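(* Let $P$ be a compact rational simple polytope with $m$ facets, with positive integer labels $c_1,\dots,c_m$ on its facets, satisfying $c_i\ge2$ for all $i=1,\dots,m$. Then for any $u\in\mathrm{Int}(P)$, the Lagrangian torus fiber $L(u)=\mu_T^{-1}(u)$ of the symplectic toric orbifold $\mathcal X$ corresponding to the labeled polytope is non-displaceable.
   Context: **Symplectic toric orbifold of a labeled polytope.** Let $N=\mathbb Z^n$ and $M=\mathrm{Hom}(N,\mathbb Z)$. $P\subset M_{\mathbb R}\cong(\mathbb R^n)^*$ is a compact convex polytope which is simple (exactly $n$ facets meet at each vertex) and rational (each facet has a normal vector in $N$). Let $\boldsymbol v_j\in N$ be the primitive inward normal of the $j$-th facet, $\boldsymbol b_j=c_j\boldsymbol v_j$, and write $P=\{u\mid\langle u,\boldsymbol b_j\rangle\ge\lambda_j,\ j=1,\dots,m\}$. Let $\pi:\mathbb R^m\to\mathbb R^n$, $e_j\mapsto\boldsymbol b_j$; it induces $T^m\to T^n$ with kernel $K$; let $\iota:\mathrm{Lie}(K)\to\mathbb R^m$ be the inclusion. With $\omega_0=\frac i2\sum dz_k\wedge d\bar z_k$ on $\mathbb C^m$ and $\mu_K=\iota^*\circ\frac12(|z_1|^2,\dots,|z_m|^2)$, the symplectic toric orbifold is $\mathcal X=\mu_K^{-1}(\iota^*(-\lambda))/K$, $\lambda=(\lambda_1,\dots,\lambda_m)$. The residual action of $T^n=T^m/K$ has moment map $\mu_T:\mathcal X\to P$, and $L(u)=\mu_T^{-1}(u)$. **Non-displaceability.** A smooth function on the orbifold $\mathcal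 X$ is a function whose lifts to all uniformizing charts are smooth; a (time-dependent) Hamiltonian function $H$ has a Hamiltonian vector field defined on charts by $i_{X_{\tilde H}}\omega=d\tilde H$ and generates a Hamiltonian isotopy $\psi^H_t$ of $\mathcal X$. $L$ is non-displaceable if $L\cap\psi^H_1(L)\neq\emptyset$ for every such $H$. *)

(* Defs.v *)
From HB Require Import structures.
From mathcomp Require Import all_boot all_order all_algebra.
From mathcomp Require Import complex.
From mathcomp Require Import all_classical all_reals all_analysis.
Set Implicit Arguments.
Unset Strict Implicit.
Unset Printing Implicit Defensive.
Import Order.TTheory GRing.Theory Num.Theory numFieldNormedType.Exports.
Local Open Scope classical_set_scope.
Local Open Scope ring_scope.

Fixpoint C_class (R : realType) (V W : normedModType R) (r : nat)
    (U : set V) (f : V -> W) : Prop :=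
  if r is r'.+1 then
    (forall x, U x -> differentiable f x) /\
    (forall v, C_class r' U (fun x => 'd f x v))
  else forall x, U x -> {for x, continuous f}.

(* Only used for finite-dimensional V and open U, where differentiability
   together with C^r directional differentials is the usual C^{r+1}. *)
Definition smooth_on (R : realType) (V W : normedModType R)
    (U : set V) (f : V -> W) : Prop :=
  forall r, C_class r U f.

Section Polytopes.
Context {R : realType} {n : nat}.
Implicit Types (P F : set 'rV[R]_n) (u a : 'rV[R]_n).

Definition pairing u a : R := \sum_(i < n) u 0 i * a 0 i.

Definition is_polytope P : Prop :=
  exists k (x : 'I_k -> 'rV[R]_n),
    P = [set \sum_i w i *: x i | w in
          [set w : 'I_k -> R | (forall i, 0 <= w i) /\ \sum_i w i = 1]].

Definition is_face P F : Prop :=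
  exists a, F = [set u | P u /\ forall u', P u' -> pairing u a <= pairing u' a].

Definition affine_dim F (d : nat) : Prop :=
  exists p (D : 'M[R]_(d, n)),
    [/\ F p, row_free D, forall i, F (p + row i D)
      & forall u, F u -> (u - p <= D)%MS].

Definition is_facet P F : Prop :=
  is_face P F /\ exists2 d, affine_dim F d & d.+1 = n.

Definition is_vertex P u : Prop := is_face P [set u].

Definition primitive (v : 'rV[int]_n) : Prop :=
  \big[gcdn/0%N]_(i < n) absz (v 0 i) = 1%N.

End Polytopes.

Definition to_real (R : realType) (n : nat) (v : 'rV[int]_n) : 'rV[R]_n :=
  map_mx intr v.

Section LabeledPolytope.
Context {R : realType} {n m : nat}.
Variables (P : set 'rV[R]_n) (v : 'I_m -> 'rV[int]_n) (c : 'I_m -> nat)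
  (lambda : 'I_m -> R).

Definition labeled_normal (j : 'I_m) : 'rV[int]_n := (c j)%:Z *: v j.

Definition facet_of (j : 'I_m) : set 'rV[R]_n :=
  [set u | P u /\ pairing u (to_real R (labeled_normal j)) = lambda j].

(* [j |-> facet_of j] is a bijection from 'I_m onto the facets of P; since P
   is n-dimensional and lies in the half-spaces of [lp_halfspaces], v j is then
   the primitive inward normal of the j-th facet, and lambda is determined by
   P and c. *)
Record labeled_simple_polytope : Prop := LabeledSimplePolytope {
  lp_polytope : is_polytope P ;
  lp_dim : affine_dim P n ;
  lp_primitive : forall j, primitive (v j) ;
  lp_label : forall j, (0 < c j)%N ;
  lp_halfspaces : P =
    [set u | forall j, lambda j <= pairing u (to_real R (labeled_normal j))] ;
  lp_facet : forall j, is_facet P (facet_of j) ;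
  lp_facet_inj : injective facet_of ;
  lp_facet_surj : forall F, is_facet P F -> exists j, F = facet_of j ;
  lp_simple : forall u, is_vertex P u -> #|[pred j | `[< facet_of j u >]]| = n
}.

End LabeledPolytope.

Section ComplexSpace.
Context {R : realType} {m : nat}.

(* z : 'rV[R]_(m + m) stands for the point (x_j + i y_j)_j of C^m, with
   (x_j) the first m coordinates and (y_j) the last m. *)
Definition zcoord (z : 'rV[R]_(m + m)) (j : 'I_m) : R[i] :=
  (z 0 (lshift m j) +i* z 0 (rshift m j))%C.

Definition of_zcoord (f : 'I_m -> R[i]) : 'rV[R]_(m + m) :=
  row_mx (\row_j complex.Re (f j)) (\row_j complex.Im (f j)).

Definition half_normsq (z : 'rV[R]_(m + m)) (j : 'I_m) : R :=
  ((z 0 (lshift m j)) ^+ 2 + (z 0 (rshift m j)) ^+ 2) / 2.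

(* (i/2) \sum_k dz_k /\ d(conj z_k) = \sum_k dx_k /\ dy_k *)
Definition omega0 (a b : 'rV[R]_(m + m)) : R :=
  \sum_(k < m) (a 0 (lshift m k) * b 0 (rshift m k)
              - a 0 (rshift m k) * b 0 (lshift m k)).

Definition torus : set ('I_m -> R[i]) := [set g | forall j, `|g j| = 1].

Definition torus_act (g : 'I_m -> R[i]) (z : 'rV[R]_(m + m)) :
    'rV[R]_(m + m) :=
  of_zcoord (fun j => g j * zcoord z j).

(* d/ds at s = 0 of (e^{i s xi_j} z_j)_j *)
Definition torus_inf_act (xi : 'I_m -> R) (z : 'rV[R]_(m + m)) :
    'rV[R]_(m + m) :=
  of_zcoord (fun j => 'i%C * (xi j)%:C%C * zcoord z j).

End ComplexSpace.

Section ToricOrbifold.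
Context {R : realType} {n m : nat}.
Variables (b : 'I_m -> 'rV[int]_n) (lambda : 'I_m -> R).

Definition pi_lin (xi : 'I_m -> R) : 'rV[R]_n :=
  \sum_j xi j *: to_real R (b j).

(* the homomorphism T^m -> T^n induced by pi, with T^k = U(1)^k *)
Definition pi_torus (g : 'I_m -> R[i]) : 'I_n -> R[i] :=
  fun i => \prod_j g j ^ b j 0 i.

Definition torusK : set ('I_m -> R[i]) :=
  [set g | torus g /\ pi_torus g = (fun=> 1)].

Definition LieK : set ('I_m -> R) := [set xi | pi_lin xi = 0].

(* the level set mu_K^{-1}(iota^*(-lambda)); both sides of the equation are
   evaluated at xi in Lie(K) *)
Definition level_set : set 'rV[R]_(m + m) :=
  [set z | forall xi, LieK xi ->
     \sum_j half_normsq z j * xi j = \sum_j (- lambda j) * xi j].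

Definition orbit (z : 'rV[R]_(m + m)) : set 'rV[R]_(m + m) :=
  [set torus_act g z | g in torusK].

(* points of the orbifold are K-orbits in the level set *)
Definition toric_orbifold : set (set 'rV[R]_(m + m)) := orbit @` level_set.

(* the u with pi^*(u) = |z|^2/2 + lambda for z in the orbit p *)
Definition mu_T (p : set 'rV[R]_(m + m)) : 'rV[R]_n :=
  xget 0 [set u | forall z, p z ->
     forall j, pairing u (to_real R (b j)) = half_normsq z j + lambda j].

Definition torus_fiber (u : 'rV[R]_n) : set (set 'rV[R]_(m + m)) :=
  [set p | toric_orbifold p /\ mu_T p = u].

(* Uniformizing charts of the quotient orbifold, given by slices: [ch_map]
   embeds [ch_dom] in the level set, transversally to the K-orbits (of
   complementary dimension m - n), so that orbit \o ch_map identifies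
   ch_dom / ch_group with an open subset of the orbifold; ch_group acts on
   ch_dom through ch_map. *)
Record uniformizing_chart := UniformizingChart {
  ch_dom : set 'rV[R]_(n + n) ;
  ch_map : 'rV[R]_(n + n) -> 'rV[R]_(m + m) ;
  ch_group : set ('I_m -> R[i]) ;
  ch_dom_open : open ch_dom ;
  ch_dom_connected : connected ch_dom ;
  ch_map_smooth : smooth_on ch_dom ch_map ;
  ch_map_level : forall x, ch_dom x -> level_set (ch_map x) ;
  ch_map_inj : set_inj ch_dom ch_map ;
  ch_map_transverse : forall x w xi, ch_dom x -> LieK xi ->
    'd ch_map x w = torus_inf_act xi (ch_map x) -> w = 0 ;
  ch_group_sub : ch_group `<=` torusK ;
  ch_group_finite : finite_set ch_group ;
  ch_group1 : ch_group (fun=> 1) ;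
  ch_groupM : forall g h, ch_group g -> ch_group h ->
    ch_group (fun j => g j * h j) ;
  ch_groupV : forall g, ch_group g -> ch_group (fun j => (g j)^-1) ;
  ch_group_act : forall g x, ch_group g -> ch_dom x ->
    exists2 x', ch_dom x' & ch_map x' = torus_act g (ch_map x) ;
  ch_group_full : forall g x x', torusK g -> ch_dom x -> ch_dom x' ->
    ch_map x' = torus_act g (ch_map x) -> ch_group g
}.

Definition chart_proj (C : uniformizing_chart) (x : 'rV[R]_(n + n)) :
    set 'rV[R]_(m + m) :=
  orbit (ch_map C x).

(* The reduced form pulls back to omega0 on the level set, so its lift to the
   chart is the pullback of omega0 by the slice. *)
Definition chart_form (C : uniformizing_chart) (x a a' : 'rV[R]_(n + n)) : R :=
  omega0 ('d (ch_map C) x a) ('d (ch_map C) x a').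

Definition lift (f : set 'rV[R]_(m + m) -> R) (C : uniformizing_chart) :
    'rV[R]_(n + n) -> R :=
  f \o chart_proj C.

(* Functions on the orbifold are represented by functions on all sets of
   points of C^m, whose values outside [toric_orbifold] are irrelevant. *)
Definition smooth_hamiltonian (H : R -> set 'rV[R]_(m + m) -> R) : Prop :=
  forall C : uniformizing_chart,
    smooth_on [set tx : R * 'rV[R]_(n + n) | ch_dom C tx.2]
      (fun tx : R * 'rV[R]_(n + n) => lift (H tx.1) C tx.2).

(* a is the value at x of the vector field X with i_X omega = d(lift f C) *)
Definition hamiltonian_vector (C : uniformizing_chart)
    (f : set 'rV[R]_(m + m) -> R) (x a : 'rV[R]_(n + n)) : Prop :=
  forall w, chart_form C x a w = 'd (lift f C) x w.

Definition hamiltonian_isotopy (H : R -> set 'rV[R]_(m + m) -> R)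
    (psi : R -> set 'rV[R]_(m + m) -> set 'rV[R]_(m + m)) : Prop :=
  [/\ forall t p, toric_orbifold p -> toric_orbifold (psi t p),
      forall p, toric_orbifold p -> psi 0 p = p
    & forall p (C : uniformizing_chart) t0 x0, toric_orbifold p ->
        ch_dom C x0 -> chart_proj C x0 = psi t0 p ->
      exists2 gamma : R -> 'rV[R]_(n + n), gamma t0 = x0 &
        \forall t \near t0,
          [/\ ch_dom C (gamma t), chart_proj C (gamma t) = psi t p,
              derivable gamma t 1
            & hamiltonian_vector C (H t) (gamma t) ('D_1 gamma t)]].

Definition non_displaceable (L : set (set 'rV[R]_(m + m))) : Prop :=
  forall H psi, smooth_hamiltonian H -> hamiltonian_isotopy H psi ->
    (L `&` psi 1 @` L) !=set0.

End ToricOrbifold.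

(* Main.v *)
From HB Require Import structures.
From mathcomp Require Import all_boot all_order all_algebra all_fingroup.
From mathcomp Require Import zify ring lra.
From mathcomp Require Import complex.
From mathcomp Require Import all_classical all_reals all_analysis.
Require Import Defs.
Set Implicit Arguments.
Unset Strict Implicit.
Unset Printing Implicit Defensive.

(* Since all labels are at least 2, every facet of P is a mirror of the
   orbifold: near it, in a uniformizing chart, Hamiltonians are invariant under
   a nontrivial rotation in the normal plane, so their flows preserve the
   preimage of the facet. Hence a Hamiltonian isotopy restricts to the regular
   part Int(P) x T^n, where action-angle coordinates (u, theta) turn it into the
   flow of u' = dK/dtheta, theta' = - dK/du, with K periodic in theta. It remains
   to find a trajectory that starts and ends on {u} x T^n.

   Cut K off near the boundary and discretize time by the symplectic Euler
   scheme. The discrete trajectories from {u} x T^n to itself are the critical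
   points of a discrete action, the sum of a hyperbolic quadratic form and a
   bounded function with bounded gradient. Such a function has almost critical
   points: otherwise gradient descent would lower it indefinitely on the whole
   negative space of the form, whereas degree theory (in the combinatorial
   guise of Kuhn's lemma) shows that the descended negative space always meets
   the positive space, where the function is bounded below. As the time step
   and the cut-off tend to 0, the initial angles accumulate, and the true
   trajectory from the limit angle, which stays in Int(P), is approximated by
   the discrete ones; so it returns to {u} x T^n. *)

(** * Kuhn's lemma *)

(** With p = u - u_0 and q = theta, the condition p_0 = p_N = 0 turns the discrete symplectic term
    into the pairing of the increments q_(j+1) - q_j with p_(j+1). The initial angle q_0 is a
    degenerate direction in which nothing is coercive, so exact critical points are not sought.
    Almost critical ones suffice, because the error allowed in a step is chosen after the number of
    steps and the Euler scheme is stable under such errors. Nothing is claimed about where the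
    discrete trajectories go in general: they may wander into the region of the cut-off. Only the
    true trajectory from the limit angle is controlled. On [0, 1] it has a tube with slacks bounded
    below, inside which a late enough cut-off is inactive, and the scheme started near it cannot
    leave this tube. The confinement to Int(P) is where the labels enter: at a facet of label 1 the
    group of rotations is trivial and a trajectory may run into the facet. Since an isotopy is
    specified only through local lifts to charts, trajectories in action-angle coordinates must also
    be glued, up to translations of the angles by periods. *)

Lemma odd_card_invol (T : finType) (A : {set T}) (f : T -> T) :
  {in A, forall x, f x \in A} -> {in A, involutive f} ->
  {in A, forall x, f x != x} -> ~~ odd #|A|.
Proof.
move: {2}#|A| (leqnn #|A|) => k; elim: k A => [|k IHk] A leAk fA ff fx.
  by move: leAk; rewrite leqn0 => /eqP ->.
have [->|[x xA]] := set_0Vmem A; first by rewrite cards0.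
have fxA := fA _ xA.
rewrite (cardsD1 x) xA (cardsD1 (f x)) !inE fxA fx //= negbK.
apply: IHk.
- by move: leAk; rewrite (cardsD1 x) xA (cardsD1 (f x)) !inE fxA fx //=; lia.
- move=> y; rewrite !inE => /and3P[y1 y2 yA]; rewrite fA // andbT.
  apply/andP; split; first by apply: contra y2 => /eqP e; rewrite -(ff y) // e ff.
  by apply: contra y1 => /eqP e; rewrite -(ff y) // e.
- by move=> y; rewrite !inE => /and3P[_ _ yA]; exact: ff.
- by move=> y; rewrite !inE => /and3P[_ _ yA]; exact: fx.
Qed.

Section Doors.
Variables (d : nat) (lab : 'I_d.+1 -> 'I_d.+1).

(** Here [i] stands for the facet opposite to the vertex [i]. The facet has d vertices for the d
    labels other than [ord_max], so on a door each of these labels occurs exactly once and [ord_max]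
    does not occur. *)
Definition is_door (i : 'I_d.+1) :=
  [forall c : 'I_d.+1, (c != ord_max) ==>
     [exists k : 'I_d.+1, (k != i) && (lab k == c)]].
Definition is_full := [forall c : 'I_d.+1, exists k : 'I_d.+1, lab k == c].

Lemma is_doorP i : reflect (forall c, c != ord_max -> exists2 k, k != i & lab k = c)
  (is_door i).
Proof.
apply: (iffP forallP) => [h c cm|h c].
  by move: (h c); rewrite cm => /existsP[k /andP[ki /eqP]]; exists k.
by apply/implyP => /h [k ki <-]; apply/existsP; exists k; rewrite ki eqxx.
Qed.

(** A full simplex has one door, opposite to the vertex labelled [ord_max]. In a simplex that is not
    full, if the facet opposite to [i0] is a door, the label of [i0] is repeated by exactly one
    vertex [k0] of the door, and the doors are those opposite to [i0] and to [k0]. *)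
Lemma odd_doors : odd #|[set i | is_door i]| = is_full.
Proof.
have [full|nfull] := boolP is_full.
  have inj : injective lab.
    suff h : {in [set: 'I_d.+1] &, injective lab} by move=> x y; apply: h; rewrite inE.
    apply/imset_injP; rewrite (_ : lab @: _ = [set: 'I_d.+1]) //.
    apply/setP => c; rewrite inE; apply/imsetP.
    by move/forallP: full => /(_ c) /existsP[k /eqP <-]; exists k.
  suff -> : [set i | is_door i] = [set i | lab i == ord_max].
    have /existsP[k /eqP kE] := forallP full ord_max.
    rewrite (_ : [set i | _] = [set k]) ?cards1 //.
    by apply/setP => i; rewrite !inE -kE (inj_eq inj).
  apply/setP => i; rewrite !inE; apply/is_doorP/eqP => [h|h c cm].
    apply/eqP; apply: contraT => /h [k ki /inj e].
    by rewrite e eqxx in ki.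
  have /existsP[k /eqP kE] := forallP full c; exists k => //.
  by apply: contra cm => /eqP ki; rewrite -kE ki h.
have [->|[i0]] := set_0Vmem [set i | is_door i]; first by rewrite cards0.
rewrite inE => /is_doorP door.
have i0m : lab i0 != ord_max.
  apply: contra nfull => /eqP h; apply/forallP => c.
  have [->|/door[k _ <-]] := eqVneq c ord_max; apply/existsP; first by exists i0; rewrite h.
  by exists k.
have inj : {in [set~ i0] &, injective lab}.
  apply/imset_injP; rewrite cardsC1 card_ord /=.
  suff -> : [set lab x | x in [set~ i0]] = [set~ ord_max] by rewrite cardsC1 card_ord.
  apply/eqP; rewrite eq_sym eqEcard; apply/andP; split.
    apply/fintype.subsetP => c; rewrite !inE => /door[k ki <-].
    by apply: imset_f; rewrite !inE.
  rewrite cardsC1 card_ord; apply: leq_trans (leq_imset_card _ _) _.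
  by rewrite cardsC1 card_ord.
have [k0 k0i k0E] := door _ i0m.
rewrite (_ : [set i | _] = [set i0; k0]) ?cards2 1?eq_sym ?k0i //.
apply/setP => i; rewrite !inE; apply/is_doorP/orP => [h|[/eqP-> //|/eqP-> c cm]].
  have [->|ii0] := eqVneq i i0; first by left.
  right; have iNm : lab i != ord_max.
    apply: contra nfull => /eqP hm; apply/forallP => c.
    have [->|/door[k _ <-]] := eqVneq c ord_max; apply/existsP; first by exists i; rewrite hm.
    by exists k.
  have [k ki kE] := h _ iNm.
  have [ki0|ki0] := eqVneq k i0; last first.
    by move: ki; rewrite (inj _ _ _ _ kE) ?inE // eqxx.
  by apply/eqP; apply: inj; rewrite ?inE // k0E -kE ki0.
have [k ki kE] := door _ cm.
have [kk0|kk0] := eqVneq k k0; last by exists k.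
by exists i0; rewrite 1?eq_sym // -k0E -kk0.
Qed.

End Doors.

Section Kuhn.
Variables (d N : nat).
Local Notation D := d.+1.
Local Notation M := N.+1.
(* Freudenthal's triangulation of [0, M]^D: (z, r) is the simplex with vertices
   z + \sum_(r j < k) e_j, 0 <= k <= D; a facet is given by the vertex it omits,
   and [pivot] is the same facet seen from the other side. *)
Definition simplex := ({ffun 'I_D -> 'I_M} * {perm 'I_D})%type.
Definition vert (x : simplex) (k : nat) : {ffun 'I_D -> nat} :=
  [ffun j => x.1 j + (x.2 j < k)%N].

(** Cyclic shifts of the ranks of the directions. Crossing the facet that omits the first vertex
    advances the base point along the direction of rank 0, which then becomes the last one; crossing
    the facet that omits the last vertex is the reverse move. *)
Definition up_perm : {perm 'I_D} := perm (can_inj (@ordSK D)).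
Definition down_perm : {perm 'I_D} := perm (can_inj (@ord_predK D)).

Definition facet := (simplex * 'I_D.+1)%type.

(** Whether the simplex across the facet still lies in the cube. Only the facets omitting the first
    or the last vertex change the base point when crossed, so only these can lie on the boundary. *)
Definition inside (y : facet) : bool :=
  let: ((z, r), i) := y in
  if i == ord0 then [forall j, (r j == ord0) ==> ((z j).+1 < M)]
  else if i == ord_max then [forall j, (r j == ord_max) ==> (0 < z j)]
  else true.

Definition pivot (y : facet) : facet :=
  let: ((z, r), i) := y in
  if i == ord0 then
    (([ffun j => inord (z j + (r j == ord0))], (r * down_perm)%g), ord_max)
  else if i == ord_max then
    (([ffun j => inord (z j - (r j == ord_max))], (r * up_perm)%g), ord0)
  else ((z, (r * tperm (inord i.-1) (inord i))%g), i).

(** The position, in the simplex on the other side, of the vertex that was at position [k];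
    meaningful when [k] is not the omitted vertex. *)
Definition pivot_pos (y : facet) (k : nat) : nat :=
  let: ((z, r), i) := y in
  if i == ord0 then k.-1 else if i == ord_max then k.+1 else k.

Lemma val_down (a : 'I_D) : down_perm a = (if val a == 0 then d else a.-1) :> nat.
Proof.
rewrite permE /=; case: a => [[|a] /= h]; first by rewrite modn_small.
by rewrite modnDr modn_small // ltnW.
Qed.

Lemma val_up (a : 'I_D) : up_perm a = (if val a == d then 0 else a.+1) :> nat.
Proof.
rewrite permE /=; case: eqP => [->|/eqP h]; first by rewrite modnn.
by rewrite modn_small //; case: a h => a /= ? ?; lia.
Qed.

Lemma ord_cases (i : 'I_D.+1) : [\/ i = ord0, i = ord_max | 0 < i < D].
Proof.
case: i => [i hi]; have [i0|] := posnP i; first by constructor 1; apply/val_inj.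
move=> ip; have [e|ne] := eqVneq i D; first by constructor 2; apply/val_inj.
by constructor 3; move: ip ne => /=; lia.
Qed.

Lemma ord_mid (i : 'I_D.+1) : 0 < i < D ->
  ((i == ord0) = false) * ((i == ord_max) = false).
Proof. by move=> h; rewrite -!(inj_eq val_inj) /=; split; lia. Qed.

(** Consequently, two labellings that agree on the boundary of the cube have the same doors there;
    this is how a labelling is compared with the model one. *)
Lemma insideN_boundary y (k : nat) : ~~ inside y -> k != y.2 :> nat -> (k <= D) ->
  exists j, (vert y.1 k j == 0) || (vert y.1 k j == M).
Proof.
case: y => [[z r] i] /=; case: (ord_cases i) => [->|->|iD] /=; rewrite ?eqxx ?(ord_mid iD) /=.
- move=> /forallPn[j]; rewrite negb_imply => /andP[/eqP rj zj] k0 kD.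
  by exists j; rewrite ffunE /= rj /=; have := ltn_ord (z j); move: k0 => /=; lia.
- move=> /forallPn[j]; rewrite negb_imply => /andP[/eqP rj zj] k0 kD.
  by exists j; rewrite ffunE /= rj /=; lia.
- by [].
Qed.

Lemma inside_pivot y : inside y -> inside (pivot y).
Proof.
case: y => [[z r] i]; case: (ord_cases i) => [->|->|iD] /=; rewrite ?eqxx ?(ord_mid iD) /=.
- move=> /forallP h; apply/forallP => j; rewrite !ffunE permM -(inj_eq val_inj).
  move: (h j); rewrite -(inj_eq val_inj) /= val_down /=.
  case: eqP => /= e zj; first by rewrite eqxx /= inordK; lia.
  by apply/implyP; have := ltn_ord (r j); lia.
- move=> /forallP h; apply/forallP => j; rewrite !ffunE permM -(inj_eq val_inj).
  move: (h j); rewrite -(inj_eq val_inj) /= val_up /=.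
  case: eqP => /= e zj //; rewrite inordK; have := ltn_ord (z j); lia.
- by rewrite !(ord_mid iD).
Qed.

Lemma downK : (down_perm * up_perm = 1)%g.
Proof. by apply/permP => a; rewrite permM !permE /= ord_predK. Qed.

Lemma upK : (up_perm * down_perm = 1)%g.
Proof. by apply/permP => a; rewrite permM !permE /= ordSK. Qed.

Lemma pivotK y : inside y -> pivot (pivot y) = y.
Proof.
case: y => [[z r] i]; case: (ord_cases i) => [->|->|iD] /=; rewrite ?eqxx ?(ord_mid iD) /=.
- move=> /forallP h; rewrite -mulgA downK mulg1; congr (_, _, _).
  apply/ffunP => j; rewrite !ffunE permM; apply/val_inj.
  move: (h j); rewrite -!(inj_eq val_inj) /= val_down /=.
  have := ltn_ord (z j); have := ltn_ord (r j).
  by case: eqP => e /= rj zj h'; rewrite !inordK; lia.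
- move=> /forallP h; rewrite -mulgA upK mulg1; congr (_, _, _).
  apply/ffunP => j; rewrite !ffunE permM; apply/val_inj.
  move: (h j); rewrite -!(inj_eq val_inj) /= val_up /=.
  have := ltn_ord (z j); have := ltn_ord (r j).
  by case: eqP => e /= rj zj h'; rewrite !inordK; lia.
- by move=> _; rewrite !(ord_mid iD) -mulgA tperm2 mulg1.
Qed.

Lemma pivot_neq y : pivot y != y.
Proof.
case: y => [[z r] i]; case: (ord_cases i) => [->|->|iD] /=; rewrite ?eqxx ?(ord_mid iD) /=.
- by rewrite xpair_eqE andbC.
- by rewrite xpair_eqE andbC.
- rewrite !xpair_eqE !eqxx andbT /=; apply/eqP => /(congr1 (mulg r^-1)).
  rewrite mulKg mulVg => /permP/(_ (inord i)); rewrite tpermR perm1.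
  by move=> /(congr1 val); rewrite /= !inordK; lia.
Qed.

Lemma vert_pivot y (k : nat) : inside y -> k != y.2 :> nat -> k <= D ->
  vert (pivot y).1 (pivot_pos y k) = vert y.1 k.
Proof.
case: y => [[z r] i]; case: (ord_cases i) => [->|->|iD] /=; rewrite ?eqxx ?(ord_mid iD) /=.
- move=> /forallP h k0 kD; apply/ffunP => j; rewrite !ffunE permM val_down.
  move: (h j); rewrite -!(inj_eq val_inj) /= => h'.
  have := ltn_ord (z j); have := ltn_ord (r j) => h1 h2.
  by rewrite inordK; case: eqP h' => e /= h'; lia.
- move=> /forallP h k0 kD; apply/ffunP => j; rewrite !ffunE permM val_up.
  move: (h j); rewrite -!(inj_eq val_inj) /= => h'.
  have := ltn_ord (z j); have := ltn_ord (r j) => h1 h2.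
  by rewrite inordK; case: eqP h' => e /= h'; lia.
- move=> _ ki kD; apply/ffunP => j; rewrite !ffunE permM.
  by case: tpermP => [->|->|//]; rewrite !inordK /=; lia.
Qed.

Lemma pivot_posK y (k : nat) : inside y -> k != y.2 :> nat -> k <= D ->
  [/\ pivot_pos y k <= D, pivot_pos y k != (pivot y).2 :> nat & pivot_pos (pivot y) (pivot_pos y k) = k].
Proof.
case: y => [[z r] i] _; case: (ord_cases i) => [->|->|iD] /=; rewrite ?eqxx ?(ord_mid iD) /=.
- by move=> k0 kD; split; lia.
- by move=> k0 kD; split; lia.
- rewrite !(ord_mid iD).
  by move=> ki kD; split.
Qed.

Variable lab : {ffun 'I_D -> nat} -> 'I_D.+1.

Definition vlab (x : simplex) (k : 'I_D.+1) := lab (vert x k).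
Definition door (y : facet) := is_door (vlab y.1) y.2.

Lemma door_pivot_sub y : inside y -> door y -> door (pivot y).
Proof.
move=> iy /is_doorP h; apply/is_doorP => c /h [k ki kc].
have kD : k <= D by have := ltn_ord k.
have [s1 s2 _] := pivot_posK iy ki kD.
exists (inord (pivot_pos y k)).
  by apply: contra s2 => /eqP <-; rewrite inordK.
by rewrite /vlab inordK // vert_pivot // -kc.
Qed.

(** Count the pairs of a simplex and one of its doors modulo 2. Simplex by simplex, [odd_doors]
    gives the number of full simplices; door by door, [pivot] pairs off those inside the cube and
    leaves those of the boundary. *)
Lemma odd_full :
  odd #|[set x : simplex | is_full (vlab x)]| =
  odd #|[set y : facet | door y & ~~ inside y]|.
Proof.
transitivity (odd #|[set y : facet | door y]|).
  rewrite -!sum1dep_card.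
  rewrite [in RHS](eq_bigl (fun y : facet => true && is_door (vlab y.1) y.2)) //.
  rewrite -(pair_big_dep xpredT (fun x i => is_door (vlab x) i) (fun _ _ => 1)) /=.
  rewrite big_mkcond /= !(big_morph odd oddD (erefl _)); apply: eq_bigr => x _.
  by rewrite sum1dep_card odd_doors; case: is_full.
rewrite -(cardsID [set y | inside y]) oddD -[RHS]addFb; congr (_ (+) _).
  apply/negbTE/(@odd_card_invol _ _ pivot) => [y|y|y _]; rewrite ?pivot_neq //.
    rewrite !inE => /andP[dy iy]; rewrite inside_pivot // andbT.
    exact: door_pivot_sub.
  by rewrite !inE => /andP[_ /pivotK].
by congr odd; apply: eq_card => y; rewrite !inE andbC.
Qed.

End Kuhn.

(** Turns a vector of D signs into one of D + 1 labels. When all signs hold, [find] returns the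
    length D, so the label [ord_max] means that every sign is true, while a label i < D means that
    the i-th sign is false. *)
Definition first_false (D : nat) (t : 'I_D -> bool) : 'I_D.+1 :=
  inord (find (fun j => ~~ t j) (enum 'I_D)).

Lemma first_falseE D (t : 'I_D -> bool) :
  first_false t = find (fun j => ~~ t j) (enum 'I_D) :> nat.
Proof.
by rewrite inordK // ltnS (leq_trans (find_size _ _)) // size_enum_ord.
Qed.

Lemma first_false_lt D (t : 'I_D -> bool) (i : 'I_D) :
  first_false t = i :> nat -> t i = false.
Proof.
rewrite first_falseE => e.
have h : has (fun j => ~~ t j) (enum 'I_D) by rewrite has_find e size_enum_ord.
by have := nth_find i h; rewrite e nth_ord_enum => /negbTE.
Qed.

Lemma first_false_before D (t : 'I_D -> bool) (i : 'I_D) :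
  i < first_false t -> t i.
Proof.
rewrite first_falseE => /(before_find i); rewrite nth_ord_enum => /negbFE.
by [].
Qed.

Lemma first_false_le D (t : 'I_D -> bool) (i : 'I_D) :
  ~~ t i -> first_false t <= i.
Proof.
by move=> ti; rewrite leqNgt; apply: contra ti => /first_false_before.
Qed.

Lemma leq_first_false D (s t : 'I_D -> bool) :
  (forall i, s i -> t i) -> first_false s <= first_false t.
Proof.
move=> st; rewrite leqNgt; apply/negP => h.
have hD : first_false t < D by rewrite (leq_trans h) // -ltnS.
have /= := @first_false_lt _ t (Ordinal hD) (erefl _).
by rewrite st // first_false_before.
Qed.

Lemma nondecr_surj_id D (f : 'I_D -> 'I_D) :
  (forall i j : 'I_D, i <= j -> f i <= f j) -> (forall c, exists k, f k = c) ->
  forall k, f k = k.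
Proof.
move=> fm fs.
have inj : {in [set: 'I_D] &, injective f}.
  apply/imset_injP; rewrite (_ : f @: _ = [set: 'I_D]) //.
  apply/setP => c; rewrite inE; apply/imsetP.
  by have [k <-] := fs c; exists k.
have fsm (i j : 'I_D) : i < j -> f i < f j.
  move=> ij; rewrite ltn_neqAle fm ?(ltnW ij) // andbT.
  by apply/eqP => /val_inj/inj e; move: ij; rewrite e ?inE // ltnn.
have ge k (kD : k < D) : k <= f (Ordinal kD).
  elim: k kD => // k IHk kD; have kD' : k < D := ltnW kD.
  by apply: leq_ltn_trans (IHk kD') _; apply: fsm.
have le k (kD : k < D) : f (Ordinal kD) <= k.
  move: {2}(D - k) (erefl (D - k)) => e; elim: e k kD => [|e IHe] k kD he.
    by lia.
  have [kD'|] := ltnP k.+1 D; last by have := ltn_ord (f (Ordinal kD)); lia.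
  have h : f (Ordinal kD') <= k.+1 by apply: IHe; lia.
  by rewrite -ltnS (leq_trans _ h) // fsm.
by case=> k kD; apply/val_inj/eqP; rewrite eqn_leq /= ge le.
Qed.

Section KuhnLemma.
Variables (d N : nat).
Local Notation D := d.+1.
Local Notation M := N.+1.
Hypothesis M3 : 3 <= M.

(** The sign of w_i - 3/2, increasing in w; its full simplices can be listed by hand. *)
Definition ref_sign (w : {ffun 'I_D -> nat}) (i : 'I_D) : bool := 2 <= w i.

(** The coordinates increase along the vertices of a simplex, hence so do the labels. If all labels
    occur, the k-th vertex has label k, so the coordinate c passes from 1 to 2 exactly between the
    vertices c and c + 1. This determines the base point and the order of the directions. *)
Lemma ref_full (x : simplex d N) :
  is_full (vlab (fun w => first_false (ref_sign w)) x) =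
  (x == ([ffun=> inord 1], 1%g)).
Proof.
apply/idP/idP => [full0|/eqP->]; first apply/eqP.
  have full := forallP full0.
  move: full; set f := vlab _ x => full.
  have fid : forall k, f k = k.
    apply: nondecr_surj_id => [i j ij|c].
      apply: leq_first_false => a; rewrite /ref_sign !ffunE => /leq_trans; apply.
      by rewrite leq_add2l; case: ltnP => // h; rewrite (leq_trans h ij).
    by have /existsP[k /eqP] := full c; exists k.
  have key (c : 'I_D) : (x.1 c + (x.2 c < c) = 1) /\ (x.1 c + (x.2 c < c.+1) = 2).
    have h1 : (ref_sign (vert x c) c) = false.
      apply: first_false_lt; have := fid (inord c).
      by rewrite /f /vlab inordK => [-> /=|]; rewrite ?inordK; have := ltn_ord c; lia.
    have h2 : ref_sign (vert x c.+1) c.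
      apply: first_false_before; have := fid (inord c.+1).
      by rewrite /f /vlab inordK => [-> /=|]; rewrite ?inordK; have := ltn_ord c; lia.
    move: h1 h2; rewrite /ref_sign !ffunE.
    by do 2 (case: ltnP => ?); lia.
  rewrite [x]surjective_pairing; congr pair.
    apply/ffunP => c; apply/val_inj; rewrite ffunE /= inordK; last lia.
    by have [] := key c; case: ltnP => ?; case: ltnP => ?; lia.
  apply/permP => c; rewrite perm1; apply/val_inj => /=.
  by have [] := key c; case: ltnP => ?; case: ltnP => ?; lia.
apply/forallP => c; apply/existsP; exists c; apply/eqP/val_inj => /=.
have w k i : ref_sign (vert (([ffun=> inord 1], 1%g) : simplex d N) k) i = (i < k).
  by rewrite /ref_sign !ffunE /= perm1 inordK; [case: (i < k)|lia].
have [cD|cD] := ltnP c D.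
  apply/eqP; rewrite eqn_leq; apply/andP; split.
    by apply: (@first_false_le _ _ (Ordinal cD)); rewrite w /= ltnn.
  rewrite leqNgt; apply/negP => h.
  have hD := ltn_trans h cD.
  by have := @first_false_lt _ _ (Ordinal hD) (erefl _); rewrite w /= h.
apply/eqP; rewrite eqn_leq; apply/andP; split.
  by rewrite (leq_trans _ cD) // -ltnS.
rewrite leqNgt; apply/negP => h.
have hD : vlab (fun w => first_false (ref_sign w)) (([ffun=> inord 1], 1%g) : simplex d N) c < D.
  by rewrite (leq_trans h) // -ltnS.
by have := @first_false_lt _ _ (Ordinal hD) (erefl _); rewrite w /= h.
Qed.

(* The number of full simplices mod 2 only depends on the labels of the
   boundary vertices; it is compared with that of the labelling [ref_sign],
   which has exactly one. *)
Theorem kuhn (s : {ffun 'I_D -> nat} -> 'I_D -> bool) :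
  (forall (w : {ffun 'I_D -> nat}) i, w i <= 1 -> s w i = false) ->
  (forall (w : {ffun 'I_D -> nat}) i, N <= w i -> s w i) ->
  exists2 w, (forall i, s w i) &
    forall i, exists2 w', s w' i = false &
      forall j, w j <= (w' j).+1 /\ w' j <= (w j).+1.
Proof.
move=> s0 s1.
pose bd (w : {ffun 'I_D -> nat}) := [exists i, (w i == 0) || (w i == M)].
(* On the boundary of the cube [s] is replaced by the model sign, which makes the boundary doors
   those of the model. The modified sign still satisfies the two hypotheses on [s]. *)
pose s' w := if bd w then ref_sign w else s w.
have s'0 (w : {ffun 'I_D -> nat}) i : w i <= 1 -> s' w i = false.
  by move=> h; rewrite /s'; case: (bd w); rewrite ?s0 // /ref_sign; lia.
have s'1 (w : {ffun 'I_D -> nat}) i : N <= w i -> s' w i.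
  by move=> h; rewrite /s'; case: (bd w); rewrite ?s1 // /ref_sign; lia.
pose lab' w := first_false (s' w); pose lab0 w := first_false (@ref_sign w).
have : odd #|[set x : simplex d N | is_full (vlab lab' x)]|.
  rewrite odd_full.
  rewrite (_ : [set y | _ & _] = [set y : facet d N | door lab0 y & ~~ inside y]).
    rewrite -odd_full (_ : [set x | _] = [set ([ffun=> inord 1], 1%g)]) ?cards1 //.
    by apply/setP => x; rewrite !inE; apply: ref_full.
  apply/setP => y; rewrite !inE; have [|iy] := boolP (inside y); first by rewrite !andbF.
  rewrite !andbT; have e (k : 'I_D.+1) : k != y.2 -> vlab lab' y.1 k = vlab lab0 y.1 k.
    move=> ky; rewrite /vlab /lab' /s'.
    case: ifP => // /negbT /existsPn h.
    have kD : k <= D by have := ltn_ord k; rewrite ltnS.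
    have [j] := insideN_boundary (k := k) iy ky kD.
    by rewrite (negbTE (h j)).
  by apply/is_doorP/is_doorP => h c /h [k ky <-]; exists k; rewrite ?e.
have [->|[x]] := set_0Vmem [set x : simplex d N | is_full (vlab lab' x)].
  by rewrite cards0.
rewrite inE => /forallP full _.
have near (k k' : 'I_D.+1) j : vert x k j <= (vert x k' j).+1.
  by rewrite !ffunE; case: ltnP => _; case: ltnP => _; lia.
have [km kmE] : exists k : 'I_D.+1, forall i, s' (vert x k) i.
  have /existsP[k /eqP kE] := full ord_max.
  by exists k => i; apply: first_false_before; rewrite -/(lab' _) -/(vlab lab' x k) kE /=.
have ki i : exists k : 'I_D.+1, s' (vert x k) i = false.
  have /existsP[k /eqP kE] := full (widen_ord (leqnSn _) i).
  by exists k; apply: first_false_lt; rewrite -/(lab' _) -/(vlab lab' x k) kE /=.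
(* The replacement is not seen by the full simplex that was found: a vertex with a coordinate 0
   would force this coordinate to be at most 1, and its sign false, at [km]; a coordinate M would
   force the sign true at all vertices. *)
have nbd (k : 'I_D.+1) : bd (vert x k) = false.
  apply/negbTE/existsPn => i; apply/negP => /orP[/eqP h|/eqP h].
    by have := kmE i; rewrite s'0 //; have := near km k i; rewrite h.
  by have [k' ] := ki i; rewrite s'1 //; have := near k k' i; rewrite h.
exists (vert x km) => [i|i]; first by have := kmE i; rewrite /s' nbd.
have [k kE] := ki i; exists (vert x k); first by move: kE; rewrite /s' nbd.
by move=> j; split; apply: near.
Qed.

End KuhnLemma.

Import Order.TTheory GRing.Theory Num.Theory numFieldNormedType.Exports.
Local Open Scope classical_set_scope.
Local Open Scope ring_scope.

(** * Approximate zeros and critical points *)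

Section Approximate.
Variable R : realType.

Definition unif_cont (I J : Type) (G : (I -> R) -> J -> R) : Prop :=
  forall e, 0 < e -> exists2 d, 0 < d &
    forall y y', (forall i, `|y i - y' i| <= d) ->
    forall j, `|G y j - G y' j| <= e.

Lemma unif_cont_comp (I J K : Type) (F : (J -> R) -> K -> R)
    (G : (I -> R) -> J -> R) :
  unif_cont F -> unif_cont G -> unif_cont (fun y => F (G y)).
Proof.
move=> uF uG e /uF[d d0 h]; have [d' d'0 h'] := uG _ d0.
by exists d' => // y y' yy' j; apply: h => i; apply: h'.
Qed.

Lemma unif_cont_iter (I : Type) (F : (I -> R) -> I -> R) k :
  unif_cont F -> unif_cont (iter k F).
Proof.
move=> uF; elim: k => [e e0|k IHk]; first by exists e.
exact: unif_cont_comp uF IHk.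
Qed.

(* Kuhn's lemma for the signs of y + B y on a fine grid. *)
Lemma approx_zero (I : finType) (B : (I -> R) -> I -> R) (C : R) :
  (forall y i, `|B y i| <= C) -> unif_cont B ->
  forall e, 0 < e -> exists y, forall i, `|y i + B y i| <= e.
Proof.
move=> BC uB e e0.
have [d dE] : exists d, d = #|I| by exists #|I|.
case: d dE => [dE|d dE].
  by exists (fun=> 0) => i; have := fintype0 i (esym dE).
pose rk (i : I) : 'I_d.+1 := cast_ord (esym dE) (enum_rank i).
pose ev (j : 'I_d.+1) : I := enum_val (cast_ord dE j).
have rkK : cancel rk ev by move=> i; rewrite /rk /ev cast_ordKV enum_rankK.
have evK : cancel ev rk by move=> i; rewrite /rk /ev enum_valK cast_ordK.
have [d0 d00 hd] := uB (e / 2) (divr_gt0 e0 (ltr0n _ 2)).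
pose h := Num.min d0 (e / 2).
have h0 : 0 < h by rewrite /h lt_min d00 /=; lra.
have hd0 : h <= d0 by rewrite /h ge_min lexx.
have he : h <= e / 2 by rewrite /h ge_min lexx orbT.
(* The offset places w_i <= 1 at y_i <= - C - h and, with the choice of [N] below, w_i >= N at y_i
   >= C + h; there the bound on [B] decides the sign of y_i + B y i. *)
pose y (w : {ffun 'I_d.+1 -> nat}) i : R := h * (w (rk i))%:R - C - 2 * h.
pose s w j := 0 <= y w (ev j) + B (y w) (ev j).
pose N := ((Num.bound (2 * C / h)).+1 + 3)%N.
have C0 : 0 <= C by apply: le_trans (BC (fun=> 0) (ev ord0)).
have NC : 2 * C <= h * (N%:R - 3).
  have : 2 * C / h < (Num.bound (2 * C / h))%:R.
    by apply: archi_boundP; rewrite divr_ge0 ?mulr_ge0 // ltW.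
  by rewrite ltr_pdivrMr // => h1; rewrite /N natrD addrK -natr1; lra.
have BN y' i : - C <= B y' i <= C by have := BC y' i; rewrite ler_norml.
have N3 : (2 < N.+1)%N by rewrite /N; lia.
have [||w ws ww] := kuhn N3 (s := s).
- move=> w i wi; rewrite /s leNgt; apply/negbTE/negPn.
  have /andP[_ b] := BN (y w) (ev i).
  rewrite /y evK; have : (w i)%:R <= 1 :> R by rewrite ler1n || rewrite -[1]/(1%:R) ler_nat.
  by set q := B _ _ in b *; move=> wl; nra.
- move=> w i wi; rewrite /s.
  have /andP[b _] := BN (y w) (ev i).
  rewrite {1}/y evK; have : N%:R <= (w i)%:R :> R by rewrite ler_nat.
  by set q := B _ _ in b *; move=> wl; nra.
exists (y w) => i.
have [w' w's near] := ww (rk i).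
have yw j : `|y w j - y w' j| <= h.
  rewrite (_ : _ - _ = h * ((w (rk j))%:R - (w' (rk j))%:R)); last by rewrite /y; ring.
  rewrite normrM (gtr0_norm h0) -[leRHS]mulr1 ler_pM2l // ler_norml.
  have [] := near (rk j); rewrite -!(ler_nat R) -!natr1 => *; lra.
have Bw := hd (y w) (y w') (fun j => le_trans (yw j) hd0) i.
move: (ws (rk i)) w's (yw i) Bw; rewrite /s rkK => a /negbT; rewrite -ltNge => b.
by rewrite !ler_norml => /andP[c1 c2] /andP[c3 c4]; apply/andP; split; lra.
Qed.

End Approximate.

Section ApproxCritical.
Variables (R : realType) (Q I : finType).
Local Notation T := (Q + (I + I))%type.
Local Notation xi i := (inr (inl i)).
Local Notation pp i := (inr (inr i)).

(** A form of signature (#|I|, #|I|) whose kernel is the space of the [Q]-coordinates. In the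
    application [Q] indexes the initial angle. *)
Definition hyp_form (x : T -> R) : R := \sum_i x (xi i) * x (pp i).
Definition hyp_grad (x : T -> R) (t : T) : R :=
  match t with inl _ => 0 | xi i => x (pp i) | pp i => x (xi i) end.

Lemma sum_T (F : T -> R) :
  \sum_t F t = \sum_q F (inl q) + \sum_i (F (xi i) + F (pp i)).
Proof. by rewrite big_sumType /= big_sumType /= big_split. Qed.

Lemma hyp_formD x v :
  hyp_form (fun t => x t + v t) =
  hyp_form x + \sum_t hyp_grad x t * v t + hyp_form v.
Proof.
rewrite sum_T [X in _ + (X + _)]big1 ?add0r; last by move=> *; rewrite mul0r.
by rewrite -!big_split /=; apply: eq_bigr => i _; ring.
Qed.

Lemma hyp_form_le v : hyp_form v <= \sum_t v t ^+ 2.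
Proof.
rewrite sum_T -[leLHS]add0r lerD ?sumr_ge0 // => [*|]; first exact: sqr_ge0.
by apply: ler_sum => i _; have := sqr_ge0 (v (xi i) - v (pp i));
  have := sqr_ge0 (v (xi i)); have := sqr_ge0 (v (pp i)); nra.
Qed.

Variables (f : (T -> R) -> R) (g : (T -> R) -> T -> R) (M : R).
Hypothesis f_bounded : forall x, `|f x| <= M.
Hypothesis g_bounded : forall x t, `|g x t| <= M.
Hypothesis f_diff : forall e, 0 < e -> exists2 C, 0 <= C & forall x v,
  `|f (fun t => x t + v t) - f x - \sum_t g x t * v t|
    <= e * (\sum_t `|v t|) + C * \sum_t v t ^+ 2.
Hypothesis g_unif : unif_cont g.

Let F x := hyp_form x + f x.
Let G x t := hyp_grad x t + g x t.
Let step s x (t : T) := x t - s * G x t.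

(** To first order a step lowers [F] by s times n2, the sum of the squares of the gradient. Half of
    this is kept: [s] makes the quadratic remainders of [f] and of the form cost a quarter of s n2.
    The remainder of [f] that is linear in v also costs a quarter, since |G| <= G^2 / e + e and e^2
    <= n2 bound the sum of the |G| by a multiple of n2 / e. *)
Lemma step_decr e : 0 < e -> (forall x, exists t, e < `|G x t|) ->
  exists2 s, 0 < s & forall x, F (step s x) <= F x - s * e ^+ 2 / 2.
Proof.
move=> e0 Ge; pose n : R := 1 + #|{: T}|%:R.
have n0 : 0 < n by rewrite /n ltr_wpDr ?ler0n.
have [C C0 hC] := f_diff (divr_gt0 e0 (mulr_gt0 (ltr0n _ 4) n0)).
pose s := (4 * (1 + C))^-1.
have s0 : 0 < s by rewrite /s invr_gt0; lra.
have sC : s * (1 + C) = 4^-1 by rewrite /s invfM -mulrA mulVf ?mulr1 //; lra.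
exists s => // x; pose v t := - (s * G x t).
pose n2 := \sum_t G x t ^+ 2.
have en2 : e ^+ 2 <= n2.
  have [t te] := Ge x; rewrite /n2 (bigD1 t) //= -[leLHS]addr0 lerD //.
    by rewrite -[leRHS]real_normK ?num_real // ler_sqr ?nnegrE ?(ltW e0) // ltW.
  by rewrite sumr_ge0 // => *; exact: sqr_ge0.
have n1 : \sum_t `|G x t| <= n * n2 / e.
  have -> : n * n2 / e = n2 / e + #|{: T}|%:R * (n2 / e) by rewrite /n; ring.
  apply: (@le_trans _ _ (\sum_t (G x t ^+ 2 / e + e))).
    apply: ler_sum => t _; rewrite -(real_normK (num_real (G x t))).
    set a := `|_|; have a0 : 0 <= a by exact: normr_ge0.
    rewrite -(ler_pM2r e0) mulrDl divfK ?gt_eqF //.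
    by have := sqr_ge0 (a - e); nra.
  rewrite big_split /= -mulr_suml lerD // sumr_const -[leLHS]mulr_natl ler_wpM2l //.
  by rewrite ler_pdivlMr // -expr2.
have -> : F (step s x) = F (fun t => x t + v t) by [].
have lin : \sum_t hyp_grad x t * v t + \sum_t g x t * v t = - s * n2.
  rewrite -big_split /= mulr_sumr; apply: eq_bigr => t _.
  by rewrite /v /G; ring.
have v2 : \sum_t v t ^+ 2 = s ^+ 2 * n2.
  by rewrite mulr_sumr; apply: eq_bigr => t _; rewrite /v; ring.
have v1 : \sum_t `|v t| = s * \sum_t `|G x t|.
  by rewrite mulr_sumr; apply: eq_bigr => t _; rewrite /v normrN normrM gtr0_norm.
have := hC x v; rewrite v1 v2 => /ler_normlW fv.
have qv := hyp_form_le v; rewrite v2 in qv.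
have e1 : e / (4 * n) * (s * \sum_t `|G x t|) <= s * n2 / 4.
  apply: (@le_trans _ _ (e / (4 * n) * (s * (n * n2 / e)))).
    by rewrite ler_wpM2l ?ler_wpM2l ?(ltW s0) // divr_ge0 ?(ltW e0) // mulr_ge0 ?(ltW n0).
  by rewrite le_eqVlt; apply/orP; left; apply/eqP; field; rewrite !gt_eqF.
have c1 : (1 + C) * (s ^+ 2 * n2) = s * n2 / 4.
  by rewrite -sC; ring.
have sn : s * e ^+ 2 <= s * n2 by rewrite ler_pM2l.
rewrite /F hyp_formD; lra.
Qed.

(* If all gradients of F were larger than e, then k steps of the gradient
   descent would bring F below -k up to a constant on the whole antidiagonal
   [iota y]. But a step expands [eta], on whose zeros F is bounded below, and
   [approx_zero] finds y for which [eta] of the k-th iterate almost vanishes. *)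
Lemma approx_critical e : 0 < e -> exists x, forall t,
  `|hyp_grad x t + g x t| <= e.
Proof.
move=> e0; apply: contrapT => nex.
have Ge x : exists t, e < `|G x t|.
  apply: contrapT => h; apply: nex; exists x => t; rewrite leNgt.
  by apply/negP => ht; apply: h; exists t.
have [s s0 dec] := step_decr e0 Ge.
pose iota (y : I -> R) (t : T) : R :=
  match t with inl _ => 0 | xi i => y i | pp i => - y i end.
pose eta (x : T -> R) i := x (xi i) - x (pp i).
have M0 : 0 <= M by apply: le_trans (f_bounded (fun=> 0)).
have F0 y : F (iota y) <= M.
  have := ler_normlW (f_bounded (iota y)); rewrite /F /hyp_form => h.
  rewrite -[leRHS]add0r lerD // sumr_le0 // => i _ /=.
  by have := sqr_ge0 (y i); nra.
have Fk k y : F (iter k (step s) (iota y)) <= M - k%:R * (s * e ^+ 2 / 2).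
  elim: k => [|k IHk]; first by rewrite mul0r subr0; exact: F0.
  by apply: le_trans (dec _) _; rewrite -[k.+1%:R]natr1; lra.
(* The linear part of a step sends (xi, p) to (xi - s p, p - s xi), hence multiplies [eta] by 1 + s;
   on [iota y] the value of [eta] is 2 y. The deviation from linear growth stays within a multiple
   of [c k], so it remains bounded after rescaling by [c k]. *)
pose c k : R := (1 + s) ^+ k.
have c1 k : 1 <= c k by rewrite exprn_ege1 // lerDl ltW.
have etak k y i : `|eta (iter k (step s) (iota y)) i - c k * (2 * y i)|
    <= 2 * M * (c k - 1).
  elim: k => [|k IHk]; first by rewrite /eta /c /= expr0 subrr mulr0 normr_le0; apply/eqP; ring.
  set x := iter k _ _ in IHk.
  have -> : eta (iter k.+1 (step s) (iota y)) i =
      (1 + s) * eta x i - s * (g x (xi i) - g x (pp i)).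
    by rewrite iterS -/x /eta /step /G /=; ring.
  have -> : c k.+1 = (1 + s) * c k by rewrite /c exprS.
  move: IHk; rewrite !ler_norml => /andP[a b].
  have := g_bounded x (xi i); have := g_bounded x (pp i).
  rewrite !ler_norml => /andP[p1 p2] /andP[p3 p4].
  have s1 : 0 < 1 + s by lra.
  apply/andP; split.
    have := ler_wpM2l (ltW s1) a.
    have : s * (g x (xi i) - g x (pp i)) <= s * (2 * M) by rewrite ler_pM2l //; lra.
    by lra.
  have := ler_wpM2l (ltW s1) b.
  have : s * (- 2 * M) <= s * (g x (xi i) - g x (pp i)) by rewrite ler_pM2l //; lra.
  by lra.
have ustep : unif_cont (step s).
  move=> r r0; have r1 : 0 < r / (2 * s) by rewrite divr_gt0 // mulr_gt0.
  have [d d0 hd] := g_unif r1.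
  pose d1 := Num.min d (r / (2 * (1 + s))).
  have s1 : 0 < 1 + s by lra.
  exists d1; first by rewrite /d1 lt_min d0 /= divr_gt0 // mulr_gt0.
  move=> y y' yy' t.
  have yd i : `|y i - y' i| <= d by apply: le_trans (yy' i) _; rewrite /d1 ge_min lexx.
  have yr i : `|y i - y' i| <= r / (2 * (1 + s)).
    by apply: le_trans (yy' i) _; rewrite /d1 ge_min lexx orbT.
  have hg : `|hyp_grad y t - hyp_grad y' t| <= r / (2 * (1 + s)).
    by case: t => [q|[i|i]] //=; rewrite subrr normr0 divr_ge0 ?(ltW r0) // mulr_ge0 ?(ltW s1).
  have gt := hd _ _ yd t.
  have -> : step s y t - step s y' t = (y t - y' t) - s * (hyp_grad y t - hyp_grad y' t)
      - s * (g y t - g y' t) by rewrite /step /G; ring.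
  have -> : r = r / (2 * (1 + s)) + s * (r / (2 * (1 + s))) + s * (r / (2 * s)).
    by field; rewrite !gt_eqF.
  apply: le_trans (ler_normB _ _) _; rewrite normrM (gtr0_norm s0) lerD //; last by rewrite ler_pM2l.
  apply: le_trans (ler_normB _ _) _; rewrite normrM (gtr0_norm s0) lerD //.
  by rewrite ler_pM2l.
(* Enough steps to bring [F] below - M - 1; the contradiction comes from a descended point with form
   at least - 1 and [f] at least - M. *)
have [k kM] : exists k, 2 * M + 1 < k%:R * (s * e ^+ 2 / 2).
  have se : 0 < s * e ^+ 2 / 2 by rewrite divr_gt0 // mulr_gt0 // exprn_gt0.
  exists (Num.bound ((2 * M + 1) / (s * e ^+ 2 / 2))).
  by rewrite -ltr_pdivrMr // archi_boundP // divr_ge0 ?(ltW se) //; lra.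
have ck := c1 k; have ck0 : 0 < c k by lra.
(* Chosen so that y + B y is [eta] of the descended point divided by 2 c_k; [etak] bounds [B] by
   M. *)
pose B y i := eta (iter k (step s) (iota y)) i / (2 * c k) - y i.
have uB : unif_cont B.
  move=> r r0; have r1 : 0 < r / 2 by lra.
  have [d d0 hd] := unif_cont_iter k ustep r1.
  pose d1 := Num.min d (r / 2).
  exists d1; first by rewrite /d1 lt_min d0.
  move=> y y' yy' i.
  have yr : `|y i - y' i| <= r / 2.
    by apply: le_trans (yy' i) _; rewrite /d1 ge_min lexx orbT.
  have yd t : `|iota y t - iota y' t| <= d.
    have yd' j : `|y j - y' j| <= d by apply: le_trans (yy' j) _; rewrite /d1 ge_min lexx.
    case: t => [q|[j|j]] //=; first by rewrite subrr normr0 ltW.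
    by rewrite -opprD normrN.
  have h := hd _ _ yd.
  have hx := h (xi i); have hp := h (pp i).
  rewrite /B /eta.
  set a := iter k _ _ in hx hp *; set b := iter k _ _ in hx hp *.
  rewrite (_ : _ - _ = ((a (xi i) - b (xi i)) - (a (pp i) - b (pp i))) / (2 * c k) - (y i - y' i)); last by ring.
  rewrite (_ : r = r / 2 + r / 2); last by field.
  apply: le_trans (ler_normB _ _) _; rewrite lerD // normrM normfV.
  rewrite (gtr0_norm (mulr_gt0 _ ck0)) // ler_pdivrMr ?mulr_gt0 //.
  apply: le_trans (ler_normB _ _) _; nra.
have BC y i : `|B y i| <= M.
  rewrite (_ : B y i = (eta (iter k (step s) (iota y)) i - c k * (2 * y i)) / (2 * c k)).
    rewrite normrM normfV (gtr0_norm (mulr_gt0 _ ck0)) // ler_pdivrMr ?mulr_gt0 //.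
    by apply: le_trans (etak k y i) _; nra.
  by rewrite /B; field; rewrite gt_eqF.
pose n : R := 1 + #|I|%:R.
have n0 : 0 < n by rewrite /n ltr_wpDr ?ler0n.
(* This accuracy gives |eta_i| <= 1/n at the point found. As xi p = ((xi + p)^2 - eta^2) / 4, the
   form is then at least - 1. *)
have r0 : 0 < (2 * c k * n)^-1 by rewrite invr_gt0 mulr_gt0 // mulr_gt0.
have [y hy] := approx_zero BC uB r0.
have := Fk k y; set x := iter k _ _.
have etax i : eta x i ^+ 2 <= n^-1 ^+ 2.
  rewrite -(real_normK (num_real (eta x i))) ler_sqr ?nnegrE ?invr_ge0 ?(ltW n0) //.
  have := hy i; rewrite /B -/x addrC subrK normrM normfV (gtr0_norm (mulr_gt0 _ ck0)) //.
  by rewrite ler_pdivrMr ?mulr_gt0 // invfM mulrAC mulVf ?mul1r ?gt_eqF // mulr_gt0.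
have hq : - 1 <= hyp_form x.
  apply: (@le_trans _ _ (\sum_(i : I) - (n^-1 ^+ 2 / 4))); last first.
    apply: ler_sum => i _; have := etax i; rewrite /eta.
    by have := sqr_ge0 (x (xi i) + x (pp i)); nra.
  rewrite sumr_const -[leRHS]mulr_natl mulrN lerN2.
  have nn : #|I|%:R <= n by rewrite /n lerDr.
  have n1 : n^-1 <= 1 by rewrite invf_le1 // /n lerDl.
  have i0 : 0 < n^-1 by rewrite invr_gt0.
  apply: (@le_trans _ _ (n * (n^-1 ^+ 2 / 4))).
    by rewrite ler_wpM2r // divr_ge0 // sqr_ge0.
  by rewrite expr2 !mulrA mulfV ?gt_eqF // mul1r; lra.
have := f_bounded x; rewrite ler_norml => /andP[fM _].
by rewrite /F; lra.
Qed.

End ApproxCritical.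

(** * Discrete Hamiltonian paths *)

Lemma sqr_sum_le (R : realType) (T : finType) (a : T -> R) :
  (\sum_t a t) ^+ 2 <= #|T|%:R * \sum_t a t ^+ 2.
Proof.
rewrite expr2 big_distrlr /=.
apply: (@le_trans _ _ (\sum_i \sum_j (a i ^+ 2 + a j ^+ 2) / 2)).
  apply: ler_sum => i _; apply: ler_sum => j _.
  by have := sqr_ge0 (a i - a j); nra.
rewrite le_eqVlt; apply/orP; left; apply/eqP.
transitivity (\sum_i (#|T|%:R * a i ^+ 2 / 2 + (\sum_j a j ^+ 2) / 2)).
  apply: eq_bigr => i _; rewrite -mulr_suml big_split /= sumr_const.
  by rewrite -[_ *+ #|_|]mulr_natl mulrDl.
rewrite big_split /= -!mulr_suml -mulr_sumr sumr_const -[_ *+ #|_|]mulr_natl.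
by field.
Qed.

Section LinearPullback.
Variables (R : realType) (n : nat) (Q I : finType) (N : nat).
Local Notation S := ('I_n + 'I_n)%type.
Local Notation T := (Q + (I + I))%type.
Variables (K : nat -> (S -> R) -> R) (G : nat -> (S -> R) -> S -> R) (M : R).
Hypothesis K_bounded : forall k z, `|K k z| <= M.
Hypothesis G_bounded : forall k z s, `|G k z s| <= M.
Hypothesis K_diff : forall e, 0 < e -> exists2 C, 0 <= C & forall k z v,
  `|K k (fun s => z s + v s) - K k z - \sum_s G k z s * v s|
    <= e * (\sum_s `|v s|) + C * \sum_s v s ^+ 2.
Hypothesis G_unif : forall e, 0 < e -> exists2 d, 0 < d & forall k z z',
  (forall s, `|z s - z' s| <= d) -> forall s, `|G k z s - G k z' s| <= e.
Variables (A : nat -> S -> T -> bool) (h : R).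
Hypothesis h_gt0 : 0 < h.

(** The phase point at step k as a linear image of the unknowns. Boolean coefficients suffice: a
    position is the initial one plus a partial sum of increments, a momentum is a single unknown.
    [pull_fun] is the Hamiltonian part of the discrete action, and [pull_grad] its gradient by the
    chain rule. *)
Definition pull (x : T -> R) (k : nat) (s : S) : R := \sum_t (A k s t)%:R * x t.
Definition pull_fun (x : T -> R) : R := h * \sum_(k < N) K k (pull x k).
Definition pull_grad (x : T -> R) (t : T) : R :=
  h * \sum_(k < N) \sum_s (A k s t)%:R * G k (pull x k) s.

Let M0 : 0 <= M. Proof. exact: le_trans (K_bounded 0 (fun=> 0)). Qed.
Let cS : R := #|{: S}|%:R.
Let cT : R := #|{: T}|%:R.

Lemma pull_le x k s : `|pull x k s| <= \sum_t `|x t|.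
Proof.
apply: le_trans (ler_norm_sum _ _ _) _; apply: ler_sum => t _.
by rewrite normrM; case: A; rewrite ?normr1 ?normr0 ?mul1r ?mul0r.
Qed.

Lemma pull_fun_bounded x : `|pull_fun x| <= h * N%:R * M.
Proof.
rewrite normrM (gtr0_norm h_gt0) -mulrA ler_pM2l //.
apply: le_trans (ler_norm_sum _ _ _) _.
apply: (@le_trans _ _ (\sum_(k < N) M)); first exact: ler_sum.
by rewrite sumr_const card_ord mulr_natl.
Qed.

Lemma pull_grad_bounded x t : `|pull_grad x t| <= h * N%:R * (cS * M).
Proof.
rewrite normrM (gtr0_norm h_gt0) -mulrA ler_pM2l //.
apply: le_trans (ler_norm_sum _ _ _) _.
apply: (@le_trans _ _ (\sum_(k < N) cS * M)); last by rewrite sumr_const card_ord mulr_natl.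
apply: ler_sum => k _; apply: le_trans (ler_norm_sum _ _ _) _.
apply: (@le_trans _ _ (\sum_(s : S) M)); last by rewrite sumr_const mulr_natl.
apply: ler_sum => s _; rewrite normrM; case: A; rewrite ?normr1 ?normr0 ?mul1r ?mul0r //.
Qed.

Lemma pullD x v k : pull (fun t => x t + v t) k = (fun s => pull x k s + pull v k s).
Proof.
by apply/funext => s; rewrite /pull -big_split /=; apply: eq_bigr => t _; rewrite mulrDr.
Qed.

Lemma pull_gradE x v :
  \sum_t pull_grad x t * v t = h * \sum_(k < N) \sum_s G k (pull x k) s * pull v k s.
Proof.
under eq_bigr do rewrite /pull_grad -mulrA.
rewrite -mulr_sumr; congr (_ * _); under eq_bigr do rewrite mulr_suml.
rewrite exchange_big /=; apply: eq_bigr => k _.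
under eq_bigr do rewrite mulr_suml; rewrite exchange_big /=; apply: eq_bigr => s _.
by rewrite mulr_sumr; apply: eq_bigr => t _; ring.
Qed.

Lemma pull_fun_diff e : 0 < e -> exists2 C, 0 <= C & forall x v,
  `|pull_fun (fun t => x t + v t) - pull_fun x - \sum_t pull_grad x t * v t|
    <= e * (\sum_t `|v t|) + C * \sum_t v t ^+ 2.
Proof.
move=> e0; pose c := h * N%:R * cS + 1.
have hN : 0 <= h * N%:R by rewrite mulr_ge0 // ltW.
have cS0 : 0 <= cS by exact: ler0n.
have c0 : 0 < c by rewrite ltr_pwDr // !mulr_ge0 // ltW.
have [C C0 hC] := K_diff (divr_gt0 e0 c0).
exists (h * N%:R * cS * C * cT) => [|x v]; first by rewrite !mulr_ge0 // ltW.
set V := \sum_t `|v t|; set W := \sum_t v t ^+ 2.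
have V0 : 0 <= V by apply: sumr_ge0.
rewrite pull_gradE /pull_fun -!mulrBr -!sumrB normrM (gtr0_norm h_gt0).
have b (k : 'I_N) : `|K k (pull (fun t => x t + v t) k) - K k (pull x k)
    - \sum_s G k (pull x k) s * pull v k s| <= cS * (e / c * V + C * (cT * W)).
  rewrite pullD; apply: le_trans (hC _ _ _) _; rewrite mulrDr lerD //.
    rewrite mulrCA ler_wpM2l ?(divr_ge0 (ltW e0) (ltW c0)) //.
    apply: (@le_trans _ _ (\sum_(s : S) V)); last by rewrite sumr_const -[leLHS]mulr_natl.
    by apply: ler_sum => s _; exact: pull_le.
  rewrite mulrCA ler_wpM2l //.
  apply: (@le_trans _ _ (\sum_(s : S) cT * W)); last by rewrite sumr_const -[leLHS]mulr_natl.
  apply: ler_sum => s _; rewrite -(real_normK (num_real _)).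
  apply: (@le_trans _ _ (V ^+ 2)); first by rewrite ler_sqr ?nnegrE // pull_le.
  apply: le_trans (sqr_sum_le _) _; rewrite le_eqVlt; apply/orP; left; apply/eqP.
  by congr (_ * _); apply: eq_bigr => t _; rewrite real_normK ?num_real.
apply: (@le_trans _ _ (h * (N%:R * (cS * (e / c * V + C * (cT * W)))))).
  rewrite ler_pM2l //; apply: le_trans (ler_norm_sum _ _ _) _.
  apply: (@le_trans _ _ (\sum_(k < N) (cS * (e / c * V + C * (cT * W))))).
    by apply: ler_sum => k _.
  by rewrite sumr_const card_ord mulr_natl.
rewrite (_ : h * _ = (h * N%:R * cS) / c * (e * V) + h * N%:R * cS * C * cT * W); last by ring.
rewrite lerD2r ler_piMl ?mulr_ge0 ?(ltW e0) // ler_pdivrMr // mul1r.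
by rewrite /c lerDl.
Qed.

Lemma pull_grad_unif : unif_cont pull_grad.
Proof.
move=> e e0; pose c := h * N%:R * cS + 1.
have hN : 0 <= h * N%:R by rewrite mulr_ge0 // ltW.
have cS0 : 0 <= cS by exact: ler0n.
have c0 : 0 < c by rewrite ltr_pwDr // !mulr_ge0 // ltW.
have [d d0 hd] := G_unif (divr_gt0 e0 c0).
have cT0 : 0 <= cT by exact: ler0n.
have cT1 : 0 < cT + 1 by lra.
exists (d / (cT + 1)); first by rewrite divr_gt0.
move=> y y' yy' t; rewrite /pull_grad -mulrBr -sumrB normrM (gtr0_norm h_gt0).
apply: (@le_trans _ _ (h * (N%:R * (cS * (e / c))))).
  rewrite ler_pM2l //; apply: le_trans (ler_norm_sum _ _ _) _.
  apply: (@le_trans _ _ (\sum_(k < N) cS * (e / c))); last by rewrite sumr_const card_ord mulr_natl.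
  apply: ler_sum => k _; rewrite -sumrB; apply: le_trans (ler_norm_sum _ _ _) _.
  apply: (@le_trans _ _ (\sum_(s : S) (e / c))); last by rewrite sumr_const -[leLHS]mulr_natl.
  apply: ler_sum => s _; rewrite -mulrBr normrM.
  have := hd k (pull y k) (pull y' k) _ s; case: A; rewrite ?normr1 ?normr0 ?mul1r ?mul0r.
    apply=> s'; rewrite /pull -sumrB; under eq_bigr do rewrite -mulrBr.
    apply: le_trans (pull_le (fun t => y t - y' t) k s') _.
    apply: (@le_trans _ _ (\sum_(t : T) (d / (cT + 1)))); first exact: ler_sum.
    rewrite sumr_const -[leLHS]mulr_natl -/cT mulrA ler_pdivrMr // mulrC ler_pM2l //; lra.
  by move=> _; rewrite divr_ge0 ?ltW.
rewrite (_ : h * _ = (h * N%:R * cS) / c * e); last by ring.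
by rewrite ler_piMl ?(ltW e0) // ler_pdivrMr // mul1r /c lerDl.
Qed.

Lemma pull_critical e : 0 < e -> exists x, forall t,
  `|hyp_grad x t + pull_grad x t| <= e.
Proof.
pose M' := Num.max (h * N%:R * M) (h * N%:R * (cS * M)).
apply: (@approx_critical R Q I pull_fun pull_grad M').
- by move=> x; apply: le_trans (pull_fun_bounded x) _; rewrite /M' le_max lexx.
- by move=> x t; apply: le_trans (pull_grad_bounded x t) _; rewrite /M' le_max lexx orbT.
- exact: pull_fun_diff.
- exact: pull_grad_unif.
Qed.
End LinearPullback.

Section DiscretePath.
Variables (R : realType) (n : nat) (N' : nat).
Local Notation N := N'.+1.
Local Notation S := ('I_n + 'I_n)%type.
Variables (K : nat -> (S -> R) -> R) (G : nat -> (S -> R) -> S -> R) (M : R).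
Hypothesis K_bounded : forall k z, `|K k z| <= M.
Hypothesis G_bounded : forall k z s, `|G k z s| <= M.
Hypothesis K_diff : forall e, 0 < e -> exists2 C, 0 <= C & forall k z v,
  `|K k (fun s => z s + v s) - K k z - \sum_s G k z s * v s|
    <= e * (\sum_s `|v s|) + C * \sum_s v s ^+ 2.
Hypothesis G_unif : forall e, 0 < e -> exists2 d, 0 < d & forall k z z',
  (forall s, `|z s - z' s| <= d) -> forall s, `|G k z s - G k z' s| <= e.

Local Notation I := ('I_N' * 'I_n)%type.
Local Notation T := ('I_n + (I + I))%type.
Local Notation xi i := (inr (inl i)).
Local Notation pp i := (inr (inr i)).

(* The unknowns are [q_0] (inl), the increments [q_(j+1) - q_j] (xi) and the
   momenta [p_(j+1)] (pp), j < N'; [p_0 = p_N = 0]. *)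
Let A (k : nat) (s : S) (t : T) : bool :=
  match s, t with
  | inl i, pp (j, i') => (j == k :> nat) && (i == i')
  | inr i, inl i' => i == i'
  | inr i, xi (j, i') => (j < k)%N && (i == i')
  | _, _ => false
  end.

Let phase (p q : 'I_n -> R) (s : S) : R :=
  match s with inl i => p i | inr i => q i end.

(** Criticality in the momenta is the equation for q. Criticality in q_0 and in the increments says
    that p_l plus h times the sum of the q-derivatives from step l on almost vanishes; the equation
    for p is the difference of two consecutive such relations, whence the accuracy e / 2. *)
Lemma discrete_path h e : 0 < h -> 0 < e ->
  exists p q : nat -> 'I_n -> R,
  [/\ p 0 = (fun=> 0), p N = (fun=> 0) & forall k i, (k < N)%N ->
    let z := phase (p k.+1) (q k) in
    `|p k.+1 i - p k i - h * G k z (inr i)| <= e /\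
    `|q k.+1 i - q k i + h * G k z (inl i)| <= e].
Proof.
move=> h0 e0; have e2 : 0 < e / 2 by lra.
have [x hx] := pull_critical N K_bounded G_bounded K_diff G_unif A h0 e2.
pose Z := pull A x; pose G' k s := G k (Z k) s.
(* [insub] fails from k = N on, which gives p_N = 0. *)
pose p (k : nat) (i : 'I_n) : R :=
  if k is k'.+1 then if insub k' : option 'I_N' is Some j then x (pp (j, i)) else 0 else 0.
(* The last position is not among the unknowns: it is defined so that the last equation for q holds
   exactly. *)
pose q (k : nat) (i : 'I_n) : R :=
  if (k < N)%N then Z k (inr i) else Z N' (inr i) - h * G' N' (inl i).
have sum_delta (F : 'I_n -> R) i : \sum_i' (i == i')%:R * F i' = F i.
  rewrite (bigD1 i) //= eqxx mul1r big1 ?addr0 // => i' /negbTE.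
  by rewrite eq_sym => ->; rewrite mul0r.
have sum_pair (F : I -> R) : \sum_t F t = \sum_j \sum_i F (j, i).
  by rewrite pair_big /=; apply: eq_bigr => -[].
have Zl k i : Z k (inl i) = p k.+1 i.
  rewrite /Z /pull sum_T /= big1 ?add0r; last by move=> *; rewrite mul0r.
  under eq_bigr do rewrite mul0r add0r.
  rewrite sum_pair /p; case: insubP => [j _ jk|kN].
    rewrite (bigD1 j) //= [X in _ + X]big1 ?addr0 => [|j' jj']; last first.
      by rewrite big1 // => i' _; rewrite -jk (inj_eq val_inj) (negbTE jj') mul0r.
    under eq_bigr do rewrite jk eqxx /=; exact: (sum_delta (fun i => x (pp (j, i)))).
  rewrite big1 // => j _; rewrite big1 // => i' _.
  by rewrite (_ : (_ == _) = false) ?mul0r //; apply/eqP => jk; rewrite -jk ltn_ord in kN.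
have Zr k i : Z k (inr i) = x (inl i) + \sum_(j < N' | (j < k)%N) x (xi (j, i)).
  rewrite /Z /pull sum_T /= sum_delta; congr (_ + _).
  under eq_bigr do rewrite mul0r addr0.
  rewrite sum_pair [RHS]big_mkcond /=; apply: eq_bigr => j _.
  case: ltnP => _ /=; last by rewrite big1 // => *; rewrite mul0r.
  exact: (sum_delta (fun i => x (xi (j, i)))).
have gl i : pull_grad N G A h x (inl i) = h * \sum_(k < N) G' k (inr i).
  congr (_ * _); apply: eq_bigr => k _; rewrite big_sumType /= big1 ?add0r.
    by under eq_bigr do rewrite eq_sym; exact: (sum_delta (fun i => G' k (inr i))).
  by move=> *; rewrite mul0r.
have gx j i : pull_grad N G A h x (xi (j, i)) = h * \sum_(k < N | (j < k)%N) G' k (inr i).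
  congr (_ * _); rewrite [RHS]big_mkcond /=; apply: eq_bigr => k _.
  rewrite big_sumType /= big1 ?add0r => [|*]; last by rewrite mul0r.
  case: ltnP => _ /=; last by rewrite big1 // => *; rewrite mul0r.
  by under eq_bigr do rewrite eq_sym; exact: (sum_delta (fun i => G' k (inr i))).
have gp (j : 'I_N') i : pull_grad N G A h x (pp (j, i)) = h * G' j (inl i).
  have jN : (j < N)%N by rewrite ltnS ltnW.
  congr (_ * _); rewrite (bigD1 (Ordinal jN)) //= [X in _ + X]big1 ?addr0 => [|k kj].
    rewrite big_sumType /= [X in _ + X]big1 ?addr0 => [|*]; last by rewrite mul0r.
    under eq_bigr do rewrite eqxx /= eq_sym.
    exact: (sum_delta (fun i => G' j (inl i))).
  rewrite big_sumType /= [X in _ + X]big1 ?addr0 => [|*]; last by rewrite mul0r.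
  rewrite big1 // => i' _; rewrite (_ : (_ == _) = false) ?mul0r //.
  by apply/eqP => jk; case/eqP: kj; apply/val_inj.
exists p, q; split => //.
  by apply/funext => i; rewrite /p; case: insubP => // j; rewrite ltnn.
move=> k i kN; have -> : phase (p k.+1) (q k) = Z k.
  by apply/funext => -[j|j] /=; rewrite ?Zl // /q kN.
rewrite -/(G' k _) -/(G' k _); split; last first.
  rewrite {2}/q kN /q ltnS; move: kN; rewrite ltnS leq_eqVlt => /orP[/eqP->|kN].
    rewrite ltnn (_ : _ + _ = 0); first by rewrite normr0 ltW.
    by rewrite /G'; ring.
  rewrite kN !Zr; have := hx (pp (Ordinal kN, i)); rewrite gp /= => hk.
  have -> : \sum_(j < N' | (j < k.+1)%N) x (xi (j, i)) =
      x (xi (Ordinal kN, i)) + \sum_(j < N' | (j < k)%N) x (xi (j, i)).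
    rewrite (bigD1 (Ordinal kN)) //=; congr (_ + _).
    by apply: eq_bigl => j; rewrite ltnS -(inj_eq val_inj) /=; lia.
  rewrite (_ : _ + _ = x (xi (Ordinal kN, i)) + h * G' k (inl i)).
    by apply: le_trans hk _; lra.
  by rewrite /G'; ring.
pose Sg k := h * \sum_(l < N | (k <= l)%N) G' l (inr i).
have pS l : (l <= N)%N -> `|p l i + Sg l| <= e / 2.
  case: l => [|l] lN; first by have := hx (inl i); rewrite gl /= !add0r.
  rewrite /p; case: insubP => [j _ jl|lN'].
    by have := hx (xi (j, i)); rewrite gx /= jl.
  rewrite /Sg big_pred0 ?mulr0 ?addr0 ?normr0 ?(ltW e2) // => j.
  by have := ltn_ord j; lia.
have SgE : Sg k = h * G' k (inr i) + Sg k.+1.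
  rewrite /Sg -mulrDr; congr (_ * _); rewrite (bigD1 (Ordinal kN)) //=; congr (_ + _).
  by apply: eq_bigl => j; rewrite -(inj_eq val_inj) /=; lia.
have := pS k.+1 kN; have := pS k (ltnW kN); rewrite SgE.
by rewrite !ler_norml /G' => /andP[? ?] /andP[? ?]; apply/andP; split; lra.
Qed.

End DiscretePath.

(** * Functions of class C^r *)

Section NearDiff.
Variables (R : realType) (V W : normedModType R).

Lemma near_diff (f g : V -> W) (x : V) : (\near x, f x = g x) ->
  differentiable f x -> differentiable g x /\ 'd g x = 'd f x :> (V -> W).
Proof.
move=> fg df; have fgx := nbhs_singleton fg.
have h : g \o shift x = cst (g x) + 'd f x +o_ 0 id.
  apply/eqaddoP => e e0.
  have /eqaddoP/(_ e e0) df' := diff_locally df.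
  have fg0 : \forall y \near (0 : V), f (y + x) = g (y + x).
    by move: fg; rewrite (near_shift 0) /= subr0.
  apply: filterS2 fg0 df' => y fgy.
  change (`|f (y + x) - (f x + 'd f x y)| <= e * `|y| ->
    `|g (y + x) - (g x + 'd f x y)| <= e * `|y|).
  by rewrite fgy fgx.
have e : 'd g x = 'd f x :> (V -> W) by apply: diff_unique h; exact: diff_continuous.
split=> //; apply/diff_locallyP; rewrite e; split => //; exact: diff_continuous.
Qed.

End NearDiff.

Section CClass.
Variables (R : realType) (V : normedModType R).

Lemma C_class_sub (W : normedModType R) r (U U' : set V) (f : V -> W) :
  U' `<=` U -> C_class r U f -> C_class r U' f.
Proof.
move=> sU; elim: r f => [|r IHr] f /= => [h x /sU /h//|[h1 h2]].
by split=> [x /sU /h1//|v]; exact: IHr.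
Qed.

Lemma C_class_bigcup (W : normedModType R) (J : Type) r (U : J -> set V) (f : V -> W) :
  (forall j, C_class r (U j) f) -> C_class r (\bigcup_j U j) f.
Proof.
elim: r f => [|r IHr] f /= h; first by move=> x [j _ /h].
split=> [x [j _ Ujx]|v]; first by have [+ _] := h j; exact.
by apply: IHr => j; have [_ +] := h j; exact.
Qed.

Lemma C_classS (W : normedModType R) r (U : set V) (f : V -> W) :
  C_class r.+1 U f -> C_class r U f.
Proof.
elim: r f => [|r IHr] f [h1 h2]; first by move=> x /h1 /differentiable_continuous.
by split=> // v; exact: IHr.
Qed.

Lemma C_class_ext (W : normedModType R) r (U : set V) (f g : V -> W) : open U ->
  {in U, f =1 g} -> C_class r U f -> C_class r U g.
Proof.
move=> oU; elim: r f g => [|r IHr] f g fg /=.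
  move=> cf x Ux; have nfg : \near x, f x = g x.
    by apply: filterS (open_nbhs_nbhs (conj oU Ux)) => y Uy; apply: fg; rewrite inE.
  have gfx : g x = f x by rewrite (nbhs_singleton nfg).
  change (g @ x --> g x); rewrite gfx; apply: cvg_trans (cf x Ux).
  exact: near_eq_cvg.
move=> [h1 h2].
have key x : U x -> differentiable g x /\ 'd g x = 'd f x :> (V -> W).
  move=> Ux; apply: near_diff (h1 _ Ux).
  by apply: filterS (open_nbhs_nbhs (conj oU Ux)) => y Uy; apply: fg; rewrite inE.
split=> [x /key[]//|v]; apply: IHr (h2 v) => x; rewrite inE => Ux.
by have [_ ->] := key x Ux.
Qed.

Lemma C_class_cst (W : normedModType R) r (U : set V) (a : W) : C_class r U (fun=> a).
Proof.
elim: r a => [|r IHr] a /=; first by move=> x _; exact: cst_continuous.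
split=> [x _|v]; first exact: differentiable_cst.
rewrite (_ : (fun x => _) = (fun=> 0)) //; apply/funext => x.
by rewrite -[fun=> a]/(cst a) diff_cst.
Qed.

Lemma C_class_linear (W : normedModType R) r (U : set V) (f : {linear V -> W}) :
  continuous f -> C_class r U f.
Proof.
move=> cf; case: r => [|r] /=; first by move=> x _; exact: cf.
split=> [x _|v]; first exact: linear_differentiable.
rewrite (_ : (fun x => _) = (fun=> f v)); first exact: C_class_cst.
by apply/funext => x; rewrite diff_lin.
Qed.

Lemma C_class_lin (W : normedModType R) r (U : set V) (f : V -> W) :
  linear f -> continuous f -> C_class r U f.
Proof.
move=> lf cf; pose fM := GRing.isLinear.Build _ _ _ _ _ lf.
pose fL : {linear V -> W} := HB.pack f fM.
by rewrite -[f]/(fL : V -> W); exact: C_class_linear.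
Qed.

Lemma C_classD (W : normedModType R) r (U : set V) (f g : V -> W) : open U ->
  C_class r U f -> C_class r U g -> C_class r U (fun x => f x + g x).
Proof.
move=> oU; elim: r f g => [|r IHr] f g /=.
  by move=> cf cg x Ux; apply: continuousD; [exact: cf|exact: cg].
move=> [f1 f2] [g1 g2]; split=> [x Ux|v].
  by apply: differentiableD; [exact: f1|exact: g1].
apply: (@C_class_ext _ _ _ (fun x => 'd f x v + 'd g x v)) => //; last exact: (IHr _ _ (f2 v) (g2 v)).
move=> x; rewrite inE => Ux.
by rewrite -[fun x => _]/(f + g) diffD; [|exact: f1|exact: g1].
Qed.

Lemma C_class_sum (W : normedModType R) (J : Type) (s : seq J) (P : pred J) r
    (U : set V) (f : J -> V -> W) : open U ->
  (forall j, C_class r U (f j)) -> C_class r U (fun x => \sum_(j <- s | P j) f j x).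
Proof.
move=> oU h; elim: s => [|j s IHs].
  rewrite (_ : (fun x => _) = (fun=> 0)); first exact: C_class_cst.
  by apply/funext => x; rewrite big_nil.
rewrite (_ : (fun x => _) = (fun x => (if P j then f j x else 0) + \sum_(j <- s | P j) f j x)).
  by apply: C_classD => //; case: (P j) => //; exact: C_class_cst.
by apply/funext => x; rewrite big_cons; case: (P j); rewrite ?add0r.
Qed.

Lemma C_classM r (U : set V) (f g : V -> R) : open U ->
  C_class r U f -> C_class r U g -> C_class r U (fun x => f x * g x).
Proof.
move=> oU; elim: r f g => [|r IHr] f g.
  by move=> cf cg x Ux; apply: continuousM; [exact: cf|exact: cg].
move=> Cf Cg; have [f1 f2] := Cf; have [g1 g2] := Cg; split=> [x Ux|v].
  by apply: differentiableM; [exact: f1|exact: g1].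
apply: (@C_class_ext _ _ _ (fun x => f x * 'd g x v + g x * 'd f x v)) => //.
  move=> x; rewrite inE => Ux.
  exact: (esym (congr1 (fun h : V -> R => h v) (diffM (f1 x Ux) (g1 x Ux)))).
exact: (C_classD oU (IHr _ _ (C_classS Cf) (g2 v)) (IHr _ _ (C_classS Cg) (f2 v))).
Qed.

Lemma C_class_prod (J : Type) (s : seq J) r (U : set V) (f : J -> V -> R) : open U ->
  (forall j, C_class r U (f j)) -> C_class r U (fun x => \prod_(j <- s) f j x).
Proof.
move=> oU h; elim: s => [|j s IHs].
  rewrite (_ : (fun x => _) = (fun=> 1)); first exact: C_class_cst.
  by apply/funext => x; rewrite big_nil.
rewrite (_ : (fun x => _) = (fun x => f j x * \prod_(j <- s) f j x)).
  exact: C_classM.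
by apply/funext => x; rewrite big_cons.
Qed.

Lemma C_class_comp1 r (U : set V) (O : set R) (f : V -> R) (p : R -> R) : open U ->
  (forall x, U x -> O (f x)) -> C_class r O p -> C_class r U f ->
  C_class r U (fun x => p (f x)).
Proof.
move=> oU UO; elim: r p => [|r IHr] p.
  by move=> cp cf x Ux; apply: continuous_comp; [exact: cf|exact/cp/UO].
move=> [p1 p2] Cf; have [f1 f2] := Cf; split=> [x Ux|v].
  by apply: differentiable_comp; [exact: f1|exact/p1/UO].
apply: (@C_class_ext _ _ _ (fun x => 'd f x v * 'd p (f x) 1)) => //.
  move=> x; rewrite inE => Ux.
  have -> : 'd (fun x => p (f x)) x v = 'd p (f x) ('d f x v).
    exact: (congr1 (fun h : V -> R => h v) (diff_comp (f1 x Ux) (p1 _ (UO _ Ux)))).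
  by rewrite -[X in _ = 'd p (f x) X]mulr1 linearZ.
exact: (C_classM oU (f2 v) (IHr _ (p2 1) (C_classS Cf))).
Qed.

Lemma C_class_coord r k (U : set V) (f : V -> 'rV[R]_k) : open U ->
  (forall i, C_class r U (fun x => f x 0 i)) -> C_class r U f.
Proof.
move=> oU h; have E x : f x = \sum_i f x 0 i *: delta_mx 0 i by exact: row_sum_delta.
apply: (@C_class_ext _ _ _ (fun x => \sum_i f x 0 i *: delta_mx 0 i)) => //.
apply: C_class_sum => // i; move: (h i); set fi := fun x => f x 0 i.
rewrite -[fun x => f x 0 i *: _]/(fun x => fi x *: _).
move: fi => g {h E f}; elim: r g => [|r IHr] f.
  by move=> cf x Ux; apply: continuousZr_tmp; exact: cf.
move=> Cf; have [f1 f2] := Cf; split=> [x Ux|v].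
  by apply: differentiableZl; exact: f1.
apply: (@C_class_ext _ _ _ (fun x => 'd f x v *: delta_mx 0 i)) => //; last exact: (IHr _ (f2 v)).
move=> x; rewrite inE => Ux.
exact: (esym (congr1 (fun h : V -> 'rV[R]_k => h v) (diffZl _ (f1 x Ux)))).
Qed.

End CClass.

Section OneVariable.
Variable R : realType.

(** Reduces smoothness in one variable to naming all successive derivatives: a sequence of period 4
    for sin and cos, multiples of powers for the square root. *)
Lemma C_class_tower (O : set R) (p : nat -> R -> R) : open O ->
  (forall k x, O x -> is_derive x 1 (p k) (p k.+1 x)) ->
  forall r k, C_class r O (p k).
Proof.
move=> oO dp; elim=> [|r IHr] k.
  move=> x Ox; apply: differentiable_continuous; apply/derivable1_diffP.
  by have [] := dp k x Ox.
split=> [x Ox|v]; first by apply/derivable1_diffP; have [] := dp k x Ox.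
apply: (@C_class_ext _ _ _ _ _ (fun x => v * p k.+1 x)) => //.
  move=> x; rewrite inE => Ox; have [d1 d2] := dp k x Ox.
  have dk : differentiable (p k) x by apply/derivable1_diffP.
  by rewrite -d2 deriveE // -[in RHS](mulr1 v) linearZ.
by apply: C_classM => //; exact: C_class_cst.
Qed.

Lemma C_class_sin_cos r : C_class r setT (@sin R) /\ C_class r setT (@cos R).
Proof.
pose p (k : nat) : R -> R := match (k %% 4)%N with
  | 0 => sin | 1 => cos | 2 => fun x => - sin x | _ => fun x => - cos x end.
have dp k (x : R) : setT x -> is_derive x 1 (p k) (p k.+1 x).
  move=> _; rewrite /p.
  have -> : (k.+1 %% 4 = (k %% 4).+1 %% 4)%N by rewrite -[in RHS]addn1 modnDml addn1.
  have : (k %% 4 < 4)%N by rewrite ltn_mod.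
  case: (k %% 4)%N => [|[|[|[|//]]]] _ /=.
  - exact: is_derive_sin.
  - exact: is_derive_cos.
  - by have := is_deriveN (is_derive_sin x).
  - by have := is_deriveN (is_derive_cos x); rewrite opprK.
split; [exact: (C_class_tower openT dp r 0)|exact: (C_class_tower openT dp r 1)].
Qed.

Lemma C_class_sqrt r : C_class r [set x : R | 0 < x] Num.sqrt.
Proof.
(* The k-th derivative of x^(1/2) is c_k x^(1/2 - k), with c_k the product of the factors 1/2 - i
   for i < k. *)
pose c := fix c (k : nat) : R := if k is k'.+1 then c k' * (2^-1 - k'%:R) else 1.
pose p k x : R := c k * (x `^ (2^-1 - k%:R)).
have o0 : open [set x : R | 0 < x] by exact: open_gt.
have dp k (x : R) : [set x : R | 0 < x] x -> is_derive x 1 (p k) (p k.+1 x).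
  move=> x0; have := is_deriveZ (c k) (is_derive1_powR (2^-1 - k%:R) x0).
  rewrite /p -[k.+1%:R]natr1 opprD addrA => h; apply: is_derive_eq h _.
  by rewrite /= -mulrA.
apply: (C_class_ext o0 _ (C_class_tower o0 dp r 0)) => x; rewrite inE => x0.
by rewrite /p mul1r subr0 powR12_sqrt // ltW.
Qed.

End OneVariable.

(** * Mean value estimates and compactness *)

Section Norms.
Variable R : realType.

Lemma rV_norm_le k (x : 'rV[R]_k) (e : R) : 0 <= e ->
  (`|x| <= e) <-> (forall i, `|x 0 i| <= e).
Proof.
move=> e0; rewrite [in X in X <-> _]/Num.Def.normr /= mx_normrE; split=> [h i|h].
  by apply: le_trans h; exact: (le_bigmax _ (fun ij => `|x ij.1 ij.2|) (0, i)).
by apply/bigmax_leP; split=> // -[a i] _ /=; rewrite (ord1 a).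
Qed.

Lemma coord_le_norm k (x : 'rV[R]_k) i : `|x 0 i| <= `|x|.
Proof. exact: (rV_norm_le x (normr_ge0 x)).1. Qed.

Lemma lsub_norm k l (x : 'rV[R]_(k + l)) : `|lsubmx x| <= `|x|.
Proof. by apply/(rV_norm_le _ (normr_ge0 x)) => i; rewrite mxE coord_le_norm. Qed.

Lemma continuous_eps (V : normedModType R) (g : V -> R) p (e : R) :
  {for p, continuous g} -> 0 < e ->
  exists2 d, 0 < d & forall q, `|q - p| < d -> `|g q - g p| < e.
Proof.
move=> cg e0; have /cvgrPdist_lt/(_ _ e0) : g @ p --> g p by exact: cg.
move=> /nbhs_normP[d /= d0 h]; exists d => // q qp.
by rewrite distrC; apply: h; rewrite /= distrC.
Qed.

Lemma pair_norm_lt (V : normedModType R) (t : R) (x : V) (d : R) :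
  `|t| < d -> `|x| < d -> `|(t, x)| < d.
Proof. by move=> td xd; rewrite /Num.Def.normr /= gt_max td. Qed.

Lemma pair_norm_le (V : normedModType R) (t : R) (x : V) (d : R) :
  `|t| <= d -> `|x| <= d -> `|(t, x)| <= d.
Proof. by move=> td xd; rewrite /Num.Def.normr /= ge_max td. Qed.

End Norms.

Section MeanValue.
Variables (R : realType) (V : normedModType R).

Lemma is_derive_line (W : normedModType R) (g : R * V -> W) t (x v : V) (s : R) :
  differentiable g (t, x + s *: v) ->
  is_derive s 1 (fun s => g (t, x + s *: v)) ('d g (t, x + s *: v) (0, v)).
Proof.
move=> dg; pose F (s : R) : R * V := (t, x + s *: v).
have dF : is_diff s F (fun r => (0, r *: v)).
  have h1 : is_diff s (fun s : R => x + s *: v) (fun r => 0 + r *: v).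
    by have := @is_diffD _ _ _ _ _ _ _ s (is_diff_cst x s) (is_diff_scalel s v).
  have h2 : is_diff s F (fun r => (0, 0 + r *: v)).
    exact: (is_diff_pair (is_diff_cst t s) h1).
  by apply: is_diff_eq h2 _; apply/funext => r; rewrite add0r.
have d := differentiable_comp (@ex_diff _ _ _ _ _ _ _ dF) dg.
have dd : derivable (g \o F) s 1 by apply/derivable1_diffP.
apply: DeriveDef => //; rewrite deriveE // (diff_comp (@ex_diff _ _ _ _ _ _ _ dF) dg) /=.
by rewrite (@diff_val _ _ _ _ _ _ _ dF) scale1r.
Qed.

Lemma mean_value_line (g : R * V -> R) t (x v : V) :
  (forall s, 0 <= s <= 1 -> differentiable g (t, x + s *: v)) ->
  exists2 c, 0 <= c <= 1 &
    g (t, x + v) - g (t, x) = 'd g (t, x + c *: v) (0, v).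
Proof.
move=> dg; pose h s := g (t, x + s *: v).
have dh (s : R) : 0 <= s <= 1 -> is_derive s 1 h ('d g (t, x + s *: v) (0, v)).
  by move=> s01; apply: is_derive_line; exact: dg.
have [|||c c01] := @MVT_segment R h (fun s => 'd g (t, x + s *: v) (0, v)) 0 1.
- exact: ler01.
- by move=> s; rewrite in_itv /= => /andP[a b]; apply: dh; rewrite !ltW.
- apply: derivable_within_continuous => s; rewrite in_itv /= => /dh[+ _]; exact.
rewrite subr0 mulr1 /h scale1r scale0r addr0 => e.
by exists c => //; move: c01; rewrite in_itv.
Qed.

End MeanValue.

(** Derivatives in the space coordinates only, at fixed time. Locked so that the differential is not
    unfolded in computations. *)
HB.lock Definition pgrad (R : realType) (k : nat) (g : R * 'rV[R]_k -> R)
    (p : R * 'rV[R]_k) (i : 'I_k) : R := 'd g p (0, delta_mx 0 i).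

Section Gradient.
Variables (R : realType) (k : nat).
Implicit Types (g : R * 'rV[R]_k -> R).

Lemma diff_pgrad g p (v : 'rV[R]_k) : differentiable g p ->
  'd g p (0, v) = \sum_i pgrad g p i * v 0 i.
Proof.
move=> dg; rewrite {1}(row_sum_delta v).
have -> : (0, \sum_i v 0 i *: delta_mx 0 i) =
    \sum_i v 0 i *: ((0, delta_mx 0 i) : R * 'rV[R]_k).
  rewrite [RHS]surjective_pairing; congr pair.
    rewrite (big_morph fst (fun _ _ => erefl) erefl) big1 //= => i _; exact: mulr0.
  by rewrite (big_morph snd (fun _ _ => erefl) erefl).
by rewrite linear_sum; apply: eq_bigr => i _; rewrite linearZ mulrC pgrad.unlock.
Qed.

Lemma mean_value_grad g t (x v : 'rV[R]_k) :
  (forall s, 0 <= s <= 1 -> differentiable g (t, x + s *: v)) ->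
  exists2 c, 0 <= c <= 1 &
    g (t, x + v) - g (t, x) = \sum_i pgrad g (t, x + c *: v) i * v 0 i.
Proof.
move=> dg; have [c c01 ->] := mean_value_line dg.
by exists c => //; apply: diff_pgrad; exact: dg.
Qed.

Lemma locally_lipschitz g (U : set (R * 'rV[R]_k)) t0 x0 : open U ->
  C_class 1 U g -> U (t0, x0) ->
  exists2 d, 0 < d & exists L, forall t x y, `|t - t0| < d ->
    `|x - x0| < d -> `|y - x0| < d -> `|g (t, x) - g (t, y)| <= L * `|x - y|.
Proof.
move=> oU [dg cg] U0.
have [dU dU0 hU] : exists2 d, 0 < d & forall q, `|q - (t0, x0)| < d -> U q.
  have /nbhs_normP[d /= d0 h] := open_nbhs_nbhs (conj oU U0).
  by exists d => // q; rewrite distrC; exact: h.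
have hd i : exists d : {posnum R}, forall q, `|q - (t0, x0)| < d%:num ->
    `|pgrad g q i| <= `|pgrad g (t0, x0) i| + 1.
  have [d d0 h] := continuous_eps (cg (0, delta_mx 0 i) _ U0) ltr01.
  exists (PosNum d0) => q /h {}h; rewrite pgrad.unlock.
  rewrite -lerBlDl; apply: le_trans (lerB_dist _ _) _; exact: ltW h.
have [d hd'] := choice hd.
pose e := Num.min dU (\big[Num.min/1]_i (d i)%:num).
have e0 : 0 < e.
  rewrite /e lt_min dU0 /=; apply/bigmin_gtP; split=> // i _; exact: gt0.
exists e => //; exists (\sum_i (`|pgrad g (t0, x0) i| + 1)) => t x y tt xx yy.
have seg s : 0 <= s <= 1 -> `|(t, y + s *: (x - y)) - (t0, x0)| < e.
  move=> /andP[s0 s1]; apply: pair_norm_lt => //=.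
  have -> : y + s *: (x - y) - x0 = (1 - s) *: (y - x0) + s *: (x - x0).
    by apply/rowP => i; rewrite !mxE; ring.
  apply: le_lt_trans (ler_normD _ _) _; rewrite !normrZ !ger0_norm ?subr_ge0 //.
  case: (ltrP 0 s) => [sp|sn]; last first.
    by have -> : s = 0 by [lra]; rewrite mul0r addr0 subr0 mul1r.
  rewrite (_ : e = (1 - s) * e + s * e); last by ring.
  by rewrite ler_ltD ?ltr_pM2l // ler_wpM2l ?subr_ge0 // ltW.
have [|c c01] := @mean_value_grad g t y (x - y).
  move=> s /seg h; apply: dg; apply: hU; apply: lt_le_trans h _.
  by rewrite /e ge_min lexx.
rewrite [y + _]addrC subrK => ->.
rewrite mulr_suml; apply: le_trans (ler_norm_sum _ _ _) _; apply: ler_sum => i _.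
rewrite normrM; apply: ler_pM => //; last exact: coord_le_norm.
apply: hd'; apply: lt_le_trans (seg c c01) _.
by rewrite /e ge_min; apply/orP; right; apply: bigmin_le_cond.
Qed.

End Gradient.

Section Compactness.
Variable R : realType.

(** A positive constant that can be chosen near each point, and may be decreased there, can be
    chosen on the whole compact set: the near-covering form of compactness, applied to the filter of
    small positive numbers. *)
Lemma compact_near_pos (T : topologicalType) (C : set T) (P : R -> T -> Prop) :
  compact C ->
  (forall x, C x -> exists2 d, 0 < d & \forall x' \near x,
     forall e, 0 < e -> e <= d -> P e x') ->
  exists2 d, 0 < d & forall x, C x -> P d x.
Proof.
move=> /compact_near_coveringP cC h.
have [] := cC R (0^'+) (fun e x => P e x) _.
  move=> x /h[d d0 hd]; exists ([set x' | forall e, 0 < e -> e <= d -> P e x'], [set e | 0 < e <= d]).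
    split=> //=; near=> e; apply/andP; split; near: e; [exact: nbhs_right_gt|exact: nbhs_right_le].
  by move=> [x' e] /= [h1 /andP[h2 h3]]; exact: h1.
move=> d /= d0 hd; exists (d / 2); first by lra.
move=> x Cx; apply: (hd (d / 2)) => //=; last by lra.
by rewrite sub0r normrN gtr0_norm; lra.
Unshelve. all: by end_near. Qed.

Lemma compact_unif (V : normedModType R) (C : set V) (g : V -> R) (e : R) :
  compact C -> (forall x, C x -> {for x, continuous g}) -> 0 < e ->
  exists2 d, 0 < d & forall p, C p -> forall q, `|q - p| <= d -> `|g q - g p| <= e.
Proof.
move=> cC cg e0; apply: compact_near_pos cC _ => x Cx.
have e2 : 0 < e / 2 by lra.
have [d d0 h] := continuous_eps (cg x Cx) e2.
exists (d / 3); first by lra.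
near=> p => r r0 rd q qp.
have px : `|p - x| < d / 2.
  by rewrite distrC; near: p; apply: cvgr_dist_lt => //; lra.
have h1 : `|g p - g x| < e / 2 by apply: h; lra.
have h2 : `|g q - g x| < e / 2.
  apply: h; rewrite -(subrKA p); apply: le_lt_trans (ler_normD _ _) _; lra.
rewrite -(subrKA (g x)); apply: le_trans (ler_normD _ _) _; rewrite (distrC (g x)); lra.
Unshelve. all: by end_near. Qed.

Lemma compact_bound (V : normedModType R) (C : set V) (g : V -> R) :
  compact C -> (forall x, C x -> {for x, continuous g}) ->
  exists M, forall p, C p -> `|g p| <= M.
Proof.
move=> cC cg.
(* A bound is sought as the inverse of a positive number, so that decreasing this number weakens the
   claim, as [compact_near_pos] requires. *)
have [d d0 h] : exists2 d, 0 < d & forall x, C x -> `|g x| <= d^-1.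
  apply: compact_near_pos cC _ => x Cx.
  have [d d0 h] := continuous_eps (cg x Cx) ltr01.
  have n0 : 0 < `|g x| + 1 by rewrite ltr_wpDl.
  exists (`|g x| + 1)^-1; first by rewrite invr_gt0.
  near=> p => r r0 rd.
  have px : `|p - x| < d by rewrite distrC; near: p; exact: cvgr_dist_lt.
  apply: (@le_trans _ _ (`|g x| + 1)).
    have := h _ px; rewrite -[X in _ -> `|X| <= _](subrK (g x)) => gp.
    by apply: le_trans (ler_normD _ _) _; lra.
  by rewrite -[leLHS]invrK lef_pV2 ?posrE ?invr_gt0.
by exists d^-1.
Unshelve. all: by end_near. Qed.

End Compactness.

(** * Convergence of the Euler scheme *)

Section Euler.
Variables (R : realType) (k : nat).

Lemma is_derive_coord (f : R -> 'rV[R]_k) (t : R) (v : 'rV[R]_k) i :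
  is_derive t 1 f v -> is_derive t 1 (fun s => f s 0 i) (v 0 i).
Proof.
move=> [df dv]; have h := (derivable_mxP _ _ _).1 df.
by apply: DeriveDef => //; rewrite -dv derive_mx // mxE.
Qed.

Variables (X : R -> 'rV[R]_k -> 'rV[R]_k) (xs : R -> 'rV[R]_k) (rho L : R).
Hypotheses (rho0 : 0 < rho) (L0 : 0 < L).
Hypothesis xs_sol : forall t : R, 0 <= t <= 1 -> is_derive t 1 xs (X t (xs t)).
Hypothesis X_lip : forall (t : R) y z, 0 <= t <= 1 -> `|y - xs t| <= rho ->
  `|z - xs t| <= rho -> `|X t y - X t z| <= L * `|y - z|.
Hypothesis X_unif : forall e : R, 0 < e -> exists2 d, 0 < d & forall s t : R,
  0 <= s <= 1 -> 0 <= t <= 1 -> `|s - t| <= d -> `|X s (xs s) - X t (xs t)| <= e.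

Lemma euler_consistent (e : R) : 0 < e -> exists2 d, 0 < d & forall s h : R,
  0 <= s -> 0 < h -> s + h <= 1 -> h <= d ->
  `|xs (s + h) - xs s - h *: X s (xs s)| <= h * e.
Proof.
move=> e0; have [d d0 hd] := X_unif e0; exists d => // s h s0 h0 sh hd'.
apply/(rV_norm_le _ (ltW (mulr_gt0 h0 e0))) => i.
have [|||c cI e1] := @MVT R (fun t => xs t 0 i) (fun t => X t (xs t) 0 i) s (s + h).
- by rewrite ltrDl.
- move=> t; rewrite in_itv /= => /andP[a b]; apply: is_derive_coord; apply: xs_sol.
  by rewrite (le_trans s0 (ltW a)) (le_trans (ltW b) sh).
- apply: derivable_within_continuous => t; rewrite in_itv /= => /andP[a b].
  have [|//] := @is_derive_coord xs t _ i (xs_sol _).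
  by rewrite (le_trans s0 a) (le_trans b sh).
move: cI; rewrite in_itv /= => /andP[a b].
rewrite !mxE e1 (_ : s + h - s = h); last by ring.
rewrite mulrC -mulrBr normrM (gtr0_norm h0) ler_pM2l //.
have c01 : 0 <= c <= 1 by apply/andP; split; lra.
have s01 : 0 <= s <= 1 by apply/andP; split; lra.
have cs : `|c - s| <= d by rewrite gtr0_norm; lra.
apply: le_trans (hd c s c01 s01 cs).
by have := coord_le_norm (X c (xs c) - X s (xs s)) i; rewrite !mxE.
Qed.

(** A discrete Gronwall estimate that also does the bookkeeping of the tube. The recursion is
    assumed only while [y i] lies within [rho] of the solution; the error bound proved by induction
    keeps it there, so the next step is available. The field may be evaluated at a point [y i]
    merely close to [x i], as in the semi-implicit scheme. *)
Lemma euler_limit (e : R) : 0 < e -> exists2 eta, 0 < eta &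
  forall (N : nat) (x y : nat -> 'rV[R]_k), (0 < N)%N -> N%:R^-1 <= eta ->
  `|x 0 - xs 0| <= eta ->
  (forall i, (i < N)%N -> `|y i - x i| <= eta) ->
  (forall i, (i < N)%N -> `|y i - xs (i%:R / N%:R)| <= rho ->
     `|x i.+1 - x i - N%:R^-1 *: X (i%:R / N%:R) (y i)| <= eta / N%:R) ->
  `|x N - xs 1| <= e.
Proof.
move=> e0; pose e' := Num.min e (rho / 2); pose E := expR L.
have e'0 : 0 < e' by rewrite /e' lt_min e0 divr_gt0.
have e'e : e' <= e by rewrite /e' ge_min lexx.
have e'r : e' <= rho / 2 by rewrite /e' ge_min lexx orbT.
have E1 : 1 <= E by rewrite /E -expR0 ler_expR ltW.
have E0 : 0 < E by lra.
(* The consistency error [e1] and the perturbation [eta] are each given a quarter of [e'] after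
   amplification by exp L. As e' <= rho / 2, the scheme stays well inside the tube. *)
pose e1 := e' * L / (4 * E).
have e10 : 0 < e1 by rewrite divr_gt0 // mulr_gt0.
have [d d0 hd] := euler_consistent e10.
have L2 : 0 < 2 + L^-1 by rewrite ltr_wpDr // invr_ge0 ltW.
pose eta := Num.min d (Num.min (rho / 2) (e' / (4 * E * (2 + L^-1)))).
have eta0 : 0 < eta.
  rewrite /eta !lt_min d0 /= !divr_gt0 ?mulr_gt0 //.
have etad : eta <= d by rewrite /eta ge_min lexx.
have etar : eta <= rho / 2 by rewrite /eta !ge_min lexx orbT.
have etae : E * (eta * (2 + L^-1)) <= e' / 4.
  have : eta <= e' / (4 * E * (2 + L^-1)) by rewrite /eta !ge_min lexx !orbT.
  rewrite ler_pdivlMr ?mulr_gt0 // => h.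
  rewrite (_ : E * _ = eta * (4 * E * (2 + L^-1)) / 4); last by field; rewrite gt_eqF.
  lra.
exists eta => // N x y N0 Neta x0 yx step.
have NR0 : 0 < N%:R :> R by rewrite ltr0n.
have h0 : 0 < N%:R^-1 :> R by rewrite invr_gt0.
set h : R := N%:R^-1 in Neta h0 step *.
(* The shift that makes the recursion homogeneous: the error plus [c] grows at most by the factor 1
   + h L at each step. *)
pose c := eta + (e1 + eta) / L.
have c0 : 0 < c by rewrite /c addr_gt0 // divr_gt0 // addr_gt0.
have Ec : E * (eta + c) <= e' / 2.
  have -> : E * (eta + c) = E * (eta * (2 + L^-1)) + E * e1 / L by rewrite /c; ring.
  have -> : E * e1 / L = e' / 4 by rewrite /e1; field; rewrite !gt_eqF.
  lra.
have pow i : (i <= N)%N -> (1 + h * L) ^+ i <= E.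
  move=> iN; apply: (@le_trans _ _ (expR (h * L) ^+ i)).
    rewrite lerXn2r ?nnegrE ?expR_ge0 ?expR_ge1Dx // addr_ge0 // mulr_ge0 // ltW //.
  rewrite -expRM_natl ler_expR mulrA ler_piMl ?(ltW L0) // /h ler_pdivrMr // mul1r ler_nat //.
have main i : (i <= N)%N -> `|x i - xs (i%:R / N%:R)| + c <= (1 + h * L) ^+ i * (eta + c).
  elim: i => [|i IHi] iN; first by rewrite mul0r expr0 mul1r lerD2r.
  have {}IHi := IHi (ltnW iN).
  have [ti tiE] : exists ti : R, ti = i%:R / N%:R by exists (i%:R / N%:R).
  have t0 : 0 <= ti by rewrite tiE divr_ge0 // ltW.
  have t1 : ti + h <= 1.
    by rewrite tiE /h -[X in _ + X]mul1r -mulrDl natr1 ler_pdivrMr // mul1r ler_nat.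
  have t01 : 0 <= ti <= 1 by rewrite t0 /=; lra.
  have stepi := step i iN; rewrite -tiE in stepi IHi.
  set ei := `|x i - xs ti| in IHi.
  have eiE : ei <= e' / 2.
    have : (1 + h * L) ^+ i * (eta + c) <= E * (eta + c).
      by apply: ler_wpM2r (pow i (ltnW iN)); lra.
    lra.
  have yb : `|y i - xs ti| <= ei + eta.
    rewrite -(subrKA (x i)); apply: le_trans (ler_normD _ _) _.
    by rewrite addrC lerD // yx.
  have yr : `|y i - xs ti| <= rho by lra.
  have s1 := stepi yr.
  have l1 := X_lip t01 yr; have {}l1 := l1 (xs ti) _.
  rewrite subrr normr0 in l1; have {}l1 := l1 (ltW rho0).
  have c1 := hd ti h t0 h0 t1 (le_trans Neta etad).
  have -> : i.+1%:R / N%:R = ti + h by rewrite tiE /h -natr1 mulrDl mul1r.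
  have dec : x i.+1 - xs (ti + h) =
    (x i.+1 - x i - h *: X ti (y i)) + (x i - xs ti) + h *: (X ti (y i) - X ti (xs ti))
     - (xs (ti + h) - xs ti - h *: X ti (xs ti)).
    by apply/rowP => a; rewrite !mxE; ring.
  have : `|x i.+1 - xs (ti + h)| <= eta * h + ei + h * (L * (ei + eta)) + h * e1.
    rewrite dec; apply: le_trans (ler_normB _ _) _; rewrite lerD //.
    apply: le_trans (ler_normD _ _) _; rewrite lerD //.
      by apply: le_trans (ler_normD _ _) _; rewrite lerD.
    rewrite normrZ (gtr0_norm h0) ler_pM2l //; apply: le_trans l1 _.
    by rewrite ler_pM2l.
  have hL : 0 < 1 + h * L by rewrite addr_gt0 // mulr_gt0.
  have := IHi; rewrite -(ler_pM2l hL) [leRHS]mulrA -exprS => m1 m2.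
  apply: le_trans m1.
  have -> : (1 + h * L) * (ei + c) = ei + c + h * L * ei + h * L * eta + h * (e1 + eta).
    by rewrite /c; field; rewrite gt_eqF.
  lra.
have := main N (leqnn N); have := pow N (leqnn N).
rewrite divff ?gt_eqF // => p1 p2.
have : (1 + h * L) ^+ N * (eta + c) <= E * (eta + c) by apply: ler_wpM2r p1; lra.
lra.
Qed.

End Euler.

(** * The discrete action of a periodic Hamiltonian *)

Section CutoffStep.
Variable R : realType.

Definition pos_sqr (x : R) : R := Num.max x 0 ^+ 2.
(** On [0, 1] this is 1 - (1 - x^2)^2, joined to the constants 0 and 1 with matching first
    derivatives. Class C^1 is enough, since the discrete action is only differentiated once. *)
Definition cut_step (x : R) : R := 1 - pos_sqr (1 - pos_sqr x).

Lemma pos_sqr_derive (x : R) : is_derive x 1 pos_sqr (2 * Num.max x 0).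
Proof.
have rem h : `|pos_sqr (h + x) - pos_sqr x - 2 * Num.max x 0 * h| <= h ^+ 2.
  by rewrite ler_norml /pos_sqr; case: (ltP x 0) => a; case: (ltP (h + x) 0) => b;
    apply/andP; split; nra.
have cv : h^-1 *: (pos_sqr (h *: 1 + x) - pos_sqr x) @[h --> 0^'] --> 2 * Num.max x 0.
  apply/cvgrPdist_le => e e0; near=> h.
  have h0 : h != 0 by near: h; exact: nbhs_dnbhs_neq.
  have he : `|h| <= e by near: h; exact: dnbhs0_le.
  rewrite -normrN (_ : - _ = h^-1 * (pos_sqr (h + x) - pos_sqr x - 2 * Num.max x 0 * h)).
    rewrite normrM normfV mulrC ler_pdivrMr ?normr_gt0 //.
    apply: le_trans (rem h) _; rewrite -(real_normK (num_real h)) expr2.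
    by rewrite ler_pM2r ?normr_gt0.
  rewrite -[h *: 1]/(h * 1) mulr1 -[h^-1 *: _]/(h^-1 * _).
  by field.
apply: DeriveDef; first by apply/cvg_ex; exists (2 * Num.max x 0).
exact: cvg_lim cv.
Unshelve. all: by end_near. Qed.

Lemma C_class1_derive (f df : R -> R) : (forall x : R, is_derive x 1 f (df x)) ->
  continuous df -> C_class 1 setT f.
Proof.
move=> hf cdf; split=> [x _|v x _]; first by apply/derivable1_diffP; have [] := hf x.
rewrite (_ : (fun x => 'd f x v) = (fun x => v * df x)).
  by apply: (@continuousM _ _ (fun=> v) df); [exact: cvg_cst|exact: cdf].
apply/funext => y; have [d1 d2] := hf y.
have dd : differentiable f y by apply/derivable1_diffP.
by rewrite -d2 deriveE // -[in LHS](mulr1 v) linearZ.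
Qed.

Lemma C_class1_cut_step : C_class 1 setT cut_step.
Proof.
have c1 : C_class 1 setT pos_sqr.
  apply: C_class1_derive pos_sqr_derive _ => x.
  apply/cvgrPdist_lt => e e0; near=> y.
  have lip : `|2 * Num.max x 0 - 2 * Num.max y 0| <= 2 * `|x - y|.
    have a1 := ler_norm (x - y); have a2 := ler_norm (y - x); rewrite distrC in a2.
    by rewrite ler_norml; case: (leP x 0) => ?; case: (leP y 0) => ?; apply/andP; split; lra.
  apply: le_lt_trans lip _; rewrite -ltr_pdivlMl // mulrC.
  by near: y; apply: cvgr_dist_lt => //; lra.
have oT : open [set: R] by exact: openT.
have h (f : R -> R) : C_class 1 setT f -> C_class 1 setT (fun x => 1 - f x).
  move=> cf.
  have c' := C_classM oT (C_class_cst 1 setT (-1 : R)) cf.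
  apply: (C_class_ext oT _ (C_classD oT (C_class_cst 1 setT (1 : R)) c')) => x _.
  by rewrite mulN1r.
exact: (h _ (C_class_comp1 oT (fun _ _ => I) c1 (h _ c1))).
Unshelve. all: by end_near. Qed.

Lemma cut_step0 x : x <= 0 -> cut_step x = 0.
Proof.
move=> x0; rewrite /cut_step /pos_sqr (max_r x0) expr0n subr0 max_l ?ler01 //.
by rewrite expr1n subrr.
Qed.

Lemma cut_step1 x : 1 <= x -> cut_step x = 1.
Proof.
move=> x1; rewrite /cut_step /pos_sqr [Num.max x 0]max_l ?(le_trans ler01) //.
by rewrite max_r ?expr0n ?subr0 // subr_le0 exprn_ege1.
Qed.

End CutoffStep.

Section Periodic.
Variables (R : realType) (n : nat).
Local Notation V := 'rV[R]_(n + n).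

Definition lattice_vec (k : 'rV[int]_n) : V := row_mx 0 ((2 * pi) *: to_real R k).

Definition theta_periodic (g : R * V -> R) : Prop :=
  forall t x k, g (t, x + lattice_vec k) = g (t, x).

Lemma lattice_reduce (x : V) : exists k, `|rsubmx (x + lattice_vec k)| <= 2 * pi.
Proof.
have p0 : 0 < 2 * pi :> R by rewrite mulr_gt0 // pi_gt0.
exists (\row_i - Num.floor (rsubmx x 0 i / (2 * pi))).
apply/(rV_norm_le _ (ltW p0)) => i; rewrite mxE mxE /lattice_vec row_mxEr !mxE.
set a := x 0 _; rewrite rmorphN /=.
have h1 : (Num.floor (a / (2 * pi)))%:~R <= a / (2 * pi) by exact: floor_le.
have h2 : a / (2 * pi) < (Num.floor (a / (2 * pi)))%:~R + 1.
  by rewrite -[1]/(1%:~R) -intrD; exact: floorD1_gt.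
move: h1 h2; set f := _%:~R; rewrite ler_pdivlMr // ltr_pdivrMr // => h1 h2.
by rewrite ler_norml; apply/andP; split; lra.
Qed.

Lemma lsub_lattice (x : V) k : lsubmx (x + lattice_vec k) = lsubmx x.
Proof. by apply/rowP => i; rewrite mxE mxE /lattice_vec row_mxEl !mxE addr0. Qed.

Variables (g : R * V -> R) (B : R).
Hypothesis g_cont : forall p, {for p, continuous g}.
Hypothesis g_supp : forall t x, B < `|lsubmx x| -> g (t, x) = 0.
Hypothesis g_per : theta_periodic g.

Let Bm := Num.max B (2 * pi).
(** Modulo the periods of the angles, every point with time in [0, 1] and first half of norm at most
    [B] has a representative in this compact set. *)
Let C : set (R * V) := `[(0 : R), (1 : R)]%classic `*` [set x : V | `|x| <= Bm].

Let C_compact : compact C.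
Proof.
apply: compact_setX; first exact: segment_compact.
apply: bounded_closed_compact.
  by exists Bm; split; [exact: num_real|move=> M BM x /= xB; exact: le_trans xB (ltW BM)].
rewrite (_ : [set _ | _] = (fun x : V => `|x|) @^-1` [set y : R | y <= Bm]) //.
apply: preimage_closed; last exact: closed_le.
by move=> x _; exact: norm_continuous.
Qed.

Let in_C t (x : V) : 0 <= t <= 1 -> `|lsubmx x| <= B -> exists k, C (t, x + lattice_vec k).
Proof.
move=> t01 xB; have [k hk] := lattice_reduce x; exists k; split => //=.
have Bm0 : 0 <= Bm by rewrite le_max mulr_ge0 ?pi_ge0 ?orbT.
apply/(rV_norm_le _ Bm0) => i; rewrite -[x + _]hsubmxK lsub_lattice.
case: (split_ordP i) => j ->; rewrite ?row_mxEl ?row_mxEr.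
  by apply: le_trans (coord_le_norm _ _) _; apply: le_trans xB _; rewrite le_max lexx.
by apply: le_trans (coord_le_norm _ _) _; apply: le_trans hk _; rewrite le_max lexx orbT.
Qed.

Lemma periodic_bound : exists M, forall t x, 0 <= t <= 1 -> `|g (t, x)| <= M.
Proof.
have [M hM] := compact_bound C_compact (fun x _ => @g_cont x).
exists (Num.max M 0) => t x t01; have [xB|xB] := ltP B `|lsubmx x|.
  by rewrite g_supp // normr0 le_max lexx orbT.
by have [k /hM h] := in_C t01 xB; rewrite -(g_per t x k) le_max h.
Qed.

Lemma periodic_unif (e : R) : 0 < e -> exists2 d, 0 < d & forall t x y, 0 <= t <= 1 ->
  `|x - y| <= d -> `|g (t, x) - g (t, y)| <= e.
Proof.
move=> e0; have [d d0 hd] := compact_unif C_compact (fun x _ => @g_cont x) e0.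
exists d => // t x y t01 xy.
have key (a b : V) : `|lsubmx a| <= B -> `|a - b| <= d -> `|g (t, b) - g (t, a)| <= e.
  move=> aB ab; have [k /hd h] := in_C t01 aB.
  rewrite -(g_per t a k) -(g_per t b k); apply: h.
  have -> : (t, b + lattice_vec k) - (t, a + lattice_vec k) = (0, b - a).
    transitivity (t - t, (b + lattice_vec k) - (a + lattice_vec k)) => //.
    by rewrite subrr opprD addrACA subrr addr0.
  by apply: pair_norm_le; rewrite ?normr0 ?(ltW d0) // distrC.
have [xB|xB] := ltP B `|lsubmx x|; last by rewrite distrC key.
have [yB|yB] := ltP B `|lsubmx y|; last by apply: key => //; rewrite distrC.
by rewrite !g_supp // subrr normr0 ltW.
Qed.

End Periodic.

(* A point is (u, theta); the field is (dK/dtheta, - dK/du). *)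
HB.lock Definition ham_field (R : realType) (n : nat) (K : R * 'rV[R]_(n + n) -> R)
    (t : R) (x : 'rV[R]_(n + n)) : 'rV[R]_(n + n) :=
  row_mx (\row_i pgrad K (t, x) (rshift n i)) (- \row_i pgrad K (t, x) (lshift n i)).

Section HamField.
Variables (R : realType) (n : nat).
Local Notation V := 'rV[R]_(n + n).

Lemma ham_field_l (K : R * V -> R) t x i : ham_field K t x 0 (lshift n i) = pgrad K (t, x) (rshift n i).
Proof. by rewrite ham_field.unlock row_mxEl mxE. Qed.

Lemma ham_field_r (K : R * V -> R) t x i : ham_field K t x 0 (rshift n i) = - pgrad K (t, x) (lshift n i).
Proof. by rewrite ham_field.unlock row_mxEr mxE mxE. Qed.

Lemma rowB k (a b : 'rV[R]_k) i : (a - b) 0 i = a 0 i - b 0 i.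
Proof. by rewrite mxE mxE. Qed.

Lemma rowZ k (c : R) (a : 'rV[R]_k) i : (c *: a) 0 i = c * a 0 i.
Proof. by rewrite mxE. Qed.

Lemma ham_field_le (K K' : R * V -> R) t x t' x' (e : R) : 0 <= e ->
  (forall i, `|pgrad K (t, x) i - pgrad K' (t', x') i| <= e) ->
  `|ham_field K t x - ham_field K' t' x'| <= e.
Proof.
move=> e0 h; apply/(rV_norm_le _ e0) => i; rewrite rowB.
case: (split_ordP i) => j ->; first by rewrite !ham_field_l; exact: h.
by rewrite !ham_field_r -opprD normrN; exact: h.
Qed.

Lemma ham_field_bound (K : R * V -> R) t x (e : R) : 0 <= e ->
  (forall i, `|pgrad K (t, x) i| <= e) -> `|ham_field K t x| <= e.
Proof.
move=> e0 h; apply/(rV_norm_le _ e0) => i.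
case: (split_ordP i) => j ->; first by rewrite ham_field_l; exact: h.
by rewrite ham_field_r normrN; exact: h.
Qed.

Lemma pgrad_periodic_at (K : R * V -> R) t x k i : theta_periodic K ->
  differentiable K (t, x) -> differentiable K (t, x + lattice_vec R k) ->
  pgrad K (t, x + lattice_vec R k) i = pgrad K (t, x) i.
Proof.
move=> per d1 d2.
have E p : differentiable K p -> pgrad K p i = 'D_(0, delta_mx 0 i) K p.
  by move=> dK; rewrite pgrad.unlock -deriveE.
rewrite (E (t, x + _)) // (E (t, x)) //.
apply: (congr1 (fun F : R -> R => lim (F @ 0^'))); apply/funext => h; congr (_ *: (_ - _)).
  rewrite /= -[in RHS](per _ _ k); congr K.
  transitivity (h *: (0 : R) + t, h *: (delta_mx 0 i : V) + (x + lattice_vec R k)) => //.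
  by rewrite addrA.
exact: per.
Qed.

Lemma pgrad_periodic (K : R * V -> R) : C_class 1 setT K -> theta_periodic K ->
  forall i, theta_periodic (fun p => pgrad K p i).
Proof.
by move=> [dK _] per i t x k; apply: pgrad_periodic_at => //; exact: dK.
Qed.

Lemma pgrad_near (K K' : R * V -> R) p i : (\near p, K p = K' p) ->
  differentiable K p -> pgrad K' p i = pgrad K p i.
Proof. by move=> h dK; have [_ e] := near_diff h dK; rewrite pgrad.unlock e. Qed.

End HamField.

Section GradRemainder.
Variables (R : realType) (k : nat) (g : R * 'rV[R]_k -> R) (M : R).
Hypothesis g_smooth : C_class 1 setT g.
Hypothesis grad_bounded : forall t x i, 0 <= t <= 1 -> `|pgrad g (t, x) i| <= M.
Hypothesis grad_unif : forall e : R, 0 < e -> exists2 d, 0 < d & forall t x y i, 0 <= t <= 1 ->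
  `|x - y| <= d -> `|pgrad g (t, x) i - pgrad g (t, y) i| <= e.

(** A substitute for a bound on second derivatives, suited to a function of class C^1. For |v| <= d
    uniform continuity of the gradient gives the linear term with the small factor e. For |v| > d
    the gradient is merely bounded, but then the sum of the |v_i| exceeds d, and its square divided
    by d dominates it. *)
Lemma grad_remainder (e : R) : 0 < e -> exists2 C, 0 <= C & forall t x (v : 'rV[R]_k),
  0 <= t <= 1 ->
  `|g (t, x + v) - g (t, x) - \sum_i pgrad g (t, x) i * v 0 i|
    <= e * (\sum_i `|v 0 i|) + C * \sum_i v 0 i ^+ 2.
Proof.
move=> e0; have [d d0 hd] := grad_unif e0.
pose M' := Num.max M 0; have M'0 : 0 <= M' by rewrite le_max lexx orbT.
have C0 : 0 <= 2 * M' / d * k%:R by rewrite !mulr_ge0 // invr_ge0 ltW.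
exists (2 * M' / d * k%:R) => // t x v t01.
have [s _|c c01 ->] := @mean_value_grad R k g t x v.
  by have [h _] := g_smooth; exact: h.
rewrite -sumrB; under eq_bigr do rewrite -mulrBl.
have S0 : 0 <= \sum_i `|v 0 i| by rewrite sumr_ge0.
have Q0 : 0 <= \sum_i v 0 i ^+ 2 by rewrite sumr_ge0 // => *; exact: sqr_ge0.
have [vd|vd] := leP `|v| d.
  apply: (@le_trans _ _ (e * (\sum_i `|v 0 i|))); last by rewrite lerDl mulr_ge0.
  apply: le_trans (ler_norm_sum _ _ _) _; rewrite mulr_sumr; apply: ler_sum => i _.
  rewrite normrM ler_wpM2r //; apply: hd => //.
  rewrite addrAC subrr add0r normrZ ger0_norm; last by case/andP: c01.
  by apply: le_trans vd; rewrite ler_piMl //; case/andP: c01.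
apply: (@le_trans _ _ (2 * M' / d * k%:R * \sum_i v 0 i ^+ 2)); last by rewrite lerDr mulr_ge0 // ltW.
have vS : d <= \sum_i `|v 0 i|.
  apply: le_trans (ltW vd) _; apply/(rV_norm_le _ S0) => i.
  by rewrite (bigD1 i) //= lerDl sumr_ge0.
apply: (@le_trans _ _ (2 * M' * (\sum_i `|v 0 i|))).
  apply: le_trans (ler_norm_sum _ _ _) _; rewrite mulr_sumr; apply: ler_sum => i _.
  rewrite normrM ler_wpM2r //; apply: le_trans (ler_normB _ _) _.
  have hM y : `|pgrad g (t, y) i| <= M' by apply: le_trans (grad_bounded _ _ t01) _; rewrite le_max lexx.
  by have := hM (x + c *: v); have := hM x; lra.
rewrite -!mulrA !ler_wpM2l // mulrC ler_pdivlMr // mulrC.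
apply: (@le_trans _ _ ((\sum_i `|v 0 i|) ^+ 2)).
  by rewrite expr2 ler_wpM2r.
apply: le_trans (sqr_sum_le _) _; rewrite card_ord le_eqVlt; apply/orP; left; apply/eqP.
by congr (_ * _); apply: eq_bigr => i _; rewrite real_normK ?num_real.
Qed.

End GradRemainder.

Section DiscreteTrajectory.
Variables (R : realType) (n : nat) (g : R * 'rV[R]_(n + n) -> R) (M : R) (u0 : 'rV[R]_n).
Hypothesis g_smooth : C_class 1 setT g.
Hypothesis g_bounded : forall t x, 0 <= t <= 1 -> `|g (t, x)| <= M.
Hypothesis grad_bounded : forall t x i, 0 <= t <= 1 -> `|pgrad g (t, x) i| <= M.
Hypothesis grad_unif : forall e : R, 0 < e -> exists2 d, 0 < d & forall t x y i, 0 <= t <= 1 ->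
  `|x - y| <= d -> `|pgrad g (t, x) i - pgrad g (t, y) i| <= e.
Local Notation S := ('I_n + 'I_n)%type.

(** Momenta are measured from [u0], so that vanishing end momenta mean that the path starts and ends
    over [u0]. *)
Let toX (z : S -> R) : 'rV[R]_(n + n) :=
  row_mx (\row_i (u0 0 i + z (inl i))) (\row_i z (inr i)).
Let toI (s : S) : 'I_(n + n) := match s with inl i => lshift n i | inr i => rshift n i end.

Lemma sum_toI (F : 'I_(n + n) -> R) : \sum_i F i = \sum_(s : S) F (toI s).
Proof. by rewrite big_split_ord big_sumType. Qed.

Lemma discrete_trajectory (N : nat) (e : R) : (0 < N)%N -> 0 < e ->
  exists x y : nat -> 'rV[R]_(n + n),
  [/\ lsubmx (x 0) = u0, lsubmx (x N) = u0,
    forall k, (k < N)%N -> lsubmx (y k) = lsubmx (x k.+1) /\ rsubmx (y k) = rsubmx (x k)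
    & forall k, (k < N)%N ->
      `|x k.+1 - x k - N%:R^-1 *: ham_field g (k%:R / N%:R) (y k)| <= e].
Proof.
case: N => [//|N] _ e0.
(* Times are capped at 1: the bounds on [g] hold on [0, 1], whereas the family of Hamiltonians is
   indexed by all natural numbers. *)
pose T (k : nat) : R := Num.min (k%:R / N.+1%:R) 1.
have T01 k : 0 <= T k <= 1.
  by rewrite /T ge_min lexx orbT andbT le_min ler01 andbT divr_ge0.
pose K k z := g (T k, toX z); pose G k z s := pgrad g (T k, toX z) (toI s).
have toXD z v : toX (fun s => z s + v s) = toX z + row_mx (\row_i v (inl i)) (\row_i v (inr i)).
  rewrite /toX add_row_mx; congr row_mx; apply/rowP => i; rewrite !mxE //.
  by rewrite addrA.
have vE v s : (row_mx (\row_i v (inl i)) (\row_i v (inr i)) : 'rV[R]_(n + n)) 0 (toI s) = v s.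
  by case: s => i /=; rewrite ?row_mxEl ?row_mxEr mxE.
have Kd e' : 0 < e' -> exists2 C, 0 <= C & forall k z v,
  `|K k (fun s => z s + v s) - K k z - \sum_s G k z s * v s|
    <= e' * (\sum_s `|v s|) + C * \sum_s v s ^+ 2.
  move=> e'0; have [C C0 hC] := grad_remainder g_smooth grad_bounded grad_unif e'0.
  exists C => // k z v.
  have := hC (T k) (toX z) (row_mx (\row_i v (inl i)) (\row_i v (inr i))) (T01 k).
  rewrite -toXD !sum_toI.
  under eq_bigr do rewrite vE.
  under [X in _ <= _ * X + _ -> _]eq_bigr do rewrite vE.
  by under [X in _ <= _ + _ * X -> _]eq_bigr do rewrite vE.
have Gu e' : 0 < e' -> exists2 d, 0 < d & forall k z z',
  (forall s, `|z s - z' s| <= d) -> forall s, `|G k z s - G k z' s| <= e'.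
  move=> e'0; have [d d0 hd] := grad_unif e'0.
  exists d => // k z z' zz s; apply: hd => //.
  apply/(rV_norm_le _ (ltW d0)) => i; rewrite rowB /toX.
  case: (split_ordP i) => j ->; rewrite ?row_mxEl ?row_mxEr mxE [X in _ - X]mxE //.
  by rewrite opprD addrACA subrr add0r.
have h0 : 0 < N.+1%:R^-1 :> R by rewrite invr_gt0 ltr0n.
have [||p [q [p0 pN hpq]]] := discrete_path N (K := K) (G := G) (M := M) _ _ Kd Gu h0 e0.
- by move=> k z; exact: g_bounded.
- by move=> k z s; exact: grad_bounded.
pose z k l := fun s : S => match s with inl i => p k i | inr i => q l i end.
exists (fun k => toX (z k k)), (fun k => toX (z k.+1 k)); split.
- by rewrite /toX row_mxKl; apply/rowP => i; rewrite !mxE /= p0 addr0.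
- by rewrite /toX row_mxKl; apply/rowP => i; rewrite !mxE /= pN addr0.
- by move=> k kN; rewrite /toX !row_mxKl !row_mxKr.
move=> k kN; apply/(rV_norm_le _ (ltW e0)) => i.
have TE : T k = k%:R / N.+1%:R.
  by rewrite /T min_l // ler_pdivrMr ?ltr0n // mul1r ler_nat ltnW.
rewrite -TE !rowB rowZ; case: (split_ordP i) => j ->.
  rewrite ham_field_l /toX !row_mxEl !mxE.
  have [h _] := hpq k j kN; apply: le_trans h; rewrite -/(z k.+1 k).
  by rewrite /G /= opprD addrACA subrr add0r.
rewrite ham_field_r /toX !row_mxEr !mxE.
have [_ h] := hpq k j kN; apply: le_trans h; rewrite -/(z k.+1 k).
by rewrite /G /= mulrN opprK.
Qed.

End DiscreteTrajectory.

(** * Trajectories over a polytope *)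

Section Slack.
Variables (R : realType) (n m : nat) (b : 'I_m -> 'rV[R]_n) (lam : 'I_m -> R).
Local Notation V := 'rV[R]_(n + n).

Definition slack (j : 'I_m) (x : V) : R := pairing (lsubmx x) (b j) - lam j.
Definition positive_slack : set V := [set x | forall j, 0 < slack j x].

Lemma C_class_snd_coord r (U : set (R * V)) i : C_class r U (fun p => p.2 0 i).
Proof.
apply: C_class_lin => [a p q|p]; first by rewrite /= !mxE.
apply: (@continuous_comp _ _ _ snd (fun x : V => x 0 i)); first exact: cvg_snd.
exact: coord_continuous.
Qed.

Lemma C_class_slack r (U : set (R * V)) j : open U -> C_class r U (fun p => slack j p.2).
Proof.
move=> oU; apply: (C_classD oU _ (C_class_cst r U (- lam j))).
apply: (C_class_sum _ _ oU) => i.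
apply: (C_classM oU _ (C_class_cst r U (b j 0 i))).
apply: (C_class_ext oU _ (@C_class_snd_coord r U (lshift n i))) => p _.
by rewrite mxE.
Qed.

Lemma slack_continuous j (p : R * V) : {for p, continuous (fun p : R * V => slack j p.2)}.
Proof. exact: (@C_class_slack 0 setT j openT p I). Qed.

Definition slack_dom : set (R * V) := [set p | positive_slack p.2].

Lemma slack_dom_open : open slack_dom.
Proof.
rewrite openE => p hp.
have hj j : \forall q \near p, 0 < slack j q.2.
  exact: (cvgr_gt _ (@slack_continuous j p) 0 (hp j)).
exact: (@filter_forall _ _ (fun j q => 0 < slack j q.2) _ _ hj).
Qed.

Variables (K : R * V -> R).
Hypothesis K_smooth : C_class 2 slack_dom K.

(** The j-th factor is 0 where the slack is at most 1 / a and 1 where it is at least 2 / a; large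
    [a] means a cut-off close to the boundary. *)
Definition cut (a : R) (p : R * V) : R := \prod_j cut_step (a * slack j p.2 - 1).
Definition cut_ham (a : R) (p : R * V) : R := cut a p * K p.

Lemma cut_ham_out (a : R) j p : a * slack j p.2 <= 1 -> cut_ham a p = 0.
Proof.
by move=> h; rewrite /cut_ham /cut (bigD1 j) //= cut_step0 ?mul0r // subr_le0.
Qed.

Lemma cut_ham_in (a : R) p : (forall j, 2 <= a * slack j p.2) -> cut_ham a p = K p.
Proof.
move=> h; rewrite /cut_ham /cut big1 ?mul1r // => j _.
by rewrite cut_step1 //; have := h j; lra.
Qed.

Lemma cut_ham_near (a : R) (p : R * V) : 0 < a -> (forall j, 2 / a < slack j p.2) ->
  \forall q \near p, K q = cut_ham a q.
Proof.
move=> a0 h.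
have hj j : \forall q \near p, 2 / a < slack j q.2.
  exact: (cvgr_gt _ (@slack_continuous j p) _ (h j)).
have hall : \forall q \near p, forall j, 2 / a < slack j q.2.
  exact: (@filter_forall _ _ (fun j (q : R * V) => 2 / a < slack j q.2) _ _ hj).
apply: filterS hall => q hq; rewrite cut_ham_in // => j.
by rewrite mulrC -ler_pdivrMr // ltW.
Qed.

(** [K] is uncontrolled off the open polytope, but the space is covered by the domain where all
    slacks are positive and the open sets where some slack is less than 1 / a, on which the product
    vanishes identically. *)
Lemma cut_ham_smooth (a : R) : 0 < a -> C_class 1 setT (cut_ham a).
Proof.
move=> a0; pose O (o : option 'I_m) : set (R * V) :=
  if o is Some j then [set p | slack j p.2 < a^-1] else slack_dom.
have oO : forall o, open (O o).
  case=> [j|]; last exact: slack_dom_open.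
  rewrite openE => p /= hp.
  exact: (cvgr_lt _ (@slack_continuous j p) _ hp).
apply: (@C_class_sub _ _ _ 1 (\bigcup_o O o)).
  move=> p _; have [Dp|/existsNP[j /negP h]] := pselect (slack_dom p).
    by exists None.
  exists (Some j) => //=; rewrite -leNgt in h; apply: le_lt_trans h _.
  by rewrite invr_gt0.
apply: C_class_bigcup => -[j|].
  apply: (C_class_ext (oO (Some j)) _ (C_class_cst 1 (O (Some j)) 0)) => p.
  rewrite inE /= => h; rewrite (@cut_ham_out a j) // mulrC -ler_pdivlMr // mul1r ltW //.
have oD := slack_dom_open.
apply: (C_classM oD _ (C_classS K_smooth)).
apply: (C_class_prod _ oD) => j.
apply: (C_class_comp1 oD (O := setT) _ (@C_class1_cut_step R)) => //.
have h := C_classM oD (C_class_cst 1 slack_dom a) (@C_class_slack 1 slack_dom j oD).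
exact: (C_classD oD h (C_class_cst 1 slack_dom (-1 : R))).
Qed.

Lemma slack_lattice j (x : V) k : slack j (x + lattice_vec R k) = slack j x.
Proof. by rewrite /slack lsub_lattice. Qed.

Hypothesis K_per : forall t x k, positive_slack x ->
  K (t, x + lattice_vec R k) = K (t, x).

Lemma cut_ham_periodic (a : R) : 0 < a -> theta_periodic (cut_ham a).
Proof.
move=> a0 t x k; have [Dx|/existsNP[j /negP h]] := pselect (positive_slack x).
  rewrite /cut_ham K_per //; congr (_ * _); rewrite /cut.
  by apply: eq_bigr => j _; rewrite slack_lattice.
have h' : a * slack j x <= 1.
  by rewrite -leNgt in h; apply: (@le_trans _ _ 0) => //; rewrite mulr_ge0_le0 // ltW.
by rewrite !(@cut_ham_out a j) //= slack_lattice.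
Qed.

Variable B : R.
Hypothesis dom_bounded : forall x, positive_slack x -> `|lsubmx x| <= B.

Lemma cut_ham_supp0 (a : R) p : 0 < a -> B < `|lsubmx p.2| -> cut_ham a p = 0.
Proof.
move=> a0 Bp; have [/dom_bounded|/existsNP[j /negP h]] := pselect (positive_slack p.2).
  by rewrite leNgt Bp.
rewrite (@cut_ham_out a j) //; apply: (@le_trans _ _ 0) => //.
by rewrite mulr_ge0_le0 ?(ltW a0) // leNgt.
Qed.

Lemma cut_ham_supp (a t : R) (x : V) : 0 < a -> B < `|lsubmx x| ->
  \forall q \near (t, x), cut_ham a q = 0.
Proof.
move=> a0 Bx.
have : \forall q \near (t, x), B < `|lsubmx q.2|.
  have : {for (t, x), continuous (fun q : R * V => `|lsubmx q.2|)}.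
    apply: (@continuous_comp _ _ _ (fun q : R * V => lsubmx q.2) (fun u : 'rV[R]_n => `|u|)).
      apply: (@continuous_comp _ _ _ snd lsubmx); first exact: cvg_snd.
      exact: continuous_lsubmx.
    exact: norm_continuous.
  by move=> h; exact: (cvgr_gt _ h _ Bx).
by apply: filterS => q; exact: cut_ham_supp0.
Qed.

Lemma cut_ham_grad_supp (a t : R) (x : V) i : 0 < a -> B < `|lsubmx x| ->
  pgrad (cut_ham a) (t, x) i = 0.
Proof.
move=> a0 Bx; have h := cut_ham_supp t a0 Bx.
have e : \forall q \near (t, x), (fun=> 0) q = cut_ham a q.
  by apply: filterS h => q ->.
rewrite (pgrad_near i e); last exact: differentiable_cst.
by rewrite pgrad.unlock -[fun=> 0]/(cst 0) diff_cst.
Qed.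

(* Semi-implicit Euler scheme for the cut-off Hamiltonian, [y i] being the
   point (u_(i+1), theta_i) at which the vector field is evaluated. *)
Lemma approx_trajectory (u0 : 'rV[R]_n) (a eta : R) : 0 < a -> 0 < eta ->
  exists (N : nat) (x y : nat -> V),
  [/\ (0 < N)%N, N%:R^-1 <= eta,
    lsubmx (x 0) = u0, `|rsubmx (x 0)| <= 2 * pi & lsubmx (x N) = u0] /\
  [/\ forall i, (i < N)%N -> `|y i - x i| <= eta
    & forall i, (i < N)%N ->
      `|x i.+1 - x i - N%:R^-1 *: ham_field (cut_ham a) (i%:R / N%:R) (y i)| <= eta / N%:R].
Proof.
move=> a0 eta0; set g := cut_ham a.
have gs : C_class 1 setT g by exact: cut_ham_smooth.
have gper : theta_periodic g by exact: cut_ham_periodic.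
have gc p : {for p, continuous g} by exact: (C_classS gs).
have pc i p : {for p, continuous (fun p => pgrad g p i)}.
  have [_ h] := gs; have := h (0, delta_mx 0 i) p Logic.I.
  by rewrite pgrad.unlock.
have pper i : theta_periodic (fun p => pgrad g p i) by exact: pgrad_periodic.
have [M0 hM0] : exists M, forall t x, 0 <= t <= 1 -> `|g (t, x)| <= M.
  apply: (periodic_bound (B := B)) => // t x Bx.
  by apply: cut_ham_supp0.
have hMi i : exists M, forall t x, 0 <= t <= 1 -> `|pgrad g (t, x) i| <= M.
  apply: (@periodic_bound _ _ (fun p => pgrad g p i) B) => // t x Bx.
  exact: cut_ham_grad_supp.
have [Mi hMi'] := choice hMi.
pose M := Num.max M0 (\big[Num.max/0]_i Mi i).
have gM t x : 0 <= t <= 1 -> `|g (t, x)| <= M.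
  by move=> t01; apply: le_trans (hM0 _ _ t01) _; rewrite le_max lexx.
have pM t x i : 0 <= t <= 1 -> `|pgrad g (t, x) i| <= M.
  move=> t01; apply: le_trans (hMi' i _ _ t01) _; rewrite le_max; apply/orP; right.
  exact: (le_bigmax _ Mi i).
have M0' : 0 <= M by apply: le_trans (gM 0 0 _); rewrite ?lexx ?ler01.
have pu (e : R) : 0 < e -> exists2 d, 0 < d & forall t x y i, 0 <= t <= 1 ->
    `|x - y| <= d -> `|pgrad g (t, x) i - pgrad g (t, y) i| <= e.
  move=> e0; have hi i : exists d : {posnum R}, forall t x y, 0 <= t <= 1 ->
      `|x - y| <= d%:num -> `|pgrad g (t, x) i - pgrad g (t, y) i| <= e.
    have [|||d d0 hd] := @periodic_unif _ _ (fun p => pgrad g p i) B _ _ _ e e0 => //.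
      by move=> t x Bx; exact: cut_ham_grad_supp.
    by exists (PosNum d0).
  have [d hd] := choice hi.
  exists (\big[Num.min/1]_i (d i)%:num).
    by apply/bigmin_gtP; split=> // i _; exact: gt0.
  move=> t x y i t01 xy; apply: hd => //; apply: le_trans xy _.
  exact: bigmin_le_cond.
(* A step moves the point by at most (M + 1) / N, and [y i] is made of coordinates of [x i] and of
   [x i.+1], so [y i] is within [eta] of [x i]. *)
pose N := (Num.bound ((M + 2) / eta)).+1.
have N0 : 0 < N%:R :> R by rewrite ltr0n.
have NM : (M + 2) / N%:R <= eta.
  rewrite ler_pdivrMr // mulrC -ler_pdivrMr // ltW // /N.
  apply: lt_trans (archi_boundP _) _; first by rewrite divr_ge0 ?(ltW eta0) // addr_ge0.
  by rewrite ltr_nat.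
(* The 1 serves the bound (M + 1) / N on the length of a step, [eta] the accuracy demanded in the
   conclusion. *)
pose e := Num.min 1 eta / N%:R.
have e0 : 0 < e by rewrite divr_gt0 // lt_min ltr01.
have eN : e <= N%:R^-1 by rewrite /e ler_pdivrMr // mulVf ?gt_eqF // ge_min lexx.
have ee : e <= eta / N%:R by rewrite /e ler_pM2r ?invr_gt0 // ge_min lexx orbT.
have [x [y [x0 xN xy step]]] := discrete_trajectory u0 gs gM pM pu (ltn0Sn _ : (0 < N)%N) e0.
(* Translating the whole path by one period vector puts the initial angle in a fixed compact set
   without disturbing the scheme. *)
have [k hk] := lattice_reduce (x 0).
exists N, (fun i => x i + lattice_vec R k), (fun i => y i + lattice_vec R k).
have ND : N%:R^-1 <= (M + 2) / N%:R by rewrite -[leLHS]mul1r ler_pM2r ?invr_gt0 //; lra.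
split; split=> //; first exact: le_trans ND NM.
- by rewrite lsub_lattice.
- by rewrite lsub_lattice.
- move=> i iN; have -> : y i + lattice_vec R k - (x i + lattice_vec R k) = y i - x i.
    by rewrite opprD addrACA subrr addr0.
  have iN1 : 0 <= (i%:R / N%:R : R) <= 1.
    by rewrite divr_ge0 //= ler_pdivrMr // mul1r ler_nat ltnW.
  have hb : `|x i.+1 - x i| <= (M + 1) / N%:R.
    rewrite -(subrK (N%:R^-1 *: ham_field g (i%:R / N%:R) (y i)) (x i.+1 - x i)).
    apply: le_trans (ler_normD _ _) _; rewrite mulrDl mul1r addrC lerD //.
      rewrite normrZ gtr0_norm ?invr_gt0 // mulrC ler_pM2r ?invr_gt0 //.
      by apply: ham_field_bound => // l; exact: pM.
    exact: le_trans (step i iN) eN.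
  have [yl yr] := xy i iN.
  have : `|y i - x i| <= `|x i.+1 - x i|.
    apply/(rV_norm_le _ (normr_ge0 _)) => l; rewrite rowB.
    case: (split_ordP l) => j ->.
      have -> : y i 0 (lshift n j) = x i.+1 0 (lshift n j).
        by have := congr1 (fun M : 'rV[R]_n => M 0 j) yl; rewrite !mxE.
      by rewrite -rowB coord_le_norm.
    have -> : y i 0 (rshift n j) = x i 0 (rshift n j).
      by have := congr1 (fun M : 'rV[R]_n => M 0 j) yr; rewrite !mxE.
    by rewrite subrr normr0.
  move=> h; apply: le_trans h _; apply: le_trans hb _; apply: le_trans NM.
  by rewrite ler_pM2r ?invr_gt0 //; lra.
- move=> i iN; have -> : ham_field g (i%:R / N%:R) (y i + lattice_vec R k) =
      ham_field g (i%:R / N%:R) (y i).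
    apply/eqP; rewrite -subr_eq0 -normr_le0; apply: ham_field_le => // l.
    by rewrite pper subrr normr0.
  have -> : x i.+1 + lattice_vec R k - (x i + lattice_vec R k) = x i.+1 - x i.
    by rewrite opprD addrACA subrr addr0.
  exact: le_trans (step i iN) ee.
Qed.

Definition trajectory (u0 theta : 'rV[R]_n) (xs : R -> V) : Prop :=
  xs 0 = row_mx u0 theta /\ forall t : R, 0 <= t <= 1 ->
    positive_slack (xs t) /\ is_derive t 1 xs (ham_field K t (xs t)).

(** A single number plays three roles, radius, inverse of a Lipschitz constant and lower bound of
    the slacks; all three conditions weaken when it decreases, so it can be made uniform along a
    trajectory by [compact_near_pos]. *)
Lemma local_tube (t0 : R) (x0 : V) : positive_slack x0 ->
  exists2 d, 0 < d & forall t y z, `|t - t0| < d -> `|y - x0| < d -> `|z - x0| < d ->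
    `|ham_field K t y - ham_field K t z| <= d^-1 * `|y - z| /\
    forall j, d <= slack j y.
Proof.
move=> Dx0; have oD := slack_dom_open; have U0 : slack_dom (t0, x0) by [].
have h1 i : exists d : {posnum R}, forall t x y, `|t - t0| < d%:num -> `|x - x0| < d%:num ->
    `|y - x0| < d%:num ->
    `|pgrad K (t, x) i - pgrad K (t, y) i| <= d%:num^-1 * `|x - y|.
  have c1 : C_class 1 slack_dom (fun p => pgrad K p i).
    by rewrite pgrad.unlock; have [_ h] := K_smooth; exact: h.
  have [d d0 [L hL]] := locally_lipschitz oD c1 U0.
  have L1 : 0 < `|L| + 1 by rewrite ltr_wpDl.
  have e0 : 0 < Num.min d (`|L| + 1)^-1 by rewrite lt_min d0 invr_gt0.
  exists (PosNum e0) => t x y /= tt xx yy.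
  have lt a : a < Num.min d (`|L| + 1)^-1 -> a < d by rewrite lt_min => /andP[].
  apply: le_trans (hL _ _ _ (lt _ tt) (lt _ xx) (lt _ yy)) _.
  rewrite ler_wpM2r //; apply: le_trans (ler_norm _) _.
  have := lexx (Num.min d (`|L| + 1)^-1); rewrite {2}/Num.min.
  have h : Num.min d (`|L| + 1)^-1 <= (`|L| + 1)^-1 by rewrite ge_min lexx orbT.
  move=> _; rewrite -lef_pV2 ?posrE ?invr_gt0 // invrK in h; lra.
have [d1 hd1] := choice h1.
have h2 j : exists d : {posnum R}, forall y, `|y - x0| < d%:num -> d%:num <= slack j y.
  have s0 : 0 < slack j x0 / 2 by rewrite divr_gt0 //; exact: Dx0.
  have [d d0 h] := continuous_eps (@slack_continuous j (t0, x0)) s0.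
  have e0 : 0 < Num.min d (slack j x0 / 2) by rewrite lt_min d0.
  exists (PosNum e0) => y /=; rewrite lt_min => /andP[yd _].
  have : `|(t0, y) - (t0, x0)| < d.
    have -> : (t0, y) - (t0, x0) = (0, y - x0).
      by transitivity (t0 - t0, y - x0) => //; rewrite subrr.
    by apply: pair_norm_lt; rewrite ?normr0.
  move=> /h /=; rewrite ltr_norml => /andP[h3 _].
  by rewrite ge_min; apply/orP; right; lra.
have [d2 hd2] := choice h2.
pose d := Num.min (\big[Num.min/1]_i (d1 i)%:num) (\big[Num.min/1]_j (d2 j)%:num).
have d0 : 0 < d.
  by rewrite /d lt_min; apply/andP; split; apply/bigmin_gtP; split=> // i _; exact: gt0.
have dd1 i : d <= (d1 i)%:num.
  by rewrite /d ge_min; apply/orP; left; exact: bigmin_le_cond.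
have dd2 j : d <= (d2 j)%:num.
  by rewrite /d ge_min; apply/orP; right; exact: bigmin_le_cond.
exists d => // t y z tt yy zz; split; last first.
  by move=> j; apply: le_trans (dd2 j) _; apply: hd2; apply: lt_le_trans yy (dd2 j).
apply: ham_field_le => [|i]; first by rewrite mulr_ge0 // invr_ge0 ltW.
apply: le_trans (hd1 i _ _ _ _ _ _) _; rewrite ?(lt_le_trans _ (dd1 i)) //.
by rewrite ler_wpM2r // lef_pV2 ?posrE.
Qed.

Lemma tube u0 theta xs : trajectory u0 theta xs ->
  exists2 d, 0 < d & forall t : R, 0 <= t <= 1 -> 
   (forall y z, `|y - xs t| <= d -> `|z - xs t| <= d ->
     `|ham_field K t y - ham_field K t z| <= d^-1 * `|y - z|) /\
   (forall y j, `|y - xs t| <= d -> d <= slack j y).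
Proof.
move=> [_ sol].
pose P (d : R) (t : R) := (forall y z, `|y - xs t| <= d -> `|z - xs t| <= d ->
     `|ham_field K t y - ham_field K t z| <= d^-1 * `|y - z|) /\
   (forall y j, `|y - xs t| <= d -> d <= slack j y).
have [|d d0 hd] := @compact_near_pos R _ `[(0 : R), (1 : R)]%classic P (@segment_compact R 0 1); last first.
  by exists d => // t t01; apply: hd; rewrite /= in_itv.
move=> t0 /=; rewrite in_itv /= => t001.
have [D0 dx0] := sol t0 t001.
have [d d0 hd] := local_tube t0 D0.
have cx : xs @ t0 --> xs t0.
  by apply: differentiable_continuous; apply/derivable1_diffP; case: dx0.
have d2 : 0 < d / 2 by rewrite divr_gt0.
have /cvgrPdist_lt/(_ _ d2) cx' := cx.
exists (d / 2) => //; near=> t => e e0 ed.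
have tt : `|t - t0| < d by rewrite distrC; near: t; exact: cvgr_dist_lt.
have xt : `|xs t - xs t0| < d / 2.
  by rewrite distrC; near: t; exact: cx'.
have tri y : `|y - xs t| <= e -> `|y - xs t0| < d.
  move=> ye; rewrite -(subrKA (xs t)); apply: le_lt_trans (ler_normD _ _) _; lra.
have ed' : e <= d by lra.
split=> [y z /tri yd /tri zd|y j /tri yd].
  apply: le_trans (hd _ _ _ tt yd zd).1 _.
  by rewrite ler_wpM2r // lef_pV2 ?posrE.
exact: le_trans ed' ((hd _ _ _ tt yd yd).2 j).
Unshelve. all: by end_near. Qed.

Lemma trajectory_field_unif u0 theta xs : trajectory u0 theta xs ->
  forall e : R, 0 < e -> exists2 d, 0 < d & forall s t : R,
  0 <= s <= 1 -> 0 <= t <= 1 -> `|s - t| <= d ->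
  `|ham_field K s (xs s) - ham_field K t (xs t)| <= e.
Proof.
move=> [_ sol] e e0.
have h i : exists d : {posnum R}, forall s t : R, 0 <= s <= 1 -> 0 <= t <= 1 ->
   `|s - t| <= d%:num -> `|pgrad K (s, xs s) i - pgrad K (t, xs t) i| <= e.
  have [|d d0 hd] := @compact_unif R R `[(0 : R), (1 : R)]%classic (fun t => pgrad K (t, xs t) i) e
      (@segment_compact R 0 1) _ e0.
    move=> t /=; rewrite in_itv /= => t01; have [Dt dt] := sol t t01.
    have dx : differentiable xs t by apply/derivable1_diffP; case: dt.
    apply: (@continuous_comp _ _ _ (fun t => (t, xs t)) (fun p => pgrad K p i)).
      apply: differentiable_continuous; apply: differentiable_pair dx.
      exact: ex_diff.
    have [_ hK] := C_classS K_smooth; have := hK (0, delta_mx 0 i) (t, xs t) Dt.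
    by rewrite pgrad.unlock.
  exists (PosNum d0) => s t s01 t01 st; apply: hd => //=; by rewrite in_itv.
have [d hd] := choice h.
exists (\big[Num.min/1]_i (d i)%:num).
  by apply/bigmin_gtP; split=> // i _; exact: gt0.
move=> s t s01 t01 st; apply: ham_field_le (ltW e0) _ => i.
by apply: hd => //; apply: le_trans st _; exact: bigmin_le_cond.
Qed.

(** The k-th discrete trajectory uses the cut-off parameter k + 1 and accuracy 1 / (k + 1). No
    subsequence is extracted: at a cluster point of the initial angles, each precision is met by
    some k as large as desired, and for it the scheme follows the true trajectory to time 1, ending
    over [u0]. *)
Theorem returning_trajectory (u0 : 'rV[R]_n) (sol : 'rV[R]_n -> R -> V) :
  (forall theta, trajectory u0 theta (sol theta)) ->
  exists theta, lsubmx (sol theta 1) = u0.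
Proof.
move=> hsol.
pose P (k : nat) (th : 'rV[R]_n) := exists (N : nat) (x y : nat -> V),
  [/\ (0 < N)%N, N%:R^-1 <= k.+1%:R^-1 :> R,
    x 0 = row_mx u0 th, `|th| <= 2 * pi & lsubmx (x N) = u0] /\
  [/\ forall i, (i < N)%N -> `|y i - x i| <= k.+1%:R^-1
    & forall i, (i < N)%N ->
      `|x i.+1 - x i - N%:R^-1 *: ham_field (cut_ham k.+1%:R) (i%:R / N%:R) (y i)|
        <= k.+1%:R^-1 / N%:R].
have hP k : exists th, P k th.
  have k0 : 0 < k.+1%:R :> R by rewrite ltr0n.
  have k1 : 0 < k.+1%:R^-1 :> R by rewrite invr_gt0.
  have [N [x [y [[N0 Nk x0 x0' xN] [xy step]]]]] := approx_trajectory u0 k0 k1.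
  exists (rsubmx (x 0)), N, x, y; split; split=> //.
  by rewrite -x0 hsubmxK.
have [th hth] := choice hP.
pose C : set 'rV[R]_n := [set th | `|th| <= 2 * pi].
have cC : compact C.
  apply: bounded_closed_compact.
    by exists (2 * pi); split; [exact: num_real|move=> M BM x /= xB; exact: le_trans xB (ltW BM)].
  rewrite (_ : C = (fun x : 'rV[R]_n => `|x|) @^-1` [set y : R | y <= 2 * pi]) //.
  apply: preimage_closed; last exact: closed_le.
  by move=> x _; exact: norm_continuous.
have [ths [_ cl]] : C `&` cluster (th @ \oo) !=set0.
  apply: cC; exists 0%N => // k _.
  by have [N [x [y [[_ _ _ + _] _]]]] := hth k.
have txs := hsol ths; set xs := sol ths in txs.
exists ths; rewrite -/xs.
have [d d0 htube] := tube txs.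
have [x0 dsol] := txs.
have dV : 0 < d^-1 by rewrite invr_gt0.
have small (e : R) : 0 < e -> `|u0 - lsubmx (xs 1)| <= e.
  move=> e0.
  have [eta eta0 heuler] := euler_limit d0 dV (fun t t01 => (dsol t t01).2)
    (fun t y z t01 yd zd => (htube t t01).1 y z yd zd) (trajectory_field_unif txs) e0.
  (* The second condition puts the cut-off zone, of slack at most 2 / (k + 1), outside the tube,
     whose slacks are at least [d]; there the cut-off field is the true one. *)
  pose A := [set th k | k in [set k : nat | k.+1%:R^-1 <= eta /\ 2 < k.+1%:R * d]].
  have FA : (th @ \oo) A.
    exists (maxn (Num.bound eta^-1) (Num.bound (2 / d))) => // k /=.
    rewrite geq_max => /andP[k1 k2]; exists k => //; split.
      rewrite -[leRHS]invrK lef_pV2 ?posrE ?invr_gt0 ?ltr0n //.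
      apply: (@le_trans _ _ (Num.bound eta^-1)%:R).
        by rewrite ltW // archi_boundP // invr_ge0 ltW.
      by rewrite ler_nat (leq_trans k1).
    rewrite -ltr_pdivrMr //; apply: (@lt_le_trans _ _ (Num.bound (2 / d))%:R).
      by rewrite archi_boundP // divr_ge0 // ltW.
    by rewrite ler_nat (leq_trans k2).
  have [_ [[k [keta kd] <-] thk]] := cl _ _ FA (nbhsx_ballx ths eta eta0).
  have [N [x [y [[N0 Nk xx0 _ xN] [yx step]]]]] := hth k.
  have main : `|x N - xs 1| <= e.
    apply: (heuler N x y N0).
    - exact: le_trans Nk keta.
    - rewrite xx0 x0 opp_row_mx add_row_mx subrr.
      apply/(rV_norm_le _ (ltW eta0)) => i; case: (split_ordP i) => j ->.
        by rewrite row_mxEl mxE normr0 ltW.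
      rewrite row_mxEr; apply: le_trans (coord_le_norm _ _) _.
      by move: thk; rewrite -ball_normE /= distrC => /ltW.
    - by move=> i iN; apply: le_trans (yx i iN) keta.
    move=> i iN yd.
    have i01 : 0 <= (i%:R / N%:R : R) <= 1.
      by rewrite divr_ge0 //= ler_pdivrMr ?ltr0n // mul1r ler_nat ltnW.
    have sl j : d <= slack j (y i) by apply: (htube _ i01).2.
    have -> : ham_field K (i%:R / N%:R) (y i) = ham_field (cut_ham k.+1%:R) (i%:R / N%:R) (y i).
      apply/eqP; rewrite -subr_eq0 -normr_le0; apply: ham_field_le => // l.
      rewrite (@pgrad_near _ _ K (cut_ham k.+1%:R)) ?subrr ?normr0 //; last first.
        by have [h _] := K_smooth; apply: h => j; apply: lt_le_trans d0 (sl j).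
      apply: cut_ham_near => [|j]; first by rewrite ltr0n.
      rewrite ltr_pdivrMr ?ltr0n // mulrC.
      by apply: lt_le_trans kd _; rewrite ler_pM2l ?ltr0n //; exact: sl.
    apply: le_trans (step i iN) _.
    by rewrite ler_pM2r // invr_gt0 ltr0n.
  rewrite -xN; apply: le_trans main.
  have -> : lsubmx (x N) - lsubmx (xs 1) = lsubmx (x N - xs 1).
    by apply/rowP => i; rewrite !mxE.
  exact: lsub_norm.
apply/eqP; rewrite eq_sym -subr_eq0 -normr_le0; apply/ler_addgt0Pr => e /small.
by rewrite add0r.
Qed.

End Slack.

(** * Labeled polytopes *)

Section Pairing.
Variables (R : realType) (n : nat).
Implicit Types u d a : 'rV[R]_n.

Lemma pairingDl u d a : pairing (u + d) a = pairing u a + pairing d a.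
Proof. by rewrite /pairing -big_split; apply: eq_bigr => i _; rewrite mxE mulrDl. Qed.

Lemma pairingZl t u a : pairing (t *: u) a = t * pairing u a.
Proof. by rewrite /pairing mulr_sumr; apply: eq_bigr => i _; rewrite mxE mulrA. Qed.

Lemma pairingNl u a : pairing (- u) a = - pairing u a.
Proof. by rewrite -scaleN1r pairingZl mulN1r. Qed.

Lemma pairing_delta i a : pairing (delta_mx 0 i) a = a 0 i.
Proof.
rewrite /pairing (bigD1 i) //= mxE !eqxx mul1r big1 ?addr0 // => k ki.
by rewrite mxE (negbTE ki) andbF mul0r.
Qed.

Lemma pairing_sumr (J : finType) (F : J -> 'rV[R]_n) (Q : pred J) u :
  pairing u (\sum_(j | Q j) F j) = \sum_(j | Q j) pairing u (F j).
Proof.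
rewrite /pairing exchange_big; apply: eq_bigr => i _.
by rewrite summxE mulr_sumr.
Qed.

Lemma pairing_mx k (B : 'M[R]_(k, n)) u j : pairing u (row j B) = (u *m B^T) 0 j.
Proof. by rewrite mxE; apply: eq_bigr => i _; rewrite !mxE. Qed.

End Pairing.

Section Polytope.
Variables (R : realType) (n m : nat) (P : set 'rV[R]_n) (v : 'I_m -> 'rV[int]_n)
  (c : 'I_m -> nat) (lambda : 'I_m -> R).
Hypothesis hP : labeled_simple_polytope P v c lambda.

Definition real_normal (j : 'I_m) : 'rV[R]_n := to_real R (labeled_normal v c j).
Local Notation b := real_normal.

Lemma polytopeE u : P u <-> forall j, lambda j <= pairing u (b j).
Proof. by rewrite {1}(lp_halfspaces hP). Qed.

Lemma polytope_bounded : exists B, forall u, P u -> `|u| <= B.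
Proof.
have [k [x ->]] := lp_polytope hP.
exists (\sum_i `|x i|) => u [w [w0 w1] <-].
apply: le_trans (ler_norm_sum _ _ _) _; apply: ler_sum => i _.
rewrite normrZ ger0_norm // ler_piMl // -w1 (bigD1 i) //= lerDl sumr_ge0 //.
Qed.

Lemma real_normal_neq0 j : b j != 0.
Proof.
apply/eqP => bj0; have := lp_primitive hP j; rewrite /primitive.
rewrite big1 // => i _; have := congr1 (fun u : 'rV[R]_n => u 0 i) bj0.
rewrite !mxE => /eqP; rewrite intr_eq0 mulf_eq0 => /orP[|/eqP ->] //.
by rewrite eqz_nat => /eqP c0; have := lp_label hP j; rewrite c0.
Qed.

(** Otherwise the whole ray from [u] in the direction [d] would stay in the bounded set P. *)
Lemma recession u d : P u -> d != 0 -> exists j, pairing d (b j) < 0.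
Proof.
move=> Pu d0; apply: contrapT => h.
have h' j : 0 <= pairing d (b j) by rewrite leNgt; apply/negP => ?; apply: h; exists j.
have [B hB] := polytope_bounded.
have inP t : 0 <= t -> P (u + t *: d).
  move=> t0; apply/polytopeE => j; rewrite pairingDl pairingZl -[leLHS]addr0 lerD //.
    by have /polytopeE := Pu; apply.
  by rewrite mulr_ge0.
have nd : 0 < `|d| by rewrite normr_gt0.
have B0 : 0 <= B by apply: le_trans (normr_ge0 _) (hB _ Pu).
pose t := (B + `|u| + 1) / `|d|.
have t0 : 0 <= t by rewrite divr_ge0 // !addr_ge0.
have := hB _ (inP t t0).
have : `|t *: d| = B + `|u| + 1 by rewrite normrZ ger0_norm // /t divfK ?gt_eqF.
have := ler_normB (u + t *: d) u; rewrite addrAC subrr add0r; lra.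
Qed.

Lemma normals_span u d : P u -> (forall j, pairing d (b j) = 0) -> d = 0.
Proof.
move=> Pu h; apply/eqP; apply: contraT => /(recession Pu)[j].
by rewrite h ltxx.
Qed.

(** The normal is nonzero at some coordinate i; a short move along i, against the sign of that
    coordinate, stays in P and lowers the pairing strictly. *)
Lemma interior_slack u : P° u -> forall j, lambda j < pairing u (b j).
Proof.
move=> /nbhs_normP[e /= e0 he] j; have bj := real_normal_neq0 j.
have [i bi] : exists i, b j 0 i != 0.
  apply: contrapT => h; case/eqP: bj; apply/rowP => i; rewrite [RHS]mxE.
  by apply/eqP; apply: contraT => bi; case: h; exists i.
pose d : 'rV[R]_n := (- (e / 2) * Num.sg (b j 0 i)) *: delta_mx 0 i.
have dE : pairing d (b j) = - (e / 2) * `|b j 0 i|.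
  by rewrite pairingZl pairing_delta -mulrA -normrEsg.
have : P (u + d).
  apply: he; rewrite /ball_ /= opprD addNKr normrN normrZ.
  have d1 : `|delta_mx 0 i : 'rV[R]_n| <= 1.
    by apply/(rV_norm_le _ ler01) => k; rewrite mxE eqxx /=; case: eqP; rewrite ?normr0 ?normr1.
  have s1 : `|- (e / 2) * Num.sg (b j 0 i)| <= e / 2.
    rewrite normrM normrN normr_sg bi mulr1 ger0_norm // divr_ge0 // ltW //.
  apply: (@le_lt_trans _ _ (e / 2 * 1)); last by rewrite mulr1; lra.
  by apply: ler_pM.
move/polytopeE/(_ j); rewrite pairingDl dE => h.
have : 0 < e / 2 * `|b j 0 i| by rewrite mulr_gt0 ?divr_gt0 ?normr_gt0.
by lra.
Qed.

Definition tight (u : 'rV[R]_n) : pred 'I_m := [pred j | pairing u (b j) == lambda j].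

(** The sum of the tight normals is a supporting functional: minimality of another point forces all
    tight constraints to be tight there too, hence equality with [u]. *)
Lemma tight_vertex u : P u ->
  (forall d, (forall j, tight u j -> pairing d (b j) = 0) -> d = 0) -> is_vertex P u.
Proof.
move=> Pu h; exists (\sum_(j | tight u j) b j); apply/seteqP; split=> [_ ->|w [Pw hw]] /=.
  split=> // w Pw; rewrite !pairing_sumr; apply: ler_sum => j /eqP ->.
  by have /polytopeE := Pw; apply.
have {hw} := hw u Pu; rewrite !pairing_sumr => hw.
suff : w - u = 0 by move=> /subr0_eq.
apply: h => j tj; rewrite pairingDl pairingNl.
have ge0 k : tight u k -> 0 <= pairing w (b k) - pairing u (b k).
  by move=> /eqP ->; rewrite subr_ge0; have /polytopeE := Pw; apply.
have : \sum_(k | tight u k) (pairing w (b k) - pairing u (b k)) = 0.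
  by apply/eqP; rewrite eq_le sumr_ge0 // andbT sumrB subr_le0.
by move/eqP; rewrite psumr_eq0 // => /allP/(_ j (mem_index_enum _)); rewrite tj => /eqP.
Qed.

(** As in the simplex method: while the tight normals fail to span, move along a direction they
    annihilate until a new constraint becomes tight. Those already tight stay so, and their number
    increases. *)
Lemma exists_vertex u : P u -> exists w, [/\ P w, is_vertex P w,
  (forall d, (forall j, tight w j -> pairing d (b j) = 0) -> d = 0) &
  forall j, tight u j -> tight w j].
Proof.
have [k] := ubnP (m - #|tight u|); elim: k u => // k IHk u hk Pu.
have [h|] := pselect (forall d, (forall j, tight u j -> pairing d (b j) = 0) -> d = 0).
  by exists u; split=> //; exact: tight_vertex.
move=> /existsNP[d /not_implyP[hd /eqP d0]].
have [j0 dj0] := recession Pu d0.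
(* For a constraint that decreases along [d], the time at which the ray meets its hyperplane; the
   smallest such time is used. *)
pose r j := (pairing u (b j) - lambda j) / - pairing d (b j).
have [j dj jmin] : exists2 j, pairing d (b j) < 0 & forall i, pairing d (b i) < 0 -> r j <= r i.
  case: (@arg_minP _ _ _ j0 (fun j => pairing d (b j) < 0) r dj0) => j dj jmin.
  by exists j.
have Pu' j' : lambda j' <= pairing u (b j') by have /polytopeE := Pu; apply.
have r0 : 0 <= r j by rewrite divr_ge0 // ?subr_ge0 // oppr_ge0 ltW.
pose w := u + r j *: d.
have wE i : pairing w (b i) = pairing u (b i) + r j * pairing d (b i).
  by rewrite pairingDl pairingZl.
have Pw : P w.
  apply/polytopeE => i; rewrite wE; have [di|di] := ltP (pairing d (b i)) 0; last first.
    by rewrite -[leLHS]addr0 lerD // mulr_ge0.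
  have := jmin i di; rewrite /r ler_pdivlMr ?oppr_gt0 // mulrN; lra.
have uw i : tight u i -> tight w i by move=> ti; rewrite /tight /= wE hd // mulr0 addr0; exact: ti.
have wj : tight w j by rewrite /tight /= wE /r; apply/eqP; field; rewrite lt_eqF.
have uj : ~~ tight u j by apply/negP => /hd e; move: dj; rewrite e ltxx.
have lt : (#|tight u| < #|tight w|)%N.
  apply: proper_card; apply/properP; split; first by apply/fintype.subsetP => i; exact: uw.
  by exists j.
have [||x [Px vx sx ux]] := IHk w => //.
  move: lt hk (max_card (tight w)); rewrite card_ord.
  by move: #|tight w| #|tight u| => p q; lia.
by exists x; split=> // i /uw/ux.
Qed.

(** Simplicity says that exactly n constraints are tight at the vertex reached from [u]. They
    separate directions, so their n normals form an invertible matrix; they include all constraints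
    tight at [u]. *)
Lemma vertex_frame u : P u -> exists f : 'I_n -> 'I_m,
  [/\ injective f, forall j, tight u j -> exists i, f i = j,
   exists2 w, P w & forall j, tight w j <-> exists i, f i = j &
   (\matrix_(i, k) b (f i) 0 k \in unitmx)].
Proof.
move=> /exists_vertex[w [Pw vw sw uw]].
have card : #|tight w| = n.
  rewrite -(lp_simple hP vw); apply: eq_card => j; rewrite !inE.
  by apply/eqP/asboolP => [h|[_]//]; split.
pose f (i : 'I_n) : 'I_m := enum_val (cast_ord (esym card) i).
have finj : injective f by move=> i i' /enum_val_inj /cast_ord_inj.
have frange j : tight w j <-> exists i, f i = j.
  split=> [tj|[i <-]]; last exact: (enum_valP (cast_ord (esym card) i)).
  exists (cast_ord card (enum_rank_in tj j)).
  by rewrite /f cast_ordK enum_rankK_in.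
exists f; split=> //; first by move=> j /uw /frange.
  by exists w.
rewrite -row_free_unit -[X in row_free X]trmxK row_free_unit unitmx_tr -row_free_unit.
apply: inj_row_free => d hd; apply: sw => j /frange[i <-].
have := congr1 (fun M : 'rV[R]_n => M 0 i) hd; rewrite !mxE => <-.
by apply: eq_bigr => k _; rewrite !mxE.
Qed.

Definition normal_mx : 'M[R]_(m, n) := \matrix_(j, k) b j 0 k.

Lemma normal_mxE j : row j normal_mx = b j.
Proof. by apply/rowP => k; rewrite !mxE. Qed.

Lemma normal_mx_left_inverse u : P u -> exists S : 'M[R]_(n, m), S *m normal_mx = 1%:M.
Proof.
move=> Pu; apply/row_fullP; rewrite /row_full -mxrank_tr -/(row_free _).
apply: inj_row_free => d hd; apply: (normals_span Pu) => j.
by rewrite -normal_mxE pairing_mx hd mxE.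
Qed.

End Polytope.

(** * The torus action *)

Section CircleExp.
Variable R : realType.
Implicit Types t : R.

Definition cexp t : R[i] := (cos t +i* sin t)%C.

Lemma cexp0 : cexp 0 = 1.
Proof. by rewrite /cexp cos0 sin0. Qed.

Lemma cexpD s t : cexp (s + t) = cexp s * cexp t.
Proof.
by rewrite /cexp cosD sinD; apply/eqP; rewrite eq_complex /= eqxx /= addrC [cos s * _]mulrC.
Qed.

Lemma norm_cexp t : `|cexp t| = 1.
Proof. by rewrite normc_def /= cos2Dsin2 sqrtr1. Qed.

Lemma cexp_neq0 t : cexp t != 0.
Proof. by rewrite -normr_gt0 norm_cexp ltr01. Qed.

Lemma cexpN t : cexp (- t) = (cexp t)^-1.
Proof.
apply: (mulfI (cexp_neq0 t)); rewrite divff ?cexp_neq0 // -cexpD subrr.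
exact: cexp0.
Qed.

Lemma cexpMz t (k : int) : cexp (t * k%:~R) = cexp t ^ k.
Proof.
have nat_case n : cexp (t * n%:R) = cexp t ^+ n.
  elim: n => [|n IHn]; first by rewrite mulr0 expr0 cexp0.
  by rewrite -natr1 mulrDr mulr1 cexpD IHn exprSr.
case: k => n; first by rewrite -exprnP -nat_case.
by rewrite NegzE mulrNz mulrN cexpN -exprnN -nat_case.
Qed.

Lemma cexp_sum (J : finType) (F : J -> R) : cexp (\sum_j F j) = \prod_j cexp (F j).
Proof. by apply: big_morph; [exact: cexpD|exact: cexp0]. Qed.

Lemma cexp_polar (z : R[i]) : `|z| = 1 -> exists t, z = cexp t.
Proof.
case: z => a b; rewrite normc_def /= => -[h].
have ab : a ^+ 2 + b ^+ 2 = 1.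
  rewrite -[LHS]sqr_sqrtr ?addr_ge0 ?sqr_ge0 // h; exact: expr1n.
have a1 : -1 <= a <= 1 by apply/andP; split; have := sqr_ge0 b; nra.
have sE : sin (acos a) ^+ 2 = b ^+ 2.
  by rewrite sin2cos2 acosK ?in_itv //= -ab; ring.
have [bs|bs] : b = sin (acos a) \/ b = - sin (acos a).
  by move/eqP: sE; rewrite eqf_sqr => /orP[/eqP ->|/eqP ->]; [left|right; rewrite opprK].
  by exists (acos a); rewrite /cexp acosK ?in_itv // -bs.
by exists (- acos a); rewrite /cexp cosN sinN acosK ?in_itv // -bs.
Qed.

Lemma cexp_2pi (k : int) : cexp (2 * pi * k%:~R) = 1.
Proof.
rewrite cexpMz (_ : cexp _ = 1) ?exp1rz // /cexp.
have -> : 2 * pi = pi *+ 2 :> R by rewrite mulr_natl.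
by rewrite cos2pi sin2pi.
Qed.

Lemma cos_eq1_small t : 0 <= t < 2 * pi -> cos t = 1 -> t = 0.
Proof.
move=> /andP[t0 t2] ct; have p0 := pi_gt0 R.
have [tp|tp] := leP t pi.
  by apply: cos_inj; rewrite ?in_itv /= ?t0 ?lexx ?(ltW p0) // cos0.
suff : 2 * pi - t = 0 by lra.
have in1 : 2 * pi - t \in `[0, pi] by rewrite in_itv /=; apply/andP; split; lra.
have in0 : 0 \in `[(0 : R), pi] by rewrite in_itv /= lexx ltW.
apply: (cos_inj in1 in0).
have -> : 2 * pi - t = - t + pi *+ 2 by rewrite addrC mulr_natl.
by rewrite cosD2pi cosN ct cos0.
Qed.

Lemma cexp_eq1 t : cexp t = 1 -> exists k : int, t = 2 * pi * k%:~R.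
Proof.
move=> h; have p0 : 0 < 2 * pi :> R by rewrite mulr_gt0 // pi_gt0.
exists (Num.floor (t / (2 * pi))); set f := Num.floor _.
have h1 : f%:~R <= t / (2 * pi) by exact: floor_le.
have h2 : t / (2 * pi) < f%:~R + 1.
  by rewrite -[1]/(1%:~R) -intrD; exact: floorD1_gt.
move: h1 h2; rewrite ler_pdivlMr // ltr_pdivrMr // => h1 h2.
suff : t - 2 * pi * f%:~R = 0 by lra.
apply: cos_eq1_small; first by apply/andP; split; lra.
have : cexp (t - 2 * pi * f%:~R) = 1 by rewrite cexpD cexpN cexp_2pi invr1 mulr1.
by move=> [].
Qed.

End CircleExp.

Section TorusAction.
Variables (R : realType) (m : nat).
Implicit Types (z : 'rV[R]_(m + m)) (g : 'I_m -> R[i]).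

Lemma of_zcoordK (f : 'I_m -> R[i]) j : zcoord (of_zcoord f) j = f j.
Proof. by rewrite /zcoord /of_zcoord row_mxEl row_mxEr !mxE; case: (f j). Qed.

Lemma zcoord_inj z z' : zcoord z =1 zcoord z' -> z = z'.
Proof.
move=> h; apply/rowP => i; case: (split_ordP i) => j ->; have := h j; rewrite /zcoord.
  by case=> ->.
by case=> _ ->.
Qed.

Lemma zcoord_act g z j : zcoord (torus_act g z) j = g j * zcoord z j.
Proof. exact: of_zcoordK. Qed.

Lemma torus_act1 z : torus_act (fun=> 1) z = z.
Proof. by apply: zcoord_inj => j; rewrite zcoord_act mul1r. Qed.

Lemma torus_actM g h z : torus_act g (torus_act h z) = torus_act (fun j => g j * h j) z.
Proof. by apply: zcoord_inj => j; rewrite !zcoord_act mulrA. Qed.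

Lemma half_normsq_norm z j : (2 * half_normsq z j)%:C%C = `|zcoord z j| ^+ 2.
Proof. by rewrite -add_Re2_Im2 /half_normsq /=; congr (_%:C)%C; field. Qed.

Lemma half_normsq_eq z z' j : `|zcoord z j| = `|zcoord z' j| ->
  half_normsq z j = half_normsq z' j.
Proof.
move=> h; have := half_normsq_norm z j; rewrite h -half_normsq_norm => /complexI.
by move/mulfI; apply; rewrite pnatr_eq0.
Qed.

Lemma half_normsq_ge0 z j : 0 <= half_normsq z j.
Proof. by rewrite /half_normsq divr_ge0 // addr_ge0 // sqr_ge0. Qed.

Lemma half_normsq_eq0 z j : (half_normsq z j == 0) = (zcoord z j == 0).
Proof.
rewrite /half_normsq mulf_eq0 invr_eq0 pnatr_eq0 orbF paddr_eq0 ?sqr_ge0 //.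
by rewrite !sqrf_eq0 eq_complex.
Qed.

Lemma half_normsq_act g z j : torus g -> half_normsq (torus_act g z) j = half_normsq z j.
Proof. by move=> tg; apply: half_normsq_eq; rewrite zcoord_act normrM tg mul1r. Qed.

End TorusAction.

Section TorusK.
Variables (R : realType) (n m : nat) (b : 'I_m -> 'rV[int]_n) (lambda : 'I_m -> R).
Implicit Types (z : 'rV[R]_(m + m)) (g : 'I_m -> R[i]).

Lemma torus_neq0 g j : torus g -> g j != 0.
Proof. by move=> tg; rewrite -normr_gt0 tg ltr01. Qed.

Lemma pi_torus1 i : pi_torus b (fun=> 1 : R[i]) i = 1.
Proof. by rewrite /pi_torus big1 // => j _; rewrite exp1rz. Qed.

Lemma pi_torusM g h i : pi_torus b (fun j => g j * h j) i = pi_torus b g i * pi_torus b h i.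
Proof. by rewrite /pi_torus -big_split; apply: eq_bigr => j _; rewrite expfzMl. Qed.

Lemma pi_torusV g i : pi_torus b (fun j => (g j)^-1) i = (pi_torus b g i)^-1.
Proof.
by rewrite /pi_torus (big_morph _ (@invfM _) (@invr1 _)); apply: eq_bigr => j _; rewrite exprz_inv invr_expz.
Qed.

Lemma torusK1 : torusK b (fun=> 1 : R[i]).
Proof. by split; [move=> j; exact: normr1|apply/funext => i; rewrite pi_torus1]. Qed.

Lemma torusKM g h : torusK b g -> torusK b h -> torusK b (fun j => g j * h j).
Proof.
move=> [tg pg] [th ph]; split=> [j|]; first by rewrite normrM tg th mulr1.
by apply/funext => i; rewrite pi_torusM pg ph mulr1.
Qed.

Lemma torusKV g : torusK b g -> torusK b (fun j => (g j)^-1).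
Proof.
move=> [tg pg]; split=> [j|]; first by rewrite normfV tg invr1.
by apply/funext => i; rewrite pi_torusV pg invr1.
Qed.

Lemma orbit_act g z : torusK b g -> orbit b (torus_act g z) = orbit b z.
Proof.
move=> Kg; apply/seteqP; split=> _ [h Kh <-].
  by exists (fun j => h j * g j); [exact: torusKM|rewrite torus_actM].
exists (fun j => h j * (g j)^-1); first exact: torusKM (torusKV Kg).
rewrite torus_actM; congr (torus_act _ z); apply/funext => j.
by rewrite mulfVK // torus_neq0 //; case: Kg.
Qed.

Lemma orbit_refl z : orbit b z z.
Proof. by exists (fun=> 1); [exact: torusK1|exact: torus_act1]. Qed.

Lemma orbit_eq z z' : orbit b z = orbit b z' -> exists2 g, torusK b g & z' = torus_act g z.
Proof. by move=> h; have := orbit_refl z'; rewrite -h => -[g Kg <-]; exists g. Qed.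

Lemma pi_torus_cexp (t : 'I_m -> R) i :
  pi_torus b (fun j => cexp (t j)) i = cexp (pi_lin b t 0 i).
Proof.
rewrite /pi_torus; under eq_bigr do rewrite -cexpMz.
rewrite -cexp_sum; congr cexp; rewrite /pi_lin summxE; apply: eq_bigr => j _.
by rewrite !mxE.
Qed.

Lemma torusK_cexp (t : 'I_m -> R) : LieK b t -> torusK b (fun j => cexp (t j)).
Proof.
move=> Kt; split=> [j|]; first exact: norm_cexp.
by apply/funext => i; rewrite pi_torus_cexp Kt mxE cexp0.
Qed.

(** Lie(K) is the left kernel of the matrix B of normals, and the level equation says that the
    vector |z|^2/2 + lambda is orthogonal to it, hence lies in the row space of B^T. The resulting
    [u] is the value of the moment map. Testing against the columns of the cokernel is enough. *)
Lemma level_setP z : level_set b lambda z <->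
  exists u : 'rV[R]_n, forall j, pairing u (to_real R (b j)) = half_normsq z j + lambda j.
Proof.
pose B : 'M[R]_(m, n) := \matrix_(j, k) to_real R (b j) 0 k.
have BE j : row j B = to_real R (b j) by apply/rowP => k; rewrite !mxE.
have piE (xi : 'I_m -> R) : pi_lin b xi = (\row_j xi j) *m B.
  by rewrite mulmx_sum_row; apply: eq_bigr => j _; rewrite mxE BE.
split=> [hz|[u hu] xi]; last first.
  rewrite /LieK /= piE => Kxi; apply/eqP; rewrite -subr_eq0 -sumrB; apply/eqP.
  transitivity (\sum_j xi j * pairing u (to_real R (b j))).
    by apply: eq_bigr => j _; rewrite hu; ring.
  transitivity (((\row_j xi j) *m B *m u^T) 0 0).
    rewrite -mulmxA mxE; apply: eq_bigr => j _; rewrite !mxE; congr (_ * _).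
    by apply: eq_bigr => k _; rewrite !mxE mulrC.
  by rewrite Kxi mul0mx mxE.
pose y : 'rV[R]_m := \row_j (half_normsq z j + lambda j).
have : (y <= B^T)%MS.
  rewrite submxE; apply/eqP/rowP => k; rewrite !mxE.
  have /hz : LieK b (fun j => cokermx B^T j k).
    rewrite /LieK /= piE; apply/rowP => i; rewrite !mxE.
    have /matrixP/(_ i k) := mulmx_coker B^T; rewrite !mxE => h.
    by rewrite -[RHS]h; apply: eq_bigr => j _; rewrite !mxE mulrC.
  move=> /eqP; rewrite -subr_eq0 -sumrB => /eqP h; rewrite -[RHS]h.
  by apply: eq_bigr => j _; rewrite !mxE; ring.
move=> /submxP[u hu]; exists u => j; rewrite -BE pairing_mx -hu.
by rewrite mxE.
Qed.

End TorusK.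

(** * Action-angle charts *)

Lemma is_derive_affine (R : realType) (p q : R) : is_derive (0 : R) 1 (fun h => p + h * q) q.
Proof.
have := is_deriveD (is_derive_cst p (0 : R) 1)
  (is_deriveM (is_derive_id (0 : R) 1) (is_derive_cst q (0 : R) 1)).
rewrite /= add0r scaler0 add0r => h; apply: is_derive_eq h _.
by rewrite -[q *: 1]/(q * 1) mulr1.
Qed.

Section DiffLine.
Variables (R : realType) (V : normedModType R).

Lemma derive_line (W : normedModType R) (f : V -> W) x v :
  'D_v f x = 'D_1 (fun h : R => f (x + h *: v)) 0.
Proof.
rewrite /derive; apply: (congr1 (fun F : R -> W => lim (F @ 0^'))).
apply/funext => h; congr (_ *: (_ - _)); rewrite /=.
  by congr f; rewrite -[h *: 1]/(h * 1) mulr1 addr0 addrC.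
by rewrite scale0r addr0.
Qed.

Lemma diff_coord_line k (F : V -> 'rV[R]_k) x v i (d : R) : differentiable F x ->
  is_derive (0 : R) 1 (fun h : R => F (x + h *: v) 0 i) d -> 'd F x v 0 i = d.
Proof.
move=> dF [_ <-]; rewrite -deriveE // derive_mx; last exact: diff_derivable.
by rewrite mxE derive_line.
Qed.

Lemma smooth_differentiable (W : normedModType R) (U : set V) (f : V -> W) x :
  smooth_on U f -> U x -> differentiable f x.
Proof. by move=> /(_ 1%N)[h _] /h. Qed.

Lemma star_connected (D : set V) x0 : D x0 ->
  (forall x s, D x -> 0 <= s <= 1 -> D (x0 + s *: (x - x0))) -> connected D.
Proof.
move=> Dx0 star.
have -> : D = \bigcup_(x in D) ((fun s : R => x0 + s *: (x - x0)) @` `[(0 : R), 1]).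
  apply/seteqP; split=> [x Dx|_ [x Dx [s /= s01 <-]]]; last first.
    by apply: star => //; move: s01; rewrite in_itv.
  exists x => //; exists 1 => /=; first by rewrite in_itv /= ler01 lexx.
  by rewrite scale1r addrC subrK.
apply: bigcup_connected.
  exists x0 => x Dx; exists 0 => /=; first by rewrite in_itv /= lexx ler01.
  by rewrite scale0r addr0.
move=> x Dx; apply: connected_continuous_connected; first exact: segment_connected.
apply: continuous_subspaceT => s.
apply: (@continuousD _ _ _ (fun=> x0) (fun s : R => s *: (x - x0))); first exact: cvg_cst.
exact: scalel_continuous.
Qed.

End DiffLine.

Section Coordinates.
Variables (R : realType) (k : nat).

Lemma C_class_rV_coord r (U : set 'rV[R]_k) i : C_class r U (fun x => x 0 i).
Proof.
by apply: C_class_lin => [a p q|p]; [rewrite !mxE|exact: coord_continuous].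
Qed.

Lemma omega0_diag (a b : 'rV[R]_(k + k)) : omega0 a b =
  \sum_i (lsubmx a 0 i * rsubmx b 0 i - rsubmx a 0 i * lsubmx b 0 i).
Proof. by apply: eq_bigr => i _; rewrite !mxE. Qed.

End Coordinates.

Section ActionAngle.
Variables (R : realType) (n m : nat) (P : set 'rV[R]_n) (v : 'I_m -> 'rV[int]_n)
  (c : 'I_m -> nat) (lambda : 'I_m -> R).
Hypothesis hP : labeled_simple_polytope P v c lambda.
Variable S : 'M[R]_(n, m).
Hypothesis hS : S *m normal_mx R v c = 1%:M.
Local Notation V := 'rV[R]_(n + n).
Local Notation b := (labeled_normal v c).
Local Notation br := (real_normal R v c).
Local Notation sl := (slack br lambda).
Local Notation D := (positive_slack br lambda).

(* The left inverse S of the matrix of normals lifts the angles in R^n to R^m: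
   the point (u, theta) goes to z_j = sqrt(2 (<u, b_j> - lambda_j)) e^(i ang_j). *)
Definition ang (j : 'I_m) (x : V) : R := (rsubmx x *m S) 0 j.
Definition aa_map (x : V) : 'rV[R]_(m + m) :=
  row_mx (\row_j (Num.sqrt (2 * sl j x) * cos (ang j x)))
         (\row_j (Num.sqrt (2 * sl j x) * sin (ang j x))).

Lemma D_polytope x : D x -> P (lsubmx x).
Proof. by move=> Dx; apply/(polytopeE hP) => j; have := Dx j; rewrite subr_gt0 => /ltW. Qed.

Lemma ang_mul_normal x : \row_j ang j x *m normal_mx R v c = rsubmx x.
Proof.
have -> : \row_j ang j x = rsubmx x *m S by apply/rowP => j; rewrite mxE.
by rewrite -mulmxA hS mulmx1.
Qed.

Lemma pi_lin_mx (t : 'I_m -> R) : pi_lin b t = (\row_j t j) *m normal_mx R v c.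
Proof. by rewrite mulmx_sum_row; apply: eq_bigr => j _; rewrite mxE normal_mxE. Qed.

Lemma ang_line j x w h : ang j (x + h *: w) = ang j x + h * ang j w.
Proof. by rewrite /ang linearD linearZ /= mulmxDl -scalemxAl !mxE. Qed.

Lemma slack_line j x w h :
  sl j (x + h *: w) = sl j x + h * pairing (lsubmx w) (br j).
Proof. by rewrite /slack linearD linearZ /= pairingDl pairingZl; ring. Qed.

Lemma zcoord_aa x j : zcoord (aa_map x) j = (Num.sqrt (2 * sl j x))%:C%C * cexp (ang j x).
Proof.
rewrite /zcoord /aa_map row_mxEl row_mxEr !mxE /cexp; apply/eqP; rewrite eq_complex /=.
by rewrite !mul0r subr0 addr0 !eqxx.
Qed.

Lemma half_normsq_aa x j : D x -> half_normsq (aa_map x) j = sl j x.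
Proof.
move=> Dx; have s0 : 0 <= 2 * sl j x by rewrite mulr_ge0 // ltW //; exact: Dx.
apply: (mulfI (_ : 2 != 0 :> R)); first by rewrite pnatr_eq0.
apply: (@complexI R); rewrite half_normsq_norm zcoord_aa normrM norm_cexp mulr1.
by rewrite normc_def /= expr0n addr0 sqrtr_sqr ger0_norm ?sqrtr_ge0 // -rmorphXn /= sqr_sqrtr.
Qed.

Lemma aa_level x : D x -> level_set b lambda (aa_map x).
Proof.
move=> Dx; apply/level_setP; exists (lsubmx x) => j.
by rewrite half_normsq_aa // /slack subrK.
Qed.

Lemma aa_zcoord_neq0 x j : D x -> zcoord (aa_map x) j != 0.
Proof. by move=> Dx; rewrite -half_normsq_eq0 half_normsq_aa // gt_eqF //; exact: Dx. Qed.

Lemma aa_orbit_lsub x x' g : D x -> D x' -> torus g ->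
  aa_map x' = torus_act g (aa_map x) -> lsubmx x' = lsubmx x.
Proof.
move=> Dx Dx' tg e; apply/subr0_eq; apply: (normals_span hP (D_polytope Dx)) => j.
have := half_normsq_act (aa_map x) j tg; rewrite -e !half_normsq_aa // /slack.
by rewrite pairingDl pairingNl; lra.
Qed.

(** As no coordinate of z vanishes, g_j is the exponential of the difference of the angles. The map
    to T^n sends it to the exponential of theta' - theta, because [S] is a left inverse of the
    matrix of normals; membership in K makes this 1. *)
Lemma aa_orbit_rsub x x' g : D x -> D x' -> torusK b g ->
  aa_map x' = torus_act g (aa_map x) ->
  exists k : 'rV[int]_n, rsubmx x' = rsubmx x + (2 * pi) *: to_real R k.
Proof.
move=> Dx Dx' Kg e; have [tg pg] := Kg; have el := aa_orbit_lsub Dx Dx' tg e.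
have gE j : g j = cexp (ang j x' - ang j x).
  have := zcoord_act g (aa_map x) j; rewrite -e !zcoord_aa /slack el -/(slack br lambda j x).
  have r0 : (Num.sqrt (2 * sl j x))%:C%C != 0.
    by have := aa_zcoord_neq0 j Dx; rewrite zcoord_aa mulf_eq0 negb_or => /andP[].
  rewrite mulrCA => /(mulfI r0) h.
  by rewrite cexpD cexpN h mulfK // cexp_neq0.
have K1 i : exists k : int, rsubmx x' 0 i - rsubmx x 0 i = 2 * pi * k%:~R.
  apply: cexp_eq1; have := congr1 (fun f : 'I_n -> R[i] => f i) pg.
  have -> : g = fun j => cexp (ang j x' - ang j x) by apply/funext.
  rewrite pi_torus_cexp pi_lin_mx => <-; congr cexp.
  have -> : \row_j (ang j x' - ang j x) = \row_j ang j x' - \row_j ang j x.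
    by apply/rowP => j; rewrite !mxE.
  by rewrite mulmxBl !ang_mul_normal !mxE.
have [k hk] := choice K1; exists (\row_i k i); apply/rowP => i.
by have := hk i; rewrite !mxE => <-; ring.
Qed.

(** [S] is a real matrix, so the lift of a period need not be a period of T^m; it is nevertheless an
    element of K, since its image in T^n is trivial. *)
Lemma aa_lattice x k :
  exists2 g, torusK b g & aa_map (x + lattice_vec R k) = torus_act g (aa_map x).
Proof.
exists (fun j => cexp (ang j (lattice_vec R k))).
  split=> [j|]; first exact: norm_cexp.
  apply/funext => i; rewrite pi_torus_cexp pi_lin_mx ang_mul_normal.
  rewrite mxE /lattice_vec row_mxEr !mxE; exact: cexp_2pi.
apply: zcoord_inj => j; rewrite zcoord_act !zcoord_aa slack_lattice.
by rewrite -[lattice_vec R k]scale1r ang_line mul1r scale1r cexpD; ring.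
Qed.

Lemma C_class_slackV r (U : set V) j : open U -> C_class r U (sl j).
Proof.
move=> oU; apply: (C_classD oU _ (C_class_cst r U (- lambda j))).
apply: (C_class_sum _ _ oU) => i.
apply: (C_classM oU _ (C_class_cst r U (br j 0 i))).
by apply: (C_class_ext oU _ (C_class_rV_coord r U (lshift n i))) => x _; rewrite mxE.
Qed.

Lemma aa_dom_open : open D.
Proof.
rewrite openE => p hp.
have hj j : \forall q \near p, 0 < sl j q.
  exact: (cvgr_gt _ (@C_class_slackV 0 setT j openT p Logic.I) 0 (hp j)).
exact: (@filter_forall _ _ (fun j q => 0 < sl j q) _ _ hj).
Qed.

Lemma aa_smooth : smooth_on D aa_map.
Proof.
move=> r; have oD := aa_dom_open.
have cs j : C_class r D (sl j) by exact: C_class_slackV.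
have ca j : C_class r D (ang j).
  apply: (@C_class_ext _ _ _ r D (fun x => \sum_i x 0 (rshift n i) * S i j)) => //.
    by move=> x _; rewrite /ang mxE; apply: eq_bigr => i _; rewrite !mxE.
  apply: (C_class_sum _ _ oD) => i.
  exact: (C_classM oD (C_class_rV_coord r D (rshift n i)) (C_class_cst r D (S i j))).
have cr j : C_class r D (fun x => Num.sqrt (2 * sl j x)).
  have h2 := C_classM oD (C_class_cst r D (2 : R)) (cs j).
  apply: (@C_class_comp1 _ _ r D _ (fun x => 2 * sl j x) Num.sqrt oD _ (C_class_sqrt R r) h2) => x Dx.
  by rewrite /= mulr_gt0 //; exact: Dx.
have [csin ccos] := C_class_sin_cos R r.
apply: (C_class_coord oD) => i; case: (split_ordP i) => j ->.
  apply: (C_class_ext oD _ (C_classM oD (cr j) (C_class_comp1 oD (fun _ _ => Logic.I) ccos (ca j)))).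
  by move=> x _; rewrite /aa_map row_mxEl mxE.
apply: (C_class_ext oD _ (C_classM oD (cr j) (C_class_comp1 oD (fun _ _ => Logic.I) csin (ca j)))).
by move=> x _; rewrite /aa_map row_mxEr mxE.
Qed.

Lemma polar_derive (a d al be : R) : 0 < a ->
  is_derive (0 : R) 1 (fun h => Num.sqrt (2 * (a + h * d)) * cos (al + h * be))
    (d / Num.sqrt (2 * a) * cos al - Num.sqrt (2 * a) * be * sin al) /\
  is_derive (0 : R) 1 (fun h => Num.sqrt (2 * (a + h * d)) * sin (al + h * be))
    (d / Num.sqrt (2 * a) * sin al + Num.sqrt (2 * a) * be * cos al).
Proof.
move=> a0; have a2 : 0 < 2 * a by rewrite mulr_gt0.
have comp (f g : R -> R) (f' g' : R) : is_derive (g 0) 1 f f' -> is_derive (0 : R) 1 g g' ->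
    is_derive (0 : R) 1 (fun h => f (g h)) (f' * g').
  by move=> hf hg; have := is_derive1_comp hf hg.
have l2 : is_derive (0 : R) 1 (fun h => 2 * (a + h * d)) (2 * d).
  rewrite (_ : (fun h => _) = (fun h => 2 * a + h * (2 * d))); first exact: is_derive_affine.
  by apply/funext => h; ring.
have rho : is_derive (0 : R) 1 (fun h => Num.sqrt (2 * (a + h * d))) (d / Num.sqrt (2 * a)).
  have a3 : 0 < 2 * (a + 0 * d) by rewrite mul0r addr0.
  have := comp _ _ _ _ (is_derive1_sqrt a3) l2; rewrite mul0r addr0 => h.
  apply: is_derive_eq h _; field; rewrite gt_eqF // sqrtr_gt0 //.
have hc : is_derive (0 : R) 1 (fun h => cos (al + h * be)) (- sin al * be).
  by have := comp _ _ _ _ (is_derive_cos (al + 0 * be)) (is_derive_affine al be); rewrite mul0r addr0.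
have hs : is_derive (0 : R) 1 (fun h => sin (al + h * be)) (cos al * be).
  by have := comp _ _ _ _ (is_derive_sin (al + 0 * be)) (is_derive_affine al be); rewrite mul0r addr0.
split.
  apply: is_derive_eq (is_deriveM rho hc) _; rewrite /= !mul0r !addr0.
  by rewrite -![_ *: _]/(_ * _); ring.
apply: is_derive_eq (is_deriveM rho hs) _; rewrite /= !mul0r !addr0.
by rewrite -![_ *: _]/(_ * _); ring.
Qed.

Lemma aa_diff x w j (r := Num.sqrt (2 * sl j x)) (d := pairing (lsubmx w) (br j)) : D x ->
  'd aa_map x w 0 (lshift m j) = d / r * cos (ang j x) - r * ang j w * sin (ang j x) /\
  'd aa_map x w 0 (rshift m j) = d / r * sin (ang j x) + r * ang j w * cos (ang j x).
Proof.
move=> Dx; have dZ := smooth_differentiable aa_smooth Dx.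
have [h1 h2] := polar_derive d (ang j x) (ang j w) (Dx j).
split; apply: diff_coord_line => //.
  rewrite (_ : (fun h => _) = (fun h => Num.sqrt (2 * (sl j x + h * d)) * cos (ang j x + h * ang j w))) //.
  by apply/funext => h; rewrite /aa_map row_mxEl mxE slack_line ang_line.
rewrite (_ : (fun h => _) = (fun h => Num.sqrt (2 * (sl j x + h * d)) * sin (ang j x + h * ang j w))) //.
by apply/funext => h; rewrite /aa_map row_mxEr mxE slack_line ang_line.
Qed.

Lemma aa_rho_gt0 x j : D x -> 0 < Num.sqrt (2 * sl j x).
Proof. by move=> Dx; rewrite sqrtr_gt0 mulr_gt0 //; exact: Dx. Qed.

(** Rotating the two real equations for z_j by the angle of z_j separates radial and angular parts:
    the u-component of w pairs to 0 with every normal, and the lifted angular component equals xi.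
    Applying the map of normals to the latter gives the theta-component, which vanishes as xi is in
    Lie(K). *)
Lemma aa_transverse x w (xi : 'I_m -> R) : D x -> LieK b xi ->
  'd aa_map x w = torus_inf_act xi (aa_map x) -> w = 0.
Proof.
move=> Dx Kxi e.
have key j : pairing (lsubmx w) (br j) = 0 /\ ang j w = xi j.
  have [e1 e2] := aa_diff w j Dx; have r0 := aa_rho_gt0 j Dx.
  have z1 : torus_inf_act xi (aa_map x) 0 (lshift m j) =
      - xi j * (Num.sqrt (2 * sl j x) * sin (ang j x)).
    rewrite /torus_inf_act /of_zcoord row_mxEl mxE /zcoord /aa_map !row_mxEl !row_mxEr !mxE /=.
    by ring.
  have z2 : torus_inf_act xi (aa_map x) 0 (rshift m j) =
      xi j * (Num.sqrt (2 * sl j x) * cos (ang j x)).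
    rewrite /torus_inf_act /of_zcoord row_mxEr mxE /zcoord /aa_map !row_mxEl !row_mxEr !mxE /=.
    by ring.
  move: e1 e2; rewrite e z1 z2.
  set r := Num.sqrt _ in r0 *; set C := cos _; set s := sin _.
  set d := pairing _ _; set t := ang j w => e1 e2.
  have cs1 : C ^+ 2 + s ^+ 2 = 1 by exact: cos2Dsin2.
  have d0 : d / r = 0.
    rewrite -[LHS]mulr1 -cs1; transitivity (C * (d / r * C - r * t * s) + s * (d / r * s + r * t * C)).
      by ring.
    by rewrite -e1 -e2; ring.
  split; first by move/eqP: d0; rewrite mulf_eq0 invr_eq0 (gt_eqF r0) orbF => /eqP.
  apply: (mulfI (lt0r_neq0 r0)); rewrite -[LHS]mulr1 -[RHS]mulr1 -cs1.
  transitivity (C * (d / r * s + r * t * C) - s * (d / r * C - r * t * s)); first by ring.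
  by rewrite -e1 -e2; ring.
have lw : lsubmx w = 0.
  by apply: (normals_span hP (D_polytope Dx)) => j; have [] := key j.
have rw : rsubmx w = 0.
  rewrite -ang_mul_normal; have -> : \row_j ang j w = \row_j xi j.
    by apply/rowP => j; rewrite mxE [RHS]mxE; have [] := key j.
  by rewrite -pi_lin_mx.
by rewrite -[w]hsubmxK lw rw row_mx0.
Qed.

(** In polar form each summand dx_j dy_j is d(slack_j) wedge d(ang_j). As slack_j is affine in u
    with linear part b_j and the sum of the d(ang_j) b_j is d(theta), the total is du wedge
    d(theta). *)
Lemma aa_form x a a' : D x -> omega0 ('d aa_map x a) ('d aa_map x a') = omega0 a a'.
Proof.
move=> Dx; rewrite [RHS]omega0_diag.
have pr (w z : V) : \sum_j pairing (lsubmx w) (br j) * ang j z =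
    \sum_i lsubmx w 0 i * rsubmx z 0 i.
  rewrite -[in RHS](ang_mul_normal z).
  under eq_bigr do rewrite /pairing mulr_suml.
  rewrite exchange_big; apply: eq_bigr => i _; rewrite [X in _ = _ * X]mxE mulr_sumr.
  apply: eq_bigr => j _; rewrite [X in _ = _ * (X * _)]mxE [X in _ = _ * (_ * X)]mxE.
  by ring.
transitivity (\sum_j (pairing (lsubmx a) (br j) * ang j a' - pairing (lsubmx a') (br j) * ang j a)).
  apply: eq_bigr => j _; have [-> ->] := aa_diff a j Dx; have [-> ->] := aa_diff a' j Dx.
  have r0 := aa_rho_gt0 j Dx.
  set r := Num.sqrt _ in r0 *; set C := cos _; set s := sin _.
  have cs1 : C ^+ 2 + s ^+ 2 = 1 by exact: cos2Dsin2.
  rewrite -[RHS]mulr1 -cs1; field; exact: lt0r_neq0.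
rewrite sumrB !pr -sumrB; apply: eq_bigr => i _; by rewrite [X in _ - X = _]mulrC.
Qed.

Lemma segment_slack x y s j : D x -> D y -> 0 <= s <= 1 -> 0 < sl j (x + s *: (y - x)).
Proof.
move=> Dx Dy /andP[s0 s1]; rewrite slack_line linearB /= pairingDl pairingNl.
have := Dx j; have := Dy j; rewrite /slack.
by case: (ltrP s 1) => h; nra.
Qed.

(** The angles stay in a ball of radius 1, so two of them differ by less than 2 in each coordinate,
    hence never by a nonzero period; this makes the chart injective with trivial group. *)
Definition aa_dom (th : 'rV[R]_n) : set V := [set x | D x /\ `|rsubmx x - th| < 1].

Lemma aa_dom_connected th : connected (aa_dom th).
Proof.
have [->|/set0P[x0 [Dx0 x0th]]] := eqVneq (aa_dom th) set0; first exact: connected0.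
apply: (star_connected (x0 := x0)) => // x s [Dx xth] s01; split; first by move=> j; exact: (segment_slack j Dx0 Dx s01).
have /andP[s0 s1] := s01.
have -> : rsubmx (x0 + s *: (x - x0)) - th =
    (1 - s) *: (rsubmx x0 - th) + s *: (rsubmx x - th).
  by apply/rowP => i; rewrite !mxE; ring.
apply: le_lt_trans (ler_normD _ _) _; rewrite !normrZ !ger0_norm ?subr_ge0 //.
by have := normr_ge0 (rsubmx x0 - th); have := normr_ge0 (rsubmx x - th);
  case: (ltrP s 1) => h; nra.
Qed.

Lemma aa_dom_open' th : open (aa_dom th).
Proof.
rewrite (_ : aa_dom th = D `&` [set x | `|rsubmx x - th| < 1]) //.
apply: openI; first exact: aa_dom_open.
rewrite openE => x /= hx.
have : {for x, continuous (fun y : V => `|rsubmx y - th|)}.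
  apply: (@continuous_comp _ _ _ (fun y : V => rsubmx y - th) (fun u : 'rV[R]_n => `|u|)).
    apply: (@continuousB _ _ _ (fun y : V => rsubmx y) (fun=> th)); last exact: cst_continuous.
    exact: continuous_rsubmx.
  exact: norm_continuous.
by move=> h; exact: (cvgr_lt _ h _ hx).
Qed.

Lemma aa_trivial_stab x x' g th : aa_dom th x -> aa_dom th x' -> torusK b g ->
  aa_map x' = torus_act g (aa_map x) -> x' = x /\ g = (fun=> 1).
Proof.
move=> [Dx tx] [Dx' tx'] Kg e; have [tg _] := Kg.
have el := aa_orbit_lsub Dx Dx' tg e; have [k er] := aa_orbit_rsub Dx Dx' Kg e.
have k0 : k = 0.
  apply/rowP => i; rewrite [RHS]mxE; apply/eqP; apply: contraT => ki.
  have : `|rsubmx x' 0 i - rsubmx x 0 i| < 2.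
    have h1 := coord_le_norm (rsubmx x' - th) i; have h2 := coord_le_norm (rsubmx x - th) i.
    rewrite !rowB in h1 h2.
    have -> : rsubmx x' 0 i - rsubmx x 0 i = (rsubmx x' 0 i - th 0 i) - (rsubmx x 0 i - th 0 i) by ring.
    apply: le_lt_trans (ler_normB _ _) _; lra.
  have -> : rsubmx x' 0 i - rsubmx x 0 i = 2 * pi * (k 0 i)%:~R.
    by rewrite er [X in X - _]mxE !mxE; ring.
  have p2 := pi_ge2 R.
  rewrite normrM ger0_norm; last by rewrite mulr_ge0 // pi_ge0.
  have : 1 <= `|(k 0 i)%:~R| :> R by rewrite -intr_norm -[1]/(1%:~R) ler_int -gtz0_ge1 normr_gt0.
  by nra.
have xx : x' = x.
  rewrite -[x']hsubmxK -[x]hsubmxK el er k0; congr row_mx.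
  by apply/rowP => i; rewrite !mxE mulr0 addr0.
split=> //; apply/funext => j; have := zcoord_act g (aa_map x) j.
rewrite -e xx -[LHS]mul1r => /mulIf h; apply: esym; apply: h; exact: aa_zcoord_neq0.
Qed.

Definition aa_chart (th : 'rV[R]_n) : uniformizing_chart (n := n) b lambda.
Proof.
refine (@UniformizingChart R n m b lambda (aa_dom th) aa_map [set (fun=> 1)] _ _ _ _ _ _ _ _ _ _ _ _ _).
- exact: aa_dom_open'.
- exact: aa_dom_connected.
- by move=> r; apply: (C_class_sub _ (aa_smooth r)) => x [].
- by move=> x [Dx _]; exact: aa_level.
- move=> x x' /set_mem hx /set_mem hx' e; have [] := aa_trivial_stab hx' hx (torusK1 R b) _ => //.
  by rewrite torus_act1.
- by move=> x w xi [Dx _]; exact: aa_transverse.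
- by move=> _ ->; exact: torusK1.
- exact: finite_set1.
- by [].
- by move=> g h -> ->; apply/funext => j; rewrite mulr1.
- by move=> g ->; apply/funext => j; rewrite invr1.
- by move=> g x -> hx; exists x => //; rewrite torus_act1.
- by move=> g x x' Kg hx hx' e; have [] := aa_trivial_stab hx hx' Kg e.
Defined.

(** Take polar angles t_j of z and let theta be their image under the map of normals. The lift of
    theta through [S] may differ from t, but only by an element of Lie(K), which the orbit
    absorbs. *)
Lemma aa_surjective z : level_set b lambda z -> (forall j, zcoord z j != 0) ->
  exists2 x, D x & orbit b (aa_map x) = orbit b z.
Proof.
move=> /level_setP[u hu] zn0.
have hz j : exists t : R, zcoord z j = `|zcoord z j| * cexp t.
  have [|t ht] := @cexp_polar R (zcoord z j / `|zcoord z j|).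
    by rewrite normrM normfV normr_id divff // normr_eq0.
  by exists t; rewrite -ht mulrCA divff ?mulr1 // normr_eq0.
have [t ht] := choice hz.
pose th := (\row_j t j) *m normal_mx R v c.
pose x := row_mx u th : V.
have slx j : sl j x = half_normsq z j by rewrite /slack row_mxKl hu addrK.
have Dx : D x.
  by move=> j; rewrite slx lt0r half_normsq_eq0 zn0 half_normsq_ge0.
exists x => //.
have Kg : torusK b (fun j => cexp (t j - ang j x)).
  apply: torusK_cexp; rewrite /LieK /= pi_lin_mx.
  have -> : \row_j (t j - ang j x) = \row_j t j - \row_j ang j x.
    by apply/rowP => j; rewrite !mxE.
  by rewrite mulmxBl ang_mul_normal row_mxKr subrr.
rewrite -(orbit_act (aa_map x) Kg); congr orbit; apply: zcoord_inj => j.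
rewrite zcoord_act zcoord_aa slx ht normc_def -/(half_normsq z j).
have -> : (Num.sqrt (2 * half_normsq z j))%:C%C = `|zcoord z j|.
  by rewrite normc_def /half_normsq mulrCA divff ?mulr1 ?pnatr_eq0.
rewrite mulrCA -cexpD subrK normc_def //.
Qed.

End ActionAngle.

(** * Vertex charts *)

Lemma finite_fun_set (T : choiceType) (J : finType) (s : seq T) (A : set (J -> T)) :
  (forall g, A g -> forall j, g j \in s) -> finite_set A.
Proof.
move=> h; have [[g0 Ag0]|A0] := pselect (exists g, A g); last first.
  rewrite (_ : A = set0); first exact: finite_set0.
  by apply/seteqP; split=> // g Ag; case: A0; exists g.
pose F (k : {ffun J -> 'I_(size s).+1}) (j : J) := nth (g0 j) s (k j).
apply: (@sub_finite_set _ _ (F @` setT)); last by apply: finite_image; exact: finite_finset.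
move=> g Ag; exists [ffun j => inord (index (g j) s)] => //.
apply/funext => j; rewrite /F ffunE inordK ?ltnS ?index_size // nth_index //.
exact: h.
Qed.

Lemma unity_roots_finite (F : closedFieldType) (N : nat) : (0 < N)%N ->
  exists s : seq F, forall z, z ^+ N = 1 -> z \in s.
Proof.
move=> N0; have [s hs] := closed_field_poly_normal ('X^N - 1 : {poly F}).
exists s => z zN; have : root ('X^N - 1 : {poly F}) z.
  by rewrite rootE !hornerE zN subrr.
rewrite hs rootZ; first by rewrite root_prod_XsubC.
by rewrite (monicP _) ?oner_eq0 // monicXnsubC.
Qed.

Section VertexChart.
Variables (R : realType) (n m : nat) (v : 'I_m -> 'rV[int]_n)
  (c : 'I_m -> nat) (lambda : 'I_m -> R).
Local Notation V := 'rV[R]_(n + n).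
Local Notation b := (labeled_normal v c).
Local Notation br := (real_normal R v c).
Variables (f : 'I_n -> 'I_m) (p0 : 'rV[R]_n).
Hypothesis f_inj : injective f.
Let BJ : 'M[R]_n := \matrix_(i, k) br (f i) 0 k.
Hypothesis BJ_unit : BJ \in unitmx.
Hypothesis p0_tight : forall i, pairing p0 (br (f i)) = lambda (f i).
Hypothesis p0_slack : forall j, (forall i, f i != j) -> lambda j < pairing p0 (br j).

Lemma range_cases j : (exists i, j = f i) \/ (forall i, f i != j).
Proof.
have [[i ji]|h] := pselect (exists i, j = f i); first by left; exists i.
by right=> i; apply/eqP => fj; apply: h; exists i.
Qed.

Lemma pick_range i : [pick i' | f i' == f i] = Some i.
Proof. by case: pickP => [i' /eqP/f_inj -> //|/(_ i)]; rewrite eqxx. Qed.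

Lemma pick_out j : (forall i, f i != j) -> [pick i' | f i' == j] = None.
Proof. by move=> h; case: pickP => // i'; rewrite (negbTE (h i')). Qed.

(* The slice at a vertex where the facets f i meet: z_(f i) = w_i, and the other
   coordinates are positive reals, determined by the moment map. *)
Definition vert_u (w : V) : 'rV[R]_n :=
  (\row_i (half_normsq w i + lambda (f i))) *m invmx BJ^T.
Definition vsl (j : 'I_m) (w : V) : R := pairing (vert_u w) (br j) - lambda j.
Definition vert_dom : set V := [set w | forall j, (forall i, f i != j) -> 0 < vsl j w].
Definition vert_map (w : V) : 'rV[R]_(m + m) :=
  row_mx (\row_j (if [pick i | f i == j] is Some i then w 0 (lshift n i)
                  else Num.sqrt (2 * vsl j w)))
         (\row_j (if [pick i | f i == j] is Some i then w 0 (rshift n i) else 0)).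

Lemma BJ_row i : row i BJ = br (f i).
Proof. by apply/rowP => k; rewrite !mxE. Qed.

Lemma pairing_BJ u i : pairing u (br (f i)) = (u *m BJ^T) 0 i.
Proof. by rewrite -BJ_row pairing_mx. Qed.

Lemma BJ_pairing_inj u u' : (forall i, pairing u (br (f i)) = pairing u' (br (f i))) -> u = u'.
Proof.
move=> h; have e : u *m BJ^T = u' *m BJ^T.
  by apply/rowP => i; rewrite -!pairing_BJ.
have uT : BJ^T \in unitmx by rewrite unitmx_tr.
by rewrite -[u](mulmxK uT) e mulmxK.
Qed.

Lemma vert_uE w i : pairing (vert_u w) (br (f i)) = half_normsq w i + lambda (f i).
Proof. by rewrite pairing_BJ /vert_u mulmxKV ?unitmx_tr // mxE. Qed.

Lemma vsl_range w i : vsl (f i) w = half_normsq w i.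
Proof. by rewrite /vsl vert_uE addrK. Qed.

Lemma zcoord_vert w i : zcoord (vert_map w) (f i) = zcoord w i.
Proof. by rewrite /zcoord /vert_map row_mxEl row_mxEr !mxE pick_range. Qed.

Lemma zcoord_vert_out w j : (forall i, f i != j) ->
  zcoord (vert_map w) j = (Num.sqrt (2 * vsl j w))%:C%C.
Proof. by move=> h; rewrite /zcoord /vert_map row_mxEl row_mxEr !mxE pick_out. Qed.

Lemma half_normsq_zcoord k l (z : 'rV[R]_(k + k)) (z' : 'rV[R]_(l + l)) i j :
  zcoord z i = zcoord z' j -> half_normsq z i = half_normsq z' j.
Proof. by move=> [h1 h2]; rewrite /half_normsq h1 h2. Qed.

Lemma half_normsq_vert w j : vert_dom w -> half_normsq (vert_map w) j = vsl j w.
Proof.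
move=> Dw; have [[i ->]|h] := range_cases j.
  by rewrite vsl_range; apply: half_normsq_zcoord; exact: zcoord_vert.
have s0 : 0 <= 2 * vsl j w by rewrite mulr_ge0 // ltW // Dw.
rewrite /half_normsq /vert_map row_mxEl row_mxEr !mxE (pick_out h).
by rewrite sqr_sqrtr // expr0n addr0; field.
Qed.

Lemma vert_level w : vert_dom w -> level_set b lambda (vert_map w).
Proof.
move=> Dw; apply/level_setP; exists (vert_u w) => j.
by rewrite half_normsq_vert // /vsl subrK.
Qed.

Let alpha i j := pairing (row i (invmx BJ^T)) (br j).

(** The remaining slacks are affine in the squared moduli of w. Hence they are smooth, invariant
    under rotations of the coordinates, and affine in s^2 along s w, which makes the domain
    star-shaped. *)
Lemma vslE j w : vsl j w = vsl j 0 + \sum_i half_normsq w i * alpha i j.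
Proof.
have hn0 i : half_normsq (0 : V) i = 0 by rewrite /half_normsq !mxE expr0n addr0 mul0r.
have E w' : pairing (vert_u w') (br j) =
    \sum_i (half_normsq w' i + lambda (f i)) * alpha i j.
  rewrite /vert_u mulmx_sum_row /pairing.
  under eq_bigr do rewrite summxE mulr_suml.
  rewrite exchange_big; apply: eq_bigr => i _; rewrite /alpha /pairing mulr_sumr.
  by apply: eq_bigr => k _; rewrite mxE [X in X * _ * _]mxE; ring.
have S w' : \sum_i (half_normsq w' i + lambda (f i)) * alpha i j =
    \sum_i half_normsq w' i * alpha i j + \sum_i lambda (f i) * alpha i j.
  by rewrite -big_split; apply: eq_bigr => i _; rewrite mulrDl.
have S0 : \sum_i half_normsq (0 : V) i * alpha i j = 0.
  by apply: big1 => i _; rewrite hn0 mul0r.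
by rewrite /vsl !E !S S0; ring.
Qed.

Lemma vert_u0 : vert_u 0 = p0.
Proof.
apply: BJ_pairing_inj => i; rewrite vert_uE p0_tight.
by rewrite /half_normsq !mxE expr0n addr0 mul0r add0r.
Qed.

Lemma vert_dom0 : vert_dom 0.
Proof. by move=> j /p0_slack; rewrite /vsl vert_u0 subr_gt0. Qed.

Lemma vsl_scale j w s : vsl j (s *: w) = vsl j 0 + s ^+ 2 * (vsl j w - vsl j 0).
Proof.
rewrite vslE [vsl j w]vslE [X in _ = _ + _ * X]addrAC subrr add0r mulr_sumr.
congr (_ + _); apply: eq_bigr => i _; rewrite /half_normsq !mxE; ring.
Qed.

Lemma vert_dom_connected : connected vert_dom.
Proof.
apply: (star_connected vert_dom0) => w s Dw /andP[s0 s1] j hj.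
rewrite add0r subr0 vsl_scale; have := vert_dom0 hj; have := Dw j hj.
have s2 : s ^+ 2 <= 1 by rewrite expr_le1.
have s3 : 0 <= s ^+ 2 by exact: sqr_ge0.
by case: (ltrP (s ^+ 2) 1) => h; nra.
Qed.

Lemma C_class_vsl r (U : set V) j : open U -> C_class r U (vsl j).
Proof.
move=> oU.
have hn i : C_class r U (fun w => half_normsq w i).
  have x := C_class_rV_coord r U (lshift n i); have y := C_class_rV_coord r U (rshift n i).
  apply: (C_class_ext oU _ (C_classM oU (C_classD oU (C_classM oU x x) (C_classM oU y y))
    (C_class_cst r U (2^-1 : R)))) => w _.
  by rewrite /half_normsq !expr2.
apply: (C_class_ext oU _ (C_classD oU (C_class_cst r U (vsl j 0)) (C_class_sum (index_enum 'I_n) xpredT oU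
   (fun i => C_classM oU (hn i) (C_class_cst r U (alpha i j)))))) => w _.
by rewrite [RHS]vslE.
Qed.

Lemma vert_dom_open : open vert_dom.
Proof.
pose F j w : R := if [pick i | f i == j] is Some _ then 1 else vsl j w.
have FE : vert_dom = [set w | forall j, 0 < F j w].
  apply/seteqP; split=> w hw j; rewrite /F.
    by case: pickP => // h; apply: hw => i; rewrite h.
  by move=> h; have := hw j; rewrite /F pick_out.
have cF j : C_class 0 setT (F j).
  rewrite /F; case: pickP => [i _|_]; first exact: (C_class_cst 0 setT (1 : R)).
  exact: (@C_class_vsl 0 setT j openT).
rewrite FE openE => w hw.
have hj j : \forall q \near w, 0 < F j q.
  exact: (cvgr_gt _ (cF j w Logic.I) 0 (hw j)).
exact: (@filter_forall _ _ (fun j q => 0 < F j q) _ _ hj).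
Qed.

Lemma vert_smooth : smooth_on vert_dom vert_map.
Proof.
move=> r; have oD := vert_dom_open.
apply: (C_class_coord oD) => k; case: (split_ordP k) => j ->.
  have [[i ->]|h] := range_cases j.
    apply: (C_class_ext oD _ (C_class_rV_coord r _ (lshift n i))) => w _.
    by rewrite /vert_map row_mxEl mxE pick_range.
  have h2 := C_classM oD (C_class_cst r vert_dom (2 : R)) (C_class_vsl r j oD).
  have h3 : C_class r vert_dom (fun w => Num.sqrt (2 * vsl j w)).
    apply: (@C_class_comp1 _ _ r vert_dom _ (fun x => 2 * vsl j x) Num.sqrt oD _ (C_class_sqrt R r) h2) => x Dx.
    by rewrite /= mulr_gt0 //; exact: Dx.
  apply: (C_class_ext oD _ h3) => w _; by rewrite /vert_map row_mxEl mxE pick_out.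
have [[i ->]|h] := range_cases j.
  apply: (C_class_ext oD _ (C_class_rV_coord r _ (rshift n i))) => w _.
  by rewrite /vert_map row_mxEr mxE pick_range.
apply: (C_class_ext oD _ (C_class_cst r vert_dom (0 : R))) => w _.
by rewrite /vert_map row_mxEr mxE pick_out.
Qed.

Lemma vert_diff_range w d i : vert_dom w ->
  'd vert_map w d 0 (lshift m (f i)) = d 0 (lshift n i) /\
  'd vert_map w d 0 (rshift m (f i)) = d 0 (rshift n i).
Proof.
move=> Dw; have dZ := smooth_differentiable vert_smooth Dw.
split; apply: diff_coord_line => //.
  rewrite (_ : (fun h => _) = (fun h => w 0 (lshift n i) + h * d 0 (lshift n i))).
    exact: is_derive_affine.
  by apply/funext => h; rewrite /vert_map row_mxEl mxE pick_range !mxE.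
rewrite (_ : (fun h => _) = (fun h => w 0 (rshift n i) + h * d 0 (rshift n i))).
  exact: is_derive_affine.
by apply/funext => h; rewrite /vert_map row_mxEr mxE pick_range !mxE.
Qed.

Lemma vert_diff_out w d j : vert_dom w -> (forall i, f i != j) ->
  'd vert_map w d 0 (rshift m j) = 0.
Proof.
move=> Dw hj; have dZ := smooth_differentiable vert_smooth Dw.
apply: diff_coord_line => //.
rewrite (_ : (fun h => _) = cst 0); first exact: is_derive_cst.
by apply/funext => h; rewrite /vert_map row_mxEr mxE pick_out.
Qed.

Lemma big_range (T : Type) (idx : T) (op : Monoid.com_law idx) (F : 'I_m -> T) :
  (forall j, (forall i, f i != j) -> F j = idx) ->
  \big[op/idx]_j F j = \big[op/idx]_i F (f i).
Proof.
move=> h; rewrite (partition_big f xpredT) //=; apply: eq_bigr => j _.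
have [[i ->]|hj] := range_cases j.
  by rewrite (big_pred1 i) // => i'; rewrite /= inj_eq.
by rewrite h // big1 // => i /eqP ij; have := hj i; rewrite ij eqxx.
Qed.

(** Off the frame the slice is real, so those coordinates contribute nothing; on the frame it is the
    identity. *)
Lemma vert_form w a a' : vert_dom w ->
  omega0 ('d vert_map w a) ('d vert_map w a') = omega0 a a'.
Proof.
move=> Dw; rewrite {1}/omega0 big_range; last first.
  by move=> j hj; rewrite !(vert_diff_out _ Dw hj) mulr0 mul0r subr0.
apply: eq_bigr => i _.
by have [-> ->] := vert_diff_range a i Dw; have [-> ->] := vert_diff_range a' i Dw.
Qed.

Lemma pi_lin_range (t : 'I_m -> R) : (forall j, (forall i, f i != j) -> t j = 0) ->
  pi_lin b t = (\row_i t (f i)) *m BJ.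
Proof.
move=> h; apply/rowP => k; rewrite /pi_lin summxE mxE big_range => [|j hj].
  by apply: eq_bigr => i _; rewrite !mxE.
by rewrite mxE h // mul0r.
Qed.

(** Off the frame the slice stays real and positive, so an infinitesimal rotation tangent to it has
    xi_j = 0 there; then xi in Lie(K) and the independence of the frame normals kill the other
    components. *)
Lemma vert_transverse w d (xi : 'I_m -> R) : vert_dom w -> LieK b xi ->
  'd vert_map w d = torus_inf_act xi (vert_map w) -> d = 0.
Proof.
move=> Dw Kxi e.
have z1 j : torus_inf_act xi (vert_map w) 0 (lshift m j) = - xi j * vert_map w 0 (rshift m j).
  by rewrite /torus_inf_act /of_zcoord row_mxEl mxE /zcoord /=; ring.
have z2 j : torus_inf_act xi (vert_map w) 0 (rshift m j) = xi j * vert_map w 0 (lshift m j).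
  by rewrite /torus_inf_act /of_zcoord row_mxEr mxE /zcoord /=; ring.
have xi0 j : (forall i, f i != j) -> xi j = 0.
  move=> hj; have := vert_diff_out d Dw hj; rewrite e z2.
  rewrite /vert_map row_mxEl mxE (pick_out hj) => /eqP; rewrite mulf_eq0 => /orP[/eqP //|].
  by rewrite gt_eqF // sqrtr_gt0 mulr_gt0 //; exact: Dw.
have xif i : xi (f i) = 0.
  have : (\row_i xi (f i)) *m BJ = 0 by rewrite -pi_lin_range.
  move=> /(congr1 (mulmx^~ (invmx BJ))); rewrite mulmxK // mul0mx => /rowP/(_ i).
  by rewrite !mxE.
apply/rowP => k; rewrite [RHS]mxE; case: (split_ordP k) => i ->.
  by have [<- _] := vert_diff_range d i Dw; rewrite e z1 xif oppr0 mul0r.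
by have [_ <-] := vert_diff_range d i Dw; rewrite e z2 xif mul0r.
Qed.

Lemma vert_map_inj w w' : vert_map w = vert_map w' -> w = w'.
Proof. by move=> e; apply: zcoord_inj => i; rewrite -!zcoord_vert e. Qed.

(** The isotropy group of the vertex: in the frame coordinates it is the kernel of the endomorphism
    of T^n given by the integer matrix of the normals b_(f i). *)
Definition vert_group : set ('I_m -> R[i]) :=
  [set g | torusK b g /\ forall j, (forall i, f i != j) -> g j = 1].

Lemma vert_group_act g w : vert_group g ->
  vert_map (torus_act (g \o f) w) = torus_act g (vert_map w).
Proof.
move=> [[tg _] g1]; apply: zcoord_inj => j; rewrite zcoord_act.
have [[i ->]|h] := range_cases j; first by rewrite !zcoord_vert zcoord_act.
rewrite !zcoord_vert_out // g1 // mul1r /vsl.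
suff -> : vert_u (torus_act (g \o f) w) = vert_u w by [].
rewrite /vert_u; congr (_ *m _); apply/rowP => i; rewrite !mxE half_normsq_act // => j'.
exact: tg.
Qed.

Lemma vert_dom_act g w : torus g -> vert_dom w -> vert_dom (torus_act (g \o f) w).
Proof.
move=> tg Dw j hj; rewrite vslE; have := Dw j hj; rewrite vslE.
suff -> : \sum_i half_normsq (torus_act (g \o f) w) i * alpha i j =
  \sum_i half_normsq w i * alpha i j by [].
by apply: eq_bigr => i _; rewrite half_normsq_act // => j'; exact: tg.
Qed.

Lemma vert_group_full g w w' : torusK b g -> vert_dom w -> vert_dom w' ->
  vert_map w' = torus_act g (vert_map w) -> vert_group g.
Proof.
move=> Kg Dw Dw' e; split=> // j hj; have [tg _] := Kg.
have hh : vsl j w' = vsl j w.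
  by rewrite -!half_normsq_vert // e half_normsq_act.
have := zcoord_act g (vert_map w) j; rewrite -e !zcoord_vert_out // hh -[LHS]mul1r.
move=> /mulIf -> //; have : 0 < Num.sqrt (2 * vsl j w) by rewrite sqrtr_gt0 mulr_gt0 //; exact: Dw.
by move=> s0; apply/eqP => /complexI s1; move: s0; rewrite s1 ltxx.
Qed.

(** Raising the defining relations to powers given by the adjugate of the integer matrix B of frame
    normals yields g_(f i)^(det B) = 1, so all coordinates belong to a finite set of roots of
    unity. *)
Lemma vert_group_finite : finite_set vert_group.
Proof.
pose B : 'M[int]_n := \matrix_(i, k) b (f i) 0 k.
have detB : \det B != 0.
  have BE : BJ = map_mx intr B by apply/matrixP => i k; rewrite !mxE.
  move: BJ_unit; rewrite unitmxE BE det_map_mx unitfE.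
  by apply: contra => /eqP ->.
have detB0 : (0 < `|\det B|)%N by rewrite absz_gt0.
have [s hs] := @unity_roots_finite R[i] _ detB0.
have roots g i : vert_group g -> g (f i) ^+ `|\det B| = 1.
  move=> [[tg pg] g1].
  have gu i' : g (f i') != 0 by exact: torus_neq0.
  have col k : \prod_i' g (f i') ^ B i' k = 1.
    transitivity (\prod_j g j ^ b j 0 k); last by rewrite -[LHS]/(pi_torus b g k) pg.
    rewrite [RHS]big_range => [|j hj]; last by rewrite g1 // exp1rz.
    by apply: eq_bigr => i' _; rewrite mxE.
  have powz : g (f i) ^ (\det B) = 1.
    transitivity (\prod_k (\prod_i' g (f i') ^ B i' k) ^ (\adj B k i)).
      have e i' : \prod_k (g (f i') ^ B i' k) ^ (\adj B k i) = g (f i') ^ ((\det B)%:M i' i).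
        have hm : {morph (exprz (g (f i'))) : x y / x + y >-> x * y}.
          by move=> x y; rewrite expfzDr.
        rewrite -mul_mx_adj mxE (big_morph _ hm (expr0z _)).
        by apply: eq_bigr => k _; rewrite exprz_exp.
      under [RHS]eq_bigr do rewrite (big_morph _ (fun x y => expfzMl x y _) (exp1rz _ _)).
      rewrite exchange_big (eq_bigr _ (fun i' _ => e i')) (bigD1 i) //= big1 => [|i' ii'].
        by rewrite mulr1 mxE eqxx.
      by rewrite mxE (negbTE ii') expr0z.
    by apply: big1 => k _; rewrite col exp1rz.
  by have := powz; case: (\det B) => d //=; rewrite NegzE -exprnN => /eqP; rewrite invr_eq1 => /eqP.
apply: (@finite_fun_set _ _ (1 :: s)) => g Gg j.
have [[i ->]|hj] := range_cases j.
  by rewrite inE hs ?orbT // roots.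
by case: Gg => _ ->; rewrite ?inE ?eqxx.
Qed.

Definition vert_chart : uniformizing_chart (n := n) b lambda.
Proof.
refine (@UniformizingChart R n m b lambda vert_dom vert_map vert_group _ _ _ _ _ _ _ _ _ _ _ _ _).
- exact: vert_dom_open.
- exact: vert_dom_connected.
- exact: vert_smooth.
- by move=> x; exact: vert_level.
- by move=> x x' _ _; exact: vert_map_inj.
- by move=> x w xi; exact: vert_transverse.
- by move=> g [].
- exact: vert_group_finite.
- by split=> //; exact: torusK1.
- move=> g h [Kg g1] [Kh h1]; split; first exact: torusKM.
  by move=> j hj; rewrite g1 // h1 // mulr1.
- move=> g [Kg g1]; split; first exact: torusKV.
  by move=> j hj; rewrite g1 // invr1.
- move=> g x Gg Dx; exists (torus_act (g \o f) x); last exact: vert_group_act.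
  by apply: vert_dom_act => //; case: Gg => -[].
- by move=> g x x'; exact: vert_group_full.
Defined.

Lemma pi_linD (s t : 'I_m -> R) : pi_lin b (fun j => s j + t j) = pi_lin b s + pi_lin b t.
Proof. by rewrite /pi_lin -big_split; apply: eq_bigr => j _; rewrite scalerDl. Qed.

(** An element of K is needed that makes the coordinates off the frame positive real. Its angles
    there are prescribed, and invertibility of [BJ] supplies the frame angles [r] that bring the
    whole vector into Lie(K). What happens to the frame coordinates is irrelevant, as they are free
    in the slice. *)
Lemma vert_surjective z : level_set b lambda z ->
  (forall j, zcoord z j = 0 -> exists i, f i = j) ->
  exists2 w, vert_dom w & orbit b (vert_map w) = orbit b z.
Proof.
move=> /level_setP[u hu] z0.
have hz j : exists t : R, (forall i, f i != j) -> zcoord z j = `|zcoord z j| * cexp t.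
  have [[i ->]|h] := range_cases j; first by exists 0 => /(_ i); rewrite eqxx.
  have zn : zcoord z j != 0.
    by apply/eqP => /z0[i ij]; have := h i; rewrite ij eqxx.
  have [|t ht] := @cexp_polar R (zcoord z j / `|zcoord z j|).
    by rewrite normrM normfV normr_id divff // normr_eq0.
  by exists t => _; rewrite -ht mulrCA divff ?mulr1 // normr_eq0.
have [t ht] := choice hz.
pose T j := if [pick i | f i == j] is Some _ then 0 else - t j.
pose r := - pi_lin b T *m invmx BJ.
pose Tr j := if [pick i | f i == j] is Some i then r 0 i else 0.
have Ktau : LieK b (fun j => T j + Tr j).
  rewrite /LieK /= pi_linD (pi_lin_range (t := Tr)); last by move=> j hj; rewrite /Tr pick_out.
  have -> : \row_i Tr (f i) = r by apply/rowP => i; rewrite mxE /Tr pick_range.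
  by rewrite /r mulmxKV // subrr.
have Kg := torusK_cexp Ktau; set g := fun j => _ in Kg.
have tg : torus g by case: Kg.
pose w : V := of_zcoord (fun i => g (f i) * zcoord z (f i)).
have wE i : zcoord w i = g (f i) * zcoord z (f i) by exact: of_zcoordK.
have hw : vert_u w = u.
  apply: BJ_pairing_inj => i; rewrite vert_uE hu; congr (_ + _).
  apply: (mulfI (_ : 2 != 0 :> R)); first by rewrite pnatr_eq0.
  by apply: (@complexI R); rewrite !half_normsq_norm wE normrM tg mul1r.
have slE j : vsl j w = half_normsq z j by rewrite /vsl hw hu addrK.
exists w.
  move=> j hj; rewrite slE lt0r half_normsq_ge0 half_normsq_eq0 andbT.
  by apply/eqP => /z0[i ij]; have := hj i; rewrite ij eqxx.
rewrite -(orbit_act z Kg); congr orbit; apply: zcoord_inj => j; rewrite zcoord_act.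
have [[i ->]|hj] := range_cases j; first by rewrite zcoord_vert wE.
rewrite zcoord_vert_out // slE (ht _ hj) /g /T /Tr (pick_out hj) addr0.
rewrite [RHS]mulrCA -cexpD addNr cexp0 mulr1 normc_def /half_normsq mulrCA divff ?mulr1 ?pnatr_eq0 //.
Qed.

Definition reflection (i0 : 'I_n) (j : 'I_m) : R[i] :=
  if j == f i0 then cexp (2 * pi / (c (f i0))%:R) else 1.

(** The normal is b = c v with v integral, so the angle 2 pi / c in this single coordinate is mapped
    to 2 pi v, which is trivial in T^n. *)
Lemma vert_group_reflection i0 : (0 < c (f i0))%N -> vert_group (reflection i0).
Proof.
move=> c0; split; last first.
  by move=> j hj; rewrite /reflection; case: eqP => // e; have := hj i0; rewrite e eqxx.
pose T j : R := if j == f i0 then 2 * pi / (c (f i0))%:R else 0.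
have -> : reflection i0 = fun j => cexp (T j).
  by apply/funext => j; rewrite /reflection /T; case: ifP => // _; rewrite cexp0.
split=> [j|]; first exact: norm_cexp.
apply/funext => k; rewrite pi_torus_cexp /pi_lin summxE (bigD1 (f i0)) //= big1 ?addr0.
  rewrite /T eqxx !mxE -[RHS](cexp_2pi R (v (f i0) 0 k)); congr cexp.
  by rewrite intrM; field; rewrite pnatr_eq0 -lt0n.
by move=> j ji; rewrite /T (negbTE ji) scale0r mxE.
Qed.

End VertexChart.

(** * Reflection-invariant Hamiltonians *)

Section Intervals.
Variable R : realType.

(** Connectedness of [0, 1]. Near T the hypothesis compares arbitrary pairs of times without
    assuming anything at T itself, so it covers both the openness and the closedness of the set of
    good times. *)
Lemma locally_constant_interval (A : R -> Prop) :
  (forall T : R, 0 <= T <= 1 -> exists2 d : R, 0 < d & forall s t : R,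
     0 <= s <= 1 -> 0 <= t <= 1 -> `|s - T| < d -> `|t - T| < d -> A s -> A t) ->
  A 0 -> forall t : R, 0 <= t <= 1 -> A t.
Proof.
move=> hA A0.
pose E : set R := [set t : R | 0 <= t <= 1 /\ forall s : R, 0 <= s <= t -> A s].
have E0 : E 0.
  split=> [|s]; first by rewrite lexx ler01.
  by move=> /le_anti <-.
have ubE : ubound E 1 by move=> t [/andP[]].
have hsE : has_sup E by split; [exists 0|exists 1].
set T := sup E.
have T0 : 0 <= T by apply: ub_le_sup E0; exists 1.
have T1 : T <= 1 by apply: ge_sup => //; exists 0.
have [d d0 hd] := hA T (introT andP (conj T0 T1)).
have [s [/andP[s0 s1] sA] sT] := sup_adherent d0 hsE; rewrite -/T in sT.
have sT' : s <= T by apply: ub_le_sup; [exists 1|split=> //; apply/andP].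
have As : A s by apply: sA; rewrite s0 lexx.
have far (t : R) : 0 <= t <= 1 -> t < T + d -> A t.
  move=> /andP[t0 t1] tT; have [ts|ts] := leP t s; first by apply: sA; rewrite t0.
  by apply: (hd s) => //; rewrite ?s0 ?t0 // ltr_norml; apply/andP; split; lra.
suff T1' : 1 < T + d by move=> t t01; apply: far => //; case/andP: t01 => _; lra.
rewrite ltNge; apply/negP => Td.
suff : T + d / 2 <= T by lra.
apply: ub_le_sup; first by exists 1.
split; first by apply/andP; split; lra.
by move=> t /andP[t0 t1]; apply: far; [apply/andP; split; lra|lra].
Qed.

Lemma is_derive_near (W : normedModType R) (f g : R -> W) (t : R) d :
  (\forall s \near t, f s = g s) -> is_derive t 1 f d -> is_derive t 1 g d.
Proof.
exact: near_eq_is_derive.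
Qed.

Lemma is_derive_glue (W : normedModType R) (f g : R -> W) (t : R) d : f t = g t ->
  is_derive t 1 f d -> is_derive t 1 g d ->
  is_derive t 1 (fun s => if s < t then f s else g s) d.
Proof.
move=> fg [df Df] [dg Dg]; set F := fun s => _.
have lim_f : (fun h : R => h^-1 *: (f (h *: 1 + t) - f t)) @ 0^' --> d.
  by rewrite -Df; exact: df.
have lim_g : (fun h : R => h^-1 *: (g (h *: 1 + t) - g t)) @ 0^' --> d.
  by rewrite -Dg; exact: dg.
have lim_F : (fun h : R => h^-1 *: (F (h *: 1 + t) - F t)) @ 0^' --> d.
  apply/cvgrPdist_lt => e e0.
  move/cvgrPdist_lt: lim_f => /(_ _ e0); move/cvgrPdist_lt: lim_g => /(_ _ e0).
  apply: filterS2 => h hg hf; rewrite /F ltxx; case: ifP => _; last exact: hg.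
  by rewrite -fg.
by split; [apply: (cvgP d)|exact: cvg_lim].
Qed.

(* Compare the maximum of |a| + |b| over a short interval with the mean value
   theorem. *)
Lemma flat_zero (a b a' b' : R -> R) (t0 d L : R) : 0 < d ->
  (forall t : R, `|t - t0| < d -> is_derive t 1 a (a' t) /\ is_derive t 1 b (b' t)) ->
  (forall t : R, `|t - t0| < d -> `|a' t| <= L * (`|a t| + `|b t|) /\ `|b' t| <= L * (`|a t| + `|b t|)) ->
  a t0 = 0 -> b t0 = 0 ->
  exists2 e : R, 0 < e & forall t : R, `|t - t0| < e -> a t = 0 /\ b t = 0.
Proof.
move=> d0 der bound a0 b0.
(* With this radius the mean value theorem gives q s <= 2 |L| (q s) e <= (q s) / 2 at the maximum
   point [s], hence q s = 0. *)
pose e := Num.min (d / 2) ((4 * (`|L| + 1))^-1).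
have L1 : 0 < 4 * (`|L| + 1) by have := normr_ge0 L; lra.
have e0 : 0 < e by rewrite lt_min invr_gt0 L1 andbT; lra.
have ed : e < d by apply: (@le_lt_trans _ _ (d / 2)); [rewrite ge_min lexx|lra].
have eL : 4 * (`|L| + 1) * e <= 1.
  by rewrite mulrC -ler_pdivlMr // mul1r ge_min lexx orbT.
exists e => // t te.
have near_der (s : R) : `|s - t0| <= e -> `|s - t0| < d by move=> h; exact: le_lt_trans ed.
have cont (f f' : R -> R) (s : R) : is_derive s 1 f (f' s) -> {for s, continuous (f : R -> R)}.
  by move=> [df _]; apply: differentiable_continuous; apply/derivable1_diffP.
have itvE (s : R) : s \in `[t0 - e, t0 + e] = (`|s - t0| <= e).
  by rewrite in_itv /= ler_norml; apply/andP/andP; case=> h1 h2; split; lra.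
pose q (s : R) : R := `|a s| + `|b s|.
have cq : {within `[t0 - e, t0 + e], continuous q}.
  apply: continuous_in_subspaceT => s; rewrite inE /= => hs.
  have {}hs : `|s - t0| <= e by rewrite -itvE.
  have [da db] := der s (near_der s hs).
  apply: (@continuousD _ _ _ (fun s => `|a s|) (fun s => `|b s|)).
    apply: (@continuous_comp _ _ _ a (fun x : R => `|x|)); first exact: cont da.
    exact: norm_continuous.
  apply: (@continuous_comp _ _ _ b (fun x : R => `|x|)); first exact: cont db.
  exact: norm_continuous.
have le_e : t0 - e <= t0 + e by lra.
have [s se hs] := EVT_max le_e cq.
rewrite itvE in se.
have mv (f f' : R -> R) : (forall r : R, `|r - t0| < d -> is_derive r 1 f (f' r)) ->
    (forall r : R, `|r - t0| < d -> `|f' r| <= L * q r) -> f t0 = 0 -> `|f s| <= `|L| * q s * e.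
  move=> df bf f0.
  have key (r : R) : `|r - t0| <= e -> `|f' r| <= `|L| * q s.
    move=> re; apply: le_trans (bf r (near_der r re)) _.
    have qr : 0 <= q r by rewrite addr_ge0.
    apply: (@le_trans _ _ (`|L| * q r)); first by rewrite ler_wpM2r // ler_norm.
    by rewrite ler_wpM2l //; apply: hs; rewrite itvE.
  have mvt (x y : R) : x <= y -> `|x - t0| <= e -> `|y - t0| <= e -> exists2 r : R, `|r - t0| <= e & f y - f x = f' r * (y - x).
    move=> xy xe ye.
    have inn (r : R) : x <= r -> r <= y -> `|r - t0| <= e.
      move=> h1 h2; move: xe ye; rewrite !ler_norml => /andP[x1 x2] /andP[y1 y2]; apply/andP; split; lra.
    have [r|r1|r] := @MVT_segment _ f f' x y xy.
    - by rewrite in_itv /= => /andP[h1 h2]; apply: df; apply: near_der; apply: inn; exact: ltW.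
    - apply: continuous_in_subspaceT => r; rewrite inE /= in_itv /= => /andP[h1 h2].
      by apply: (cont f f'); apply: df; apply: near_der; exact: inn.
    by rewrite in_itv /= => /andP[h1 h2] ->; exists r => //; exact: inn.
  have z0 : `|t0 - t0| <= e by rewrite subrr normr0 ltW.
  have [st|st] := leP s t0.
    have [r re] := mvt s t0 st se z0; rewrite f0 sub0r => E.
    rewrite -normrN E normrM ler_pM // ?key // -normrN opprB //.
  have [r re] := mvt t0 s (ltW st) z0 se; rewrite f0 subr0 => E.
  by rewrite E normrM ler_pM // key.
have ha := mv a a' (fun r h => (der r h).1) (fun r h => (bound r h).1) a0.
have hb := mv b b' (fun r h => (der r h).2) (fun r h => (bound r h).2) b0.
have qs : 0 <= q s by rewrite addr_ge0.
have q0 : q s = 0.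
  have : q s <= 2 * (`|L| * q s * e) by rewrite {1}/q; lra.
  have : 4 * `|L| * e <= 1 by lra.
  by nra.
have : q t <= 0 by rewrite -q0; apply: hs; rewrite itvE ltW.
rewrite /q => qt; have := normr_ge0 (a t); have := normr_ge0 (b t) => h1 h2.
by split; apply/eqP; rewrite -normr_le0; lra.
Qed.

End Intervals.

Section HamiltonianField.
Variables (R : realType) (n : nat).
Local Notation V := 'rV[R]_(n + n).

Lemma diff_slice (K : R * V -> R) (t : R) (x w : V) : differentiable K (t, x) ->
  'd (fun y => K (t, y)) x w = 'd K (t, x) (0, w).
Proof.
move=> dK; pose F (y : V) : R * V := (t, y).
have dF : is_diff x F (fun w => (0, w)) := is_diff_pair (is_diff_cst t x) (is_diff_id x).
have dF1 : differentiable F x by case: dF.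
rewrite (_ : (fun y => _) = K \o F) // diff_comp //.
by rewrite /= (diff_val (df := fun w => (0, w))).
Qed.

Lemma omega0_delta_r (a : V) i : omega0 a (delta_mx 0 (rshift n i)) = a 0 (lshift n i).
Proof.
rewrite /omega0 (bigD1 i) //= big1 ?addr0 => [|j ji].
  by rewrite !mxE !eqxx ?(eq_lrshift, eq_rlshift) /= mulr1 mulr0 subr0.
by rewrite !mxE ?(eq_lrshift, eq_rlshift) (inj_eq (@rshift_inj _ _)) (negbTE ji) /= !mulr0 subr0.
Qed.

Lemma omega0_delta_l (a : V) i : omega0 a (delta_mx 0 (lshift n i)) = - a 0 (rshift n i).
Proof.
rewrite /omega0 (bigD1 i) //= big1 ?addr0 => [|j ji].
  by rewrite !mxE !eqxx ?(eq_lrshift, eq_rlshift) /= mulr1 mulr0 sub0r.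
by rewrite !mxE ?(eq_lrshift, eq_rlshift) (inj_eq (@lshift_inj _ _)) (negbTE ji) /= !mulr0 subr0.
Qed.

Lemma ham_field_unique (K : R * V -> R) (t : R) (x a : V) : differentiable K (t, x) ->
  (forall w, omega0 a w = 'd (fun y => K (t, y)) x w) -> a = ham_field K t x.
Proof.
move=> dK h.
have E k : omega0 a (delta_mx 0 k) = pgrad K (t, x) k.
  by rewrite h diff_slice // pgrad.unlock.
apply/rowP => k; case: (split_ordP k) => i ->.
  by rewrite ham_field_l -E omega0_delta_r.
by rewrite ham_field_r -E omega0_delta_l opprK.
Qed.

End HamiltonianField.

Section Rotation.
Variables (R : realType) (n : nat) (i0 : 'I_n) (al : R).
Hypothesis al_small : 0 < al < 2 * pi.
Local Notation V := 'rV[R]_(n + n).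

Let g (i : 'I_n) : R[i] := if i == i0 then cexp al else 1.

Lemma torus_act_re_im (k : nat) (h : 'I_k -> R[i]) (y : 'rV[R]_(k + k)) j :
  torus_act h y 0 (lshift k j) =
    complex.Re (h j) * y 0 (lshift k j) - complex.Im (h j) * y 0 (rshift k j) /\
  torus_act h y 0 (rshift k j) =
    complex.Re (h j) * y 0 (rshift k j) + complex.Im (h j) * y 0 (lshift k j).
Proof.
by rewrite /torus_act /of_zcoord row_mxEl row_mxEr !mxE /zcoord; case: (h j).
Qed.

Lemma torus_act_line (k : nat) (h : 'I_k -> R[i]) (x w : 'rV[R]_(k + k)) (s : R) :
  torus_act h (x + s *: w) = torus_act h x + s *: torus_act h w.
Proof.
apply/rowP => i; rewrite [RHS]mxE rowZ; case: (split_ordP i) => j ->.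
  by rewrite !(torus_act_re_im _ _ _).1 !mxE; ring.
by rewrite !(torus_act_re_im _ _ _).2 !mxE; ring.
Qed.

Lemma rotation_fix (x : V) : zcoord x i0 = 0 -> torus_act g x = x.
Proof.
move=> x0; apply: zcoord_inj => i; rewrite zcoord_act /g.
by case: eqP => [->|_]; rewrite ?x0 ?mulr0 ?mul1r.
Qed.

(* The rotation of angle al fixes the component of the gradient in the plane of
   i0, hence this component vanishes. *)
Lemma rotation_critical (K : R * V -> R) (t : R) (x : V) :
  (\forall y \near x, K (t, torus_act g y) = K (t, y)) ->
  differentiable K (t, x) -> zcoord x i0 = 0 ->
  pgrad K (t, x) (lshift n i0) = 0 /\ pgrad K (t, x) (rshift n i0) = 0.
Proof.
move=> Kg dK x0.
have dd (w : V) : 'd K (t, x) (0, torus_act g w) = 'd K (t, x) (0, w).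
  have e (z : V) : 'd K (t, x) (0, z) = 'D_1 (fun s : R => K (t, x + s *: z)) 0.
    have dK0 : differentiable K (t, x + (0 : R) *: z) by rewrite scale0r addr0.
    by have [_ ->] := is_derive_line dK0; rewrite scale0r addr0.
  rewrite !e; apply: near_eq_derive.
  have cl : (fun s : R => x + s *: w) @ (0 : R) --> x + (0 : R) *: w.
    apply: (@continuousD _ _ _ (fun=> x) (fun s : R => s *: w)); first exact: cvg_cst.
    exact: scalel_continuous.
  rewrite scale0r addr0 in cl.
  have h : \forall s \near (0 : R), K (t, torus_act g (x + s *: w)) = K (t, x + s *: w).
    exact: cl _ Kg.
  near=> s; have -> : x + s *: torus_act g w = torus_act g (x + s *: w).
    by rewrite torus_act_line (rotation_fix x0).
  by near: s.
set p := pgrad K (t, x) (lshift n i0); set q := pgrad K (t, x) (rshift n i0).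
have E w : (forall i, i != i0 -> zcoord w i = 0) ->
    'd K (t, x) (0, w) = p * w 0 (lshift n i0) + q * w 0 (rshift n i0).
  move=> hw; rewrite diff_pgrad // big_split_ord /= (bigD1 i0) //= big1 ?addr0.
    rewrite (bigD1 i0) //= big1 ?addr0 //.
    by move=> i ii; have := hw i ii; rewrite /zcoord => -[_ ->]; rewrite mulr0.
  by move=> i ii; have := hw i ii; rewrite /zcoord => -[-> _]; rewrite mulr0.
have eqs (a b : R) : p * (cos al * a - sin al * b) + q * (cos al * b + sin al * a) = p * a + q * b.
  pose w : V := of_zcoord (fun i => if i == i0 then (a +i* b)%C else 0).
  have hw i : i != i0 -> zcoord w i = 0 by move=> ii; rewrite of_zcoordK (negbTE ii).
  have hgw i : i != i0 -> zcoord (torus_act g w) i = 0.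
    by move=> ii; rewrite zcoord_act hw // mulr0.
  have := dd w; rewrite !E //.
  have [-> ->] := torus_act_re_im g w i0.
  by rewrite /w /of_zcoord row_mxEl row_mxEr !mxE /g eqxx /=.
have c1 : cos al != 1.
  apply/eqP => ca; have /andP[al0 al2] := al_small.
  have : al = 0 by apply: cos_eq1_small => //; rewrite (ltW al0).
  by move=> a0; move: al0; rewrite a0 ltxx.
have c2 : cos al < 1 by rewrite lt_neqAle c1 cos_le1.
have e1 := eqs 1 0; have e2 := eqs 0 1.
have s2 : 1 - cos al ^+ 2 = sin al ^+ 2 by have := cos2Dsin2 al; lra.
have {}e1 : p * (1 - cos al) = q * sin al by lra.
have {}e2 : q * (1 - cos al) = - (p * sin al) by lra.
(* 2 (1 - cos al) is the determinant of the rotation minus the identity. *)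
have c0 : 0 < 2 * (1 - cos al) by lra.
split; apply: (mulIf (lt0r_neq0 c0)); rewrite mul0r.
  have -> : p * (2 * (1 - cos al)) = p * (1 - cos al) * (1 - cos al) + p * (1 - cos al ^+ 2).
    by ring.
  by rewrite e1 s2 mulrAC e2; ring.
have -> : q * (2 * (1 - cos al)) = q * (1 - cos al) * (1 - cos al) + q * (1 - cos al ^+ 2).
  by ring.
by rewrite e2 s2 mulNr mulrAC e1; ring.
Unshelve. all: by end_near. Qed.

(** The projection onto the locus fixed by the rotation. *)
Let kill (x : V) : V := of_zcoord (fun i => if i == i0 then 0 else zcoord x i).

Lemma kill_coord (x : V) i : kill x 0 (lshift n i) = (if i == i0 then 0 else x 0 (lshift n i)) /\
  kill x 0 (rshift n i) = (if i == i0 then 0 else x 0 (rshift n i)).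
Proof.
by rewrite /kill /of_zcoord row_mxEl row_mxEr !mxE; case: eqP.
Qed.

Lemma zcoord_kill (x : V) : zcoord (kill x) i0 = 0.
Proof. by rewrite of_zcoordK eqxx. Qed.

Lemma kill_near (x x0 : V) : zcoord x0 i0 = 0 -> `|kill x - x0| <= `|x - x0|.
Proof.
move=> [xl xr]; apply/(rV_norm_le _ (normr_ge0 _)) => k; rewrite rowB.
case: (split_ordP k) => i ->.
  rewrite (kill_coord x i).1; case: eqP => [->|_]; first by rewrite xl subr0 normr0.
  by rewrite -rowB coord_le_norm.
rewrite (kill_coord x i).2; case: eqP => [->|_]; first by rewrite xr subr0 normr0.
by rewrite -rowB coord_le_norm.
Qed.

Lemma kill_dist (x : V) :
  `|x - kill x| <= `|x 0 (lshift n i0)| + `|x 0 (rshift n i0)|.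
Proof.
have h : 0 <= `|x 0 (lshift n i0)| + `|x 0 (rshift n i0)| by rewrite addr_ge0.
apply/(rV_norm_le _ h) => k; rewrite rowB.
case: (split_ordP k) => i ->.
  rewrite (kill_coord x i).1; case: eqP => [->|_]; last by rewrite subrr normr0.
  by rewrite subr0 lerDl.
rewrite (kill_coord x i).2; case: eqP => [->|_]; last by rewrite subrr normr0.
by rewrite subr0 lerDr.
Qed.

Variables (D : set V) (K : R * V -> R).
Hypothesis D_open : open D.
Hypothesis K_smooth : C_class 2 [set tx : R * V | D tx.2] K.
Hypothesis K_rot : forall (t : R) (x : V), D x -> K (t, torus_act g x) = K (t, x).

Lemma slab_open : open [set tx : R * V | D tx.2].
Proof.
by apply: (@open_comp _ _ (@snd R V) D) => // tx _; exact: cvg_snd.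
Qed.

(** The two partial derivatives in the rotation plane vanish at the projection of x to the fixed
    locus, and they are Lipschitz as [K] is of class C^2; so they are bounded by the distance from x
    to this locus. *)
Lemma rotation_lipschitz (t0 : R) (x0 : V) : D x0 -> zcoord x0 i0 = 0 ->
  exists2 d : R, 0 < d & exists L : R, forall (t : R) (x : V), `|t - t0| < d -> `|x - x0| < d ->
    `|pgrad K (t, x) (lshift n i0)| <= L * (`|x 0 (lshift n i0)| + `|x 0 (rshift n i0)|) /\
    `|pgrad K (t, x) (rshift n i0)| <= L * (`|x 0 (lshift n i0)| + `|x 0 (rshift n i0)|).
Proof.
move=> Dx0 z0.
have [dK cK] := K_smooth.
have lip k : exists2 d : R, 0 < d & exists L : R, forall (t : R) (x y : V), `|t - t0| < d ->
    `|x - x0| < d -> `|y - x0| < d -> `|pgrad K (t, x) k - pgrad K (t, y) k| <= L * `|x - y|.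
  apply: (@locally_lipschitz R _ (fun q => pgrad K q k) _ t0 x0 slab_open _ Dx0).
  rewrite pgrad.unlock; exact: cK.
have [d1 d10 [L1 h1]] := lip (lshift n i0).
have [d2 d20 [L2 h2]] := lip (rshift n i0).
have [d3 /= d30 hD] : exists2 d : R, 0 < d & forall y : V, `|y - x0| < d -> D y.
  have : nbhs x0 D by exact: open_nbhs_nbhs.
  move=> /nbhs_normP[d d0 h]; exists d => // y yx; apply: h => /=; by rewrite distrC.
pose d := Num.min d1 (Num.min d2 d3).
exists d; first by rewrite !lt_min d10 d20 d30.
exists (`|L1| + `|L2|) => t x; rewrite !lt_min => /and3P[t1 t2 _] /and3P[x1 x2 x3].
have kx : `|kill x - x0| <= `|x - x0| by exact: kill_near.
have Dk : D (kill x) by apply: hD; exact: le_lt_trans kx x3.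
have [p0 q0] : pgrad K (t, kill x) (lshift n i0) = 0 /\ pgrad K (t, kill x) (rshift n i0) = 0.
  apply: rotation_critical; [|exact: dK|exact: zcoord_kill].
  have : nbhs (kill x) D by exact: open_nbhs_nbhs.
  by apply: filterS => y; exact: K_rot.
have hd := kill_dist x.
have := h1 t x (kill x) t1 x1 (le_lt_trans kx x1); rewrite p0 subr0 => {}h1.
have := h2 t x (kill x) t2 x2 (le_lt_trans kx x2); rewrite q0 subr0 => {}h2.
have LL (L : R) : L <= `|L1| + `|L2| -> L * `|x - kill x| <=
    (`|L1| + `|L2|) * (`|x 0 (lshift n i0)| + `|x 0 (rshift n i0)|).
  move=> hL; apply: (@le_trans _ _ ((`|L1| + `|L2|) * `|x - kill x|)); first by rewrite ler_wpM2r.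
  by rewrite ler_wpM2l // addr_ge0.
split; first by apply: le_trans h1 (LL _ _); apply: ler_wpDr => //; exact: ler_norm.
by apply: le_trans h2 (LL _ _); apply: ler_wpDl => //; exact: ler_norm.
Qed.

(** The two coordinates of gamma in the plane satisfy a linear differential inequality and vanish at
    t0, so [flat_zero] applies to them in both directions of time. *)
Lemma rotation_plane_invariant (t0 : R) (gamma : R -> V) : D (gamma t0) -> zcoord (gamma t0) i0 = 0 ->
  (\forall t \near t0, is_derive (t : R) 1 gamma (ham_field K t (gamma t))) ->
  \forall t \near t0, zcoord (gamma t) i0 = 0.
Proof.
move=> Dg z0 sol; have [zl zr] := z0.
have [d d0 [L hL]] := rotation_lipschitz t0 Dg z0.
have cg : gamma @ t0 --> gamma t0.
  have [dg _] := nbhs_singleton sol.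
  by apply: differentiable_continuous; apply/derivable1_diffP.
have [e /= e0 he] : exists2 e : R, 0 < e & forall t : R, `|t - t0| < e ->
    [/\ `|t - t0| < d, `|gamma t - gamma t0| < d & is_derive t 1 gamma (ham_field K t (gamma t))].
  have near_t : \forall t \near t0, [/\ `|t - t0| < d, `|gamma t - gamma t0| < d &
       is_derive (t : R) 1 gamma (ham_field K t (gamma t))].
    near=> t; split.
    - rewrite distrC; near: t; exact: cvgr_dist_lt.
    - rewrite distrC; near: t; by move/cvgrPdist_lt: cg => /(_ _ d0).
    - by near: t.
  move: near_t => /nbhs_normP[e e0 he]; exists e => // t te; apply: he => /=; by rewrite distrC.
pose a (t : R) : R := gamma t 0 (lshift n i0); pose b (t : R) : R := gamma t 0 (rshift n i0).
pose a' (t : R) : R := pgrad K (t, gamma t) (rshift n i0).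
pose b' (t : R) : R := - pgrad K (t, gamma t) (lshift n i0).
have der (t : R) : `|t - t0| < e -> is_derive t 1 a (a' t) /\ is_derive t 1 b (b' t).
  move=> /he[_ _ dg]; split.
    by rewrite /a' -ham_field_l; exact: is_derive_coord.
  by rewrite /b' -ham_field_r; exact: is_derive_coord.
have bnd (t : R) : `|t - t0| < e ->
    `|a' t| <= L * (`|a t| + `|b t|) /\ `|b' t| <= L * (`|a t| + `|b t|).
  by move=> /he[td gd _]; rewrite /b' normrN; have [] := hL t _ td gd.
have [eps eps0 heps] := flat_zero e0 der bnd zl zr.
apply/nbhs_normP; exists eps => // t /=; rewrite distrC => /heps[at0 bt0].
by rewrite /zcoord -/(a t) -/(b t) at0 bt0.
Unshelve. all: by end_near. Qed.

End Rotation.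

(** * The flow on the regular part *)

Section Flow.
Variables (R : realType) (n m : nat) (P : set 'rV[R]_n) (v : 'I_m -> 'rV[int]_n)
  (c : 'I_m -> nat) (lambda : 'I_m -> R).
Hypothesis hP : labeled_simple_polytope P v c lambda.
Hypothesis hc : forall i, (2 <= c i)%N.
Variable S : 'M[R]_(n, m).
Hypothesis hS : S *m normal_mx R v c = 1%:M.
Local Notation V := 'rV[R]_(n + n).
Local Notation b := (labeled_normal v c).
Local Notation br := (real_normal R v c).
Local Notation D := (positive_slack br lambda).
Local Notation aa := (aa_map v c lambda S).
Local Notation orb := (orbit b).
Variables (H : R -> set 'rV[R]_(m + m) -> R) (psi : R -> set 'rV[R]_(m + m) -> set 'rV[R]_(m + m)).
Hypothesis H_smooth : smooth_hamiltonian (n := n) b lambda H.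
Hypothesis psi_flow : hamiltonian_isotopy (n := n) b lambda H psi.

Definition chart_ham (C : uniformizing_chart (n := n) b lambda) (tx : R * V) : R :=
  lift (H tx.1) C tx.2.

Lemma chart_flow (C : uniformizing_chart (n := n) b lambda) p (t0 : R) (x0 : V) :
  (forall x a a', ch_dom C x -> chart_form C x a a' = omega0 a a') ->
  toric_orbifold (n := n) b lambda p -> ch_dom C x0 -> chart_proj C x0 = psi t0 p ->
  exists2 gamma : R -> V, gamma t0 = x0 & \forall t \near t0,
    [/\ ch_dom C (gamma t), chart_proj C (gamma t) = psi t p
      & is_derive (t : R) 1 gamma (ham_field (chart_ham C) t (gamma t))].
Proof.
move=> formC tp Dx0 px0; have [_ _ flow] := psi_flow.
have [gamma g0 hg] := flow p C t0 x0 tp Dx0 px0; exists gamma => //.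
apply: filterS hg => t [Dg pg dg hv]; split=> //.
have [dK _] := H_smooth C 1%N.
apply: DeriveDef => //; apply: ham_field_unique; first exact: dK.
by move=> w; rewrite -hv formC.
Qed.

Definition aa_ham (tx : R * V) : R := H tx.1 (orb (aa tx.2)).

Lemma aa_ham_smooth r : C_class r (slack_dom br lambda) aa_ham.
Proof.
apply: (@C_class_sub _ _ _ r (\bigcup_th [set tx : R * V | aa_dom v c lambda th tx.2])).
  move=> tx Dx; exists (rsubmx tx.2) => //; split => //=.
  by rewrite subrr normr0 ltr01.
by apply: C_class_bigcup => th; exact: (H_smooth (aa_chart hP hS th) r).
Qed.

Lemma orb_lattice x k : orb (aa (x + lattice_vec R k)) = orb (aa x).
Proof. by have [g Kg ->] := aa_lattice lambda hS x k; rewrite orbit_act. Qed.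

Lemma aa_ham_periodic : theta_periodic aa_ham.
Proof. by move=> t x k; rewrite /aa_ham /= orb_lattice. Qed.

Lemma D_lattice x k : D x -> D (x + lattice_vec R k).
Proof. by move=> Dx j; rewrite slack_lattice. Qed.

Lemma ham_field_lattice (t : R) x k : D x ->
  ham_field aa_ham t (x + lattice_vec R k) = ham_field aa_ham t x.
Proof.
move=> Dx; have [dK _] := aa_ham_smooth 1.
have dx : differentiable aa_ham (t, x) by exact: dK.
have dx' : differentiable aa_ham (t, x + lattice_vec R k) by apply: dK; exact: D_lattice.
apply/rowP => i; case: (split_ordP i) => j ->.
  by rewrite !ham_field_l (pgrad_periodic_at _ aa_ham_periodic).
by rewrite !ham_field_r (pgrad_periodic_at _ aa_ham_periodic).
Qed.

Definition on_flow (p : set 'rV[R]_(m + m)) (xs : R -> V) (t : R) : Prop :=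
  [/\ D (xs t), orb (aa (xs t)) = psi t p & is_derive t 1 xs (ham_field aa_ham t (xs t))].

Lemma aa_flow p (t0 : R) (x0 : V) : toric_orbifold (n := n) b lambda p ->
  D x0 -> orb (aa x0) = psi t0 p ->
  exists2 gamma : R -> V, gamma t0 = x0 & \forall t \near t0, on_flow p gamma t.
Proof.
move=> tp Dx0 px0; pose C := aa_chart hP hS (rsubmx x0).
have DC : ch_dom C x0 by split=> //=; rewrite subrr normr0 ltr01.
have [|gamma g0 hg] := @chart_flow C p t0 x0 _ tp DC px0.
  by move=> x a a' [Dx _]; apply: aa_form.
by exists gamma => //; apply: filterS hg => t [[Dg _] pg dg].
Qed.

Definition regular p (t : R) : Prop := exists2 x, D x & orb (aa x) = psi t p.

Lemma regular_open p (t0 : R) : toric_orbifold (n := n) b lambda p ->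
  regular p t0 -> \forall t \near t0, regular p t.
Proof.
move=> tp [x Dx px]; have [gamma _ hg] := aa_flow tp Dx px.
by apply: filterS hg => t [Dg pg _]; exists (gamma t).
Qed.

(* The loci z_j = 0 are fixed by the reflections in the groups of the vertex
   charts, so the flow preserves them; this is where c_j >= 2 matters. *)
Lemma singular_open p (t0 : R) : toric_orbifold (n := n) b lambda p ->
  ~ regular p t0 -> \forall t \near t0, ~ regular p t.
Proof.
move=> tp nreg; have [toric _ _] := psi_flow.
have [z lz pz] := toric t0 p tp.
have [j0 zj0] : exists j, zcoord z j = 0.
  apply: contrapT => /forallNP h; apply: nreg.
  have [|x Dx px] := aa_surjective hS lz; first by move=> j; apply/eqP; exact: h.
  by exists x => //; rewrite px.
have /level_setP[u hu] := lz.
have hub j : pairing u (br j) = half_normsq z j + lambda j := hu j.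
have tightE j : zcoord z j = 0 -> pairing u (br j) = lambda j.
  by move=> z0; rewrite hub; have /eqP := z0; rewrite -half_normsq_eq0 => /eqP ->; rewrite add0r.
have Pu : P u.
  by apply/(polytopeE hP) => j; rewrite hub lerDr half_normsq_ge0.
(* The slice at a vertex of the face containing [u]: its frame includes every j with z_j = 0, so the
   slice meets the orbit of z. *)
have [f [f_inj frange [w Pw wtight] BJ]] := vertex_frame hP Pu.
have w_tight i : pairing w (br (f i)) = lambda (f i).
  by apply/eqP; apply/(wtight (f i)); exists i.
have w_slack j : (forall i, f i != j) -> lambda j < pairing w (br j).
  move=> hj; rewrite lt_neqAle (iffLR (polytopeE hP w) Pw) andbT eq_sym.
  by apply/negP => /(wtight j)[i ij]; have := hj i; rewrite ij eqxx.
pose C := vert_chart f_inj BJ w_tight w_slack.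
have zrange j : zcoord z j = 0 -> exists i, f i = j.
  by move=> zj; apply: frange; apply/eqP; exact: tightE.
have [x0 Dx0 px0] := vert_surjective f_inj BJ lz zrange.
have [i0 fi0] := zrange j0 zj0.
have [gamma g0 hg] : exists2 gamma : R -> V, gamma t0 = x0 & \forall t \near t0,
    [/\ ch_dom C (gamma t), chart_proj C (gamma t) = psi t p
      & is_derive (t : R) 1 gamma (ham_field (chart_ham C) t (gamma t))].
  apply: chart_flow => //; last by rewrite -pz.
  by move=> x a a' Dx; apply: vert_form.
have c2 := hc (f i0).
have c2R : 2 <= (c (f i0))%:R :> R by rewrite ler_nat.
pose al : R := 2 * pi / (c (f i0))%:R.
have al_small : 0 < al < 2 * pi.
  have p0 := pi_gt0 R; rewrite /al divr_gt0 ?mulr_gt0 //=; last by lra.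
  by rewrite ltr_pdivrMr; [nra|lra].
have zx0 : zcoord (gamma t0) i0 = 0.
  have [g Kg e] := orbit_eq px0; have [tg _] := Kg.
  have := zcoord_act g (vert_map v c lambda f x0) (f i0).
  rewrite -e fi0 zj0 -fi0 zcoord_vert // g0 => /esym/eqP.
  by rewrite mulf_eq0 (negbTE (torus_neq0 _ tg)) => /eqP.
have inv (t : R) (x : V) : ch_dom C x ->
    chart_ham C (t, torus_act (fun i => if i == i0 then cexp al else 1) x) = chart_ham C (t, x).
  move=> Dx; have Gg := @vert_group_reflection R n m v c f i0 (ltnW c2).
  rewrite /chart_ham /lift /= /chart_proj /=.
  have -> : (fun i => if i == i0 then cexp al else 1) = reflection R c f i0 \o f.
    by apply/funext => i; rewrite /reflection /= (inj_eq f_inj).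
  by rewrite vert_group_act // orbit_act //; case: Gg.
have zg := rotation_plane_invariant al_small (@ch_dom_open _ _ _ _ _ C) (H_smooth C 2%N) inv.
have {}zg := zg t0 gamma _ zx0.
have {}zg : \forall t \near t0, zcoord (gamma t) i0 = 0.
  apply: zg; first by rewrite g0.
  by apply: filterS hg => t [].
apply: filterS2 hg zg => t [_ pg _] zg [x Dx px].
have [g [tg _] e] := orbit_eq (etrans px (esym pg)).
have := zcoord_act g (aa x) (f i0); rewrite -e zcoord_vert // zg => /esym/eqP.
by rewrite mulf_eq0 (negbTE (torus_neq0 _ tg)) (negbTE (aa_zcoord_neq0 _ _ Dx)).
Qed.

(** Regular times and singular times both form open sets, and time 0 is regular. *)
Lemma regular_preserved p (t : R) : toric_orbifold (n := n) b lambda p ->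
  regular p 0 -> 0 <= t <= 1 -> regular p t.
Proof.
move=> tp r0; move: t; apply: locally_constant_interval => // T _.
have [rT|rT] := pselect (regular p T).
  have /nbhs_normP[d /= d0 hd] := regular_open tp rT.
  by exists d => // s t _ _ _ tT _; apply: hd; rewrite /= distrC.
have /nbhs_normP[d /= d0 hd] := singular_open tp rT.
by exists d => // s t _ _ sT _ rs; exfalso; apply: (hd s) rs; rewrite /= distrC.
Qed.

Lemma on_flow_lattice p (gamma : R -> V) k (t : R) :
  on_flow p gamma t -> on_flow p (fun s => gamma s + lattice_vec R k) t.
Proof.
move=> [Dg pg dg]; split; [exact: D_lattice|by rewrite orb_lattice|].
rewrite ham_field_lattice //.
by have := is_deriveD dg (is_derive_cst (lattice_vec R k) t 1); rewrite addr0.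
Qed.

Lemma on_flow_near p (xs ys : R -> V) (t : R) : (\forall s \near t, xs s = ys s) ->
  on_flow p xs t -> on_flow p ys t.
Proof.
move=> e [Dx px dx]; have et : xs t = ys t by exact: (nbhs_singleton e).
by split; rewrite -et //; exact: is_derive_near dx.
Qed.

(** At time s both lifts lie over the same orbit, so they have the same u and angles differing by a
    period. Translating the second lift by this period makes them agree there; being solutions of
    the same periodic field, they have equal derivatives at the junction. *)
Lemma flow_extension p (xs gamma : R -> V) (s t : R) : 0 <= s -> s < t ->
  (forall r : R, 0 <= r <= s -> on_flow p xs r) ->
  (forall r : R, s <= r <= t -> on_flow p gamma r) ->
  exists2 ys : R -> V, ys 0 = xs 0 & forall r : R, 0 <= r <= t -> on_flow p ys r.
Proof.
move=> s0 st fx fg.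
have fxs : on_flow p xs s by apply: fx; rewrite s0 lexx.
have fgs : on_flow p gamma s by apply: fg; rewrite lexx ltW.
have [Dx px dx] := fxs; have [Dg pg dg] := fgs.
have [g Kg e] := orbit_eq (etrans pg (esym px)).
have [tg _] := Kg.
have el := aa_orbit_lsub hP Dg Dx tg e; have [k er] := aa_orbit_rsub hP hS Dg Dx Kg e.
have xg : xs s = gamma s + lattice_vec R k.
  by rewrite -[xs s]hsubmxK -[gamma s]hsubmxK el er /lattice_vec add_row_mx addr0.
pose ga (r : R) : V := gamma r + lattice_vec R k.
have fga (r : R) : s <= r <= t -> on_flow p ga r by move=> /fg; exact: on_flow_lattice.
pose ys (r : R) : V := if r < s then xs r else ga r.
exists ys.
  by rewrite /ys lt_neqAle s0 andbT; case: eqP => //= e0; rewrite /ga e0 -xg.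
move=> r /andP[r0 rt]; have [rs|rs|rs] := ltgtP r s.
- apply: on_flow_near (fx r _); last by rewrite r0 ltW.
  have : \forall q \near r, q < s by exact: lt_nbhsl.
  by apply: filterS => q qs; rewrite /ys qs.
- apply: on_flow_near (fga r _); last by rewrite ltW.
  have : \forall q \near r, s < q by exact: lt_nbhsr.
  by apply: filterS => q qs; rewrite /ys ltNge ltW.
have [Dga pga dga] : on_flow p ga s by apply: fga; rewrite lexx ltW.
rewrite rs; have yss : ys s = ga s by rewrite /ys ltxx.
split; rewrite ?yss //.
apply: is_derive_glue => //.
by rewrite /ga -xg.
Qed.

(** Local lifts come from the definition of an isotopy, and regularity at every time guarantees an
    action-angle chart around each T. The set of times up to which a lift exists is then handled by
    [locally_constant_interval]. *)
Lemma global_flow p (x0 : V) : toric_orbifold (n := n) b lambda p -> D x0 -> orb (aa x0) = p ->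
  exists2 xs : R -> V, xs 0 = x0 & forall t : R, 0 <= t <= 1 -> on_flow p xs t.
Proof.
move=> tp Dx0 px0; have [_ psi0 _] := psi_flow.
have px0' : orb (aa x0) = psi 0 p by rewrite psi0.
have reg0 : regular p 0 by exists x0.
pose A (T : R) := exists2 xs : R -> V, xs 0 = x0 & forall t : R, 0 <= t <= T -> on_flow p xs t.
suff : forall T : R, 0 <= T <= 1 -> A T by apply; rewrite ler01 lexx.
apply: locally_constant_interval; last first.
  have [gamma g0 hg] := aa_flow tp Dx0 px0'; exists gamma => // t /le_anti <-.
  exact: nbhs_singleton hg.
move=> T T01; have [x Dx px] := regular_preserved tp reg0 T01.
have [gamma gT /nbhs_normP[d /= d0 hd]] := aa_flow tp Dx px.
exists d => // s t /andP[s0 s1] /andP[t0 t1] sT tT [xs xs0 hxs].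
have [ts|st] := leP t s.
  by exists xs => // r /andP[r0 rt]; apply: hxs; rewrite r0 (le_trans rt ts).
have [|ys ys0 hys] := flow_extension s0 st hxs (gamma := gamma).
  move=> r /andP[sr rt]; apply: hd => /=; rewrite distrC.
  move: sT tT; rewrite !ltr_norml => /andP[h1 h2] /andP[h3 h4].
  by apply/andP; split; lra.
by exists ys; rewrite ?ys0.
Qed.

End Flow.

(** * The moment map in action-angle coordinates and non-displaceability *)

Lemma mu_T_aa (R : realType) (n m : nat) (P : set 'rV[R]_n) (v : 'I_m -> 'rV[int]_n)
    (c : 'I_m -> nat) (lambda : 'I_m -> R) (S : 'M[R]_(n, m)) (x : 'rV[R]_(n + n)) :
  labeled_simple_polytope P v c lambda ->
  positive_slack (real_normal R v c) lambda x ->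
  mu_T (labeled_normal v c) lambda (orbit (labeled_normal v c) (aa_map v c lambda S x)) = lsubmx x.
Proof.
move=> hP Dx; apply: xget_subset1 => [_ [g [tg _] <-] j|u u' hu hu'].
  by rewrite half_normsq_act // half_normsq_aa // /slack subrK.
apply/subr0_eq/(normals_span hP (D_polytope hP Dx)) => j.
have zz := orbit_refl (labeled_normal v c) (aa_map v c lambda S x).
by rewrite pairingDl pairingNl (hu _ zz) (hu' _ zz) subrr.
Qed.

Theorem proposition15p2 (R : realType) (n m : nat) (P : set 'rV[R]_n)
    (v : 'I_m -> 'rV[int]_n) (c : 'I_m -> nat) (lambda : 'I_m -> R)
    (hP : labeled_simple_polytope P v c lambda)
    (hc : forall i, (2 <= c i)%N)
    (u : 'rV[R]_n) (hu : (P°) u) :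
  non_displaceable (labeled_normal v c) lambda
    (torus_fiber (labeled_normal v c) lambda u).
Proof.
move=> H psi hH hpsi.
have Pu : P u := interior_subset hu.
have [S hS] := normal_mx_left_inverse hP Pu.
have [B hB] := polytope_bounded hP.
pose x0 (th : 'rV[R]_n) : 'rV[R]_(n + n) := row_mx u th.
have Dx0 th : positive_slack (real_normal R v c) lambda (x0 th).
  by move=> j; rewrite /slack row_mxKl subr_gt0; exact: (interior_slack hP hu).
pose p (x : 'rV[R]_(n + n)) := orbit (labeled_normal v c) (aa_map v c lambda S x).
have tp x : positive_slack (real_normal R v c) lambda x -> toric_orbifold (labeled_normal v c) lambda (p x).
  by move=> Dx; exists (aa_map v c lambda S x) => //; exact: aa_level.
have sol_ex th : exists xs : R -> 'rV[R]_(n + n), xs 0 = x0 th /\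
    forall t : R, 0 <= t <= 1 -> on_flow v c lambda S H psi (p (x0 th)) xs t.
  have [xs h0 h] := global_flow hP hc hS hH hpsi (tp _ (Dx0 th)) (Dx0 th) erefl.
  by exists xs.
have [sol hsol] := choice sol_ex.
have [th ret] : exists th, lsubmx (sol th 1) = u.
  apply: (@returning_trajectory R n m (real_normal R v c) lambda (aa_ham v c lambda S H) _ _ B).
  - exact: (aa_ham_smooth hP hS hH 2).
  - by move=> t x k _; exact: (@aa_ham_periodic R n m v c lambda S hS H).
  - by move=> x Dx; apply: hB; exact: (D_polytope hP Dx).
  by move=> th; have [h0 h] := hsol th; split=> // t /h[Dt _ dt].
have [_ /(_ 1)[|D1 p1 _]] := hsol th; first by rewrite ler01 lexx.
exists (psi 1 (p (x0 th))); split; last first.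
  by exists (p (x0 th)) => //; split; [exact: tp|rewrite (mu_T_aa S hP) // row_mxKl].
by rewrite -p1; split; [exact: tp|rewrite (mu_T_aa S hP) // ret].
Qed.
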